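(* Let $p\ge 1$ be a real number. Let $z>y\ge 1$ be integers and $0\le\alpha<1$ be such that the $(\alpha,z,y)$-Johnson Coverage problem is NP-hard. Then for every constant $\varepsilon>0$ there is a constant $\rho>0$ such that, given as input a point-set $\mathcal{P}\subset\mathbb{R}^d$ of size $n$ (with $d=O(\log n)$), a collection $\mathcal{C}\subset\mathbb{R}^d$ of $m$ candidate centers (with $m=\mathrm{poly}(n)$), and a parameter $k$, it is NP-hard to distinguish between the following two cases: - Completeness: there exist $\mathcal{C}'=\{c_1,\dots,c_k\}\subseteq\mathcal{C}$ and $\sigma:\mathcal{P}\to\mathcal{C}'$ such that $\sum_{a\in\mathcal{P}}\|a-\sigma(a)\|_p^2\le\rho\, n(\log n)^{2/p}$. - Soundness: for every $\mathcal{C}'=\{c_1,\dots,c_k\}\subseteq\mathcal{C}$ and every $\sigma:\mathcal{P}\to\mathcal{C}'$, $\sum_{a\in\mathcal{P}}\|a-\sigma(a)\|_p^2\ge(\zeta_2(p,z-y,\alpha)-\varepsilon)\cdot\rho\, n(\log n)^{2/p}$.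
   Context: $(\alpha,z,y)$-Johnson Coverage problem ($z>y\ge1$): given a universe $U=[n]=\{1,\dots,n\}$, a collection $E\subseteq\binom{[n]}{z}$ of $z$-element subsets, and a parameter $k$, distinguish between: (Completeness) there are $S_1,\dots,S_k\in\binom{[n]}{y}$ such that every $T\in E$ contains some $S_i$; (Soundness) for all $S_1,\dots,S_k\in\binom{[n]}{y}$, the number of $T\in E$ containing at least one $S_i$ is at most $\alpha|E|$. For integers $q\ge t\ge r\geq 1$, $J(q,t,r)$ is the bipartite graph with parts $\binom{[q]}{t}$ and $\binom{[q]}{r}$ in which $S\in\binom{[q]}{t}$ and $S'\in\binom{[q]}{r}$ are adjacent iff $S'\subseteq S$. For a bipartite graph $G=(A\dot\cup B,E)$ and $\lambda\ge1$, a map $\tau:A\cup B\to\mathbb{R}^d$ $\lambda$-gap-realizes $G$ in the $\ell_p$-metric if for some $\beta>0$: $\|\tau(u)-\tau(v)\|_p=\beta$ for all $(u,v)\in E$, and $\|\tau(u)-\tau(v)\|_p\ge\lambda\beta$ for all $(u,v)\in(A\times B)\setminus E$; moreover $\tau$ is required to be computable in time polynomial in the size of $G$. The gap number $g_p(G)$ is the largest $\lambda$ for which some map $\lambda$-gap-realizes $G$ in a $d$-dimensional $\ell_p$-metric space with $d\le\mathrm{poly}(|A|+|B|)$. For $\Delta\ge1$, $\gamma_{p,\Delta}:=\inf_{q\ge t\ge\Delta+1}g_p(J(q,t,t-\Delta))$, and $\zeta_2(p,\Delta,\alpha):=1+(1-\alpha)(\gamma_{p,\Delta}^2-1)$. 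*)

(* Defs.v *)
From HB Require Import structures.
From Corelib Require Import BinNums.
From mathcomp Require Import all_boot all_order all_algebra.
From mathcomp Require Import all_classical all_reals all_analysis.
Set Implicit Arguments.
Unset Strict Implicit.
Unset Printing Implicit Defensive.
Import Order.TTheory GRing.Theory Num.Theory.

(** * Polynomial time and NP-hardness

    The machine model is the WHILE language over binary trees (N. D. Jones,
    "Computability and Complexity from a Programming Perspective").  Evaluating
    an expression is charged the total size of all the values it produces,
    copies included, so that there is no free sharing and the cost is
    polynomially related to the running time of a multi-tape Turing machine. *)

Inductive tree := Leaf | Node of tree & tree.

Fixpoint tsize (t : tree) : nat :=
  if t is Node l r then (tsize l + tsize r).+1 else 1%N.

Definition thead (t : tree) : tree := if t is Node l _ then l else Leaf.
Definition ttail (t : tree) : tree := if t is Node _ r then r else Leaf.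

Fixpoint teqb (t u : tree) : bool :=
  match t, u with
  | Leaf, Leaf => true
  | Node a b, Node c d => teqb a c && teqb b d
  | _, _ => false
  end.

Definition enc_bool (b : bool) : tree := if b then Node Leaf Leaf else Leaf.
Definition truthy (t : tree) : bool := if t is Node _ _ then true else false.

Inductive expr :=
  | Var of nat
  | Nil
  | Cons of expr & expr
  | Hd of expr
  | Tl of expr
  | Eq of expr & expr.

Inductive cmd :=
  | Assign of nat & expr
  | Seq of cmd & cmd
  | If of expr & cmd & cmd
  | While of expr & cmd.

Definition store := nat -> tree.

Definition update (s : store) (x : nat) (t : tree) : store :=
  fun y => if y == x then t else s y.

Fixpoint eval (s : store) (a : expr) : tree :=
  match a with
  | Var x => s x
  | Nil => Leaf
  | Cons b c => Node (eval s b) (eval s c)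
  | Hd b => thead (eval s b)
  | Tl b => ttail (eval s b)
  | Eq b c => enc_bool (teqb (eval s b) (eval s c))
  end.

Fixpoint ecost (s : store) (a : expr) : nat :=
  (tsize (eval s a) +
   match a with
   | Var _ | Nil => 0
   | Cons b c | Eq b c => ecost s b + ecost s c
   | Hd b | Tl b => ecost s b
   end)%N.

(** [exec c s s' n]: started in [s], [c] halts in [s'] after time [n]. *)
Inductive exec : cmd -> store -> store -> nat -> Prop :=
  | exec_assign s x a :
      exec (Assign x a) s (update s x (eval s a)) (ecost s a)
  | exec_seq c1 c2 s1 s2 s3 n1 n2 :
      exec c1 s1 s2 n1 -> exec c2 s2 s3 n2 ->
      exec (Seq c1 c2) s1 s3 (n1 + n2)
  | exec_if a c1 c2 s s' n :
      exec (if truthy (eval s a) then c1 else c2) s s' n ->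
      exec (If a c1 c2) s s' (ecost s a + n)
  | exec_while_stop a c s :
      ~~ truthy (eval s a) -> exec (While a c) s s (ecost s a)
  | exec_while_step a c s1 s2 s3 n1 n2 :
      truthy (eval s1 a) -> exec c s1 s2 n1 -> exec (While a c) s2 s3 n2 ->
      exec (While a c) s1 s3 (ecost s1 a + n1 + n2).

(** Input and output are in variable 0; all other variables start empty. *)
Definition runs (c : cmd) (x y : tree) (n : nat) : Prop :=
  exists s, exec c (update (fun=> Leaf) 0%N x) s n /\ s 0%N = y.

(** Every polynomial is dominated by one of these. *)
Definition polyb (e n : nat) : nat := (n ^ e + e)%N.

Definition poly_time (f : tree -> tree) : Prop :=
  exists c e, forall x, exists2 n, runs c x (f x) n & (n <= polyb e (tsize x))%N.

Definition in_NP (L : tree -> Prop) : Prop :=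
  exists (V : tree -> tree) (e : nat), poly_time V /\
    forall x, L x <->
      exists2 w, (tsize w <= polyb e (tsize x))%N & truthy (V (Node x w)).

(** NP-hardness (under Karp reductions) of distinguishing [yes] from [no]. *)
Definition NP_hard (yes no : tree -> Prop) : Prop :=
  forall L, in_NP L -> exists2 f, poly_time f &
    forall x, (L x -> yes (f x)) /\ (~ L x -> no (f x)).

(** * Encodings *)

Definition enc_seq (T : Type) (enc : T -> tree) (s : seq T) : tree :=
  foldr (fun a t => Node (enc a) t) Leaf s.

Definition enc_unary (n : nat) : tree := iter n (Node Leaf) Leaf.

Fixpoint bits_pos (m : positive) : seq bool :=
  match m with
  | xH => [:: true]
  | xO m' => false :: bits_pos m'
  | xI m' => true :: bits_pos m'
  end.

(** Binary, least significant bit first. *)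
Definition enc_nat (n : nat) : tree :=
  enc_seq enc_bool (if bin_of_nat n is Npos m then bits_pos m else [::]).

Local Open Scope classical_set_scope.
Local Open Scope ring_scope.

Definition enc_int (m : int) : tree := Node (enc_bool (m < 0)) (enc_nat `|m|%N).

Definition enc_rat (r : rat) : tree := Node (enc_int (numq r)) (enc_int (denq r)).

Definition enc_vec (d : nat) (v : 'rV[rat]_d) : tree :=
  enc_seq (fun i => enc_rat (v 0 i)) (enum 'I_d).

(** * The Johnson Coverage problem *)

(** The universe [n] is ['I_n]; [jc_E] lists the collection E. *)
Record jc_instance := JCInstance {
  jc_n : nat;
  jc_E : seq {set 'I_jc_n};
  jc_k : nat }.

(** E is nonempty: for empty E both cases would hold simultaneously. *)
Definition jc_valid (z : nat) (I : jc_instance) : Prop :=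
  [/\ uniq (jc_E I), jc_E I <> [::] & forall T, T \in jc_E I -> #|T| = z].

(** The universe is given explicitly, hence its size is in unary. *)
Definition enc_jc (I : jc_instance) : tree :=
  Node (enc_unary (jc_n I))
    (Node (enc_seq (fun T : {set 'I_(jc_n I)} =>
             enc_seq (fun i : 'I_(jc_n I) => enc_nat i) (enum T)) (jc_E I))
          (enc_nat (jc_k I))).

Definition jc_complete (y : nat) (I : jc_instance) : Prop :=
  exists S : 'I_(jc_k I) -> {set 'I_(jc_n I)},
    (forall i, #|S i| = y) /\
    (forall T, T \in jc_E I -> exists i, S i \subset T).

Definition jc_sound (R : realType) (alpha : R) (y : nat) (I : jc_instance) : Prop :=
  forall S : 'I_(jc_k I) -> {set 'I_(jc_n I)},
    (forall i, #|S i| = y) ->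
    (count (fun T : {set 'I_(jc_n I)} => [exists i, S i \subset T]) (jc_E I))%:R
      <= alpha * (size (jc_E I))%:R.

Definition jc_yes (z y : nat) (t : tree) : Prop :=
  exists I, [/\ t = enc_jc I, jc_valid z I & jc_complete y I].

Definition jc_no (R : realType) (alpha : R) (z y : nat) (t : tree) : Prop :=
  exists I, [/\ t = enc_jc I, jc_valid z I & jc_sound alpha y I].

Definition johnson_coverage_NP_hard (R : realType) (alpha : R) (z y : nat) : Prop :=
  NP_hard (jc_yes z y) (jc_no alpha z y).

(** * Gap numbers of bipartite graphs *)

Definition lp_norm (R : realType) (p : R) (d : nat) (v : 'rV[R]_d) : R :=
  (\sum_(i < d) `|v 0 i| `^ p) `^ p^-1.

Record bigraph := BiGraph {
  lside : finType;
  rside : finType;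
  edge : lside -> rside -> bool }.

Definition vertex (G : bigraph) : finType := (lside G + rside G)%type.

Definition johnson_graph (q t r : nat) : bigraph :=
  @BiGraph {S : {set 'I_q} | #|S| == t} {S : {set 'I_q} | #|S| == r}
           (fun S S' => val S' \subset val S).

(** Adjacency matrix. *)
Definition enc_graph (G : bigraph) : tree :=
  enc_seq (fun u : lside G =>
    enc_seq (fun v : rside G => enc_bool (edge u v)) (enum (rside G)))
  (enum (lside G)).

(** A real-valued map is computed by producing, for every requested precision
    2^-s, rational approximations of all coordinates of all vertices. *)
Definition computes_map (R : realType) (G : bigraph) (d : nat)
    (tau : vertex G -> 'rV[R]_d) (c : cmd) (e : nat) : Prop :=
  forall s : nat,
    let input := Node (enc_graph G) (enc_unary s) in
    exists (a : vertex G -> 'rV[rat]_d) (n : nat),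
      [/\ runs c input (enc_seq (fun x => enc_vec (a x)) (enum (vertex G))) n,
          (n <= polyb e (tsize input))%N
        & forall x i, `|ratr (a x 0 i) - tau x 0 i| <= 2 ^- s].

Definition gap_realizes (R : realType) (p lambda : R) (G : bigraph) (d : nat)
    (tau : vertex G -> 'rV[R]_d) : Prop :=
  (exists2 beta : R, 0 < beta &
     forall (u : lside G) (v : rside G),
       if edge u v then lp_norm p (tau (inl u) - tau (inr v)) = beta
       else lambda * beta <= lp_norm p (tau (inl u) - tau (inr v)))
  /\ exists c e, computes_map tau c e.

(** The supremum is +oo when every pair of vertices is an edge.  The polynomial
    bounds (here, and on the running time in [gap_realizes]) are those of the
    single graph [G]; a bound uniform in [G] could only make the gap number
    smaller. *)
Definition gap_number (R : realType) (p : R) (G : bigraph) : \bar R :=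
  ereal_sup [set lambda%:E | lambda in [set lambda : R | 1 <= lambda /\
    exists (d e : nat) (tau : vertex G -> 'rV[R]_d),
      (d <= polyb e (#|lside G| + #|rside G|))%N /\ gap_realizes p lambda tau]].

(** Finite for Delta >= 1, although the gap numbers with q = t are not. *)
Definition gamma (R : realType) (p : R) (Delta : nat) : \bar R :=
  ereal_inf [set x | exists q t : nat,
    [/\ (Delta + 1 <= t)%N, (t <= q)%N
      & x = gap_number p (johnson_graph q t (t - Delta))]].

Definition zeta2 (R : realType) (p : R) (Delta : nat) (alpha : R) : R :=
  1 + (1 - alpha) * (fine (gamma p Delta) ^+ 2 - 1).

(** * The gap version of k-means with candidate centers *)

(** Point sets are listed; as inputs they have rational coordinates. *)
Record km_instance := KMInstance {
  km_d : nat;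
  km_P : seq 'rV[rat]_km_d;
  km_C : seq 'rV[rat]_km_d;
  km_k : nat }.

Definition enc_km (I : km_instance) : tree :=
  Node (enc_seq (@enc_vec (km_d I)) (km_P I))
    (Node (enc_seq (@enc_vec (km_d I)) (km_C I)) (enc_nat (km_k I))).

(** [D] and [K] are the constants in d = O(log n) and m = poly(n).  For n = 1
    the cost thresholds vanish and both cases could hold simultaneously. *)
Definition km_valid (R : realType) (D K : nat) (I : km_instance) : Prop :=
  let n := size (km_P I) in
  [/\ uniq (km_P I), uniq (km_C I), (2 <= n)%N,
      (km_d I)%:R <= D%:R * ln (n%:R : R)
    & (size (km_C I) <= polyb K n)%N].

Definition km_cost (R : realType) (p : R) (I : km_instance)
    (sigma : 'rV[rat]_(km_d I) -> 'rV[rat]_(km_d I)) : R :=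
  \sum_(a <- km_P I) lp_norm p (map_mx ratr a - map_mx ratr (sigma a)) ^+ 2.

Definition km_threshold (R : realType) (p rho : R) (I : km_instance) : R :=
  let n := size (km_P I) in rho * n%:R * ln n%:R `^ (2 / p).

(** [C'] lists c_1, ..., c_k, and [sigma] maps P into C'. *)
Definition km_solution (I : km_instance) (C' : seq 'rV[rat]_(km_d I))
    (sigma : 'rV[rat]_(km_d I) -> 'rV[rat]_(km_d I)) : Prop :=
  [/\ size C' = km_k I, {subset C' <= km_C I}
    & forall a, a \in km_P I -> sigma a \in C'].

Definition km_yes (R : realType) (p : R) (D K : nat) (rho : R) (t : tree) : Prop :=
  exists I, [/\ t = enc_km I, @km_valid R D K I
    & exists C' (sigma : 'rV_(km_d I) -> 'rV_(km_d I)), km_solution C' sigma /\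
        km_cost p sigma <= km_threshold p rho I].

Definition km_no (R : realType) (p : R) (D K : nat) (rho zeta : R) (t : tree) : Prop :=
  exists I, [/\ t = enc_km I, @km_valid R D K I
    & forall C' (sigma : 'rV_(km_d I) -> 'rV_(km_d I)), km_solution C' sigma ->
        zeta * km_threshold p rho I <= km_cost p sigma].

(* Main.v *)
(** The universe is the set of the first [n] integers, and [b = O(log n)] is the
    length of [n] in binary.  A greedy code assigns to every element a word of
    length [b] over an alphabet of [4 ^ r] letters, so that two distinct elements
    agree in less than [b / r] positions.  In position [i] a [z]-set and a [y]-set
    of elements become sets of letters; outside of the few positions with a
    collision their sizes and the inclusion between them are preserved, and a
    rational approximation of a gap realization of J(4 ^ r, z, y), scaled so that
    adjacent vertices are at distance 1, embeds the two sets of letters.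
    Concatenating over all positions makes the distance of a set [T] of the
    collection to a center [S] close to [b ^ (1 / p)] if [S] is contained in [T],
    and at least about [lam * b ^ (1 / p)] otherwise.  At a position with a
    collision the distance is at most a constant independent of [r], because the
    diameter of J(q, z, y) does not depend on [q].  Every [T] is repeated once for
    each word of length [b], with the word appended as a short tag: the number [N]
    of points is then |E| * 4 ^ (r b), whence [ln N] is [2 r b ln 2] up to a
    factor close to 1, and no logarithm has to be computed.  The gadget depends on
    the constants only, so that the reduction contains it as a finite table. *)

From HB Require Import structures.
From Corelib Require Import BinNums PosDef.
From mathcomp Require Import all_boot all_order all_algebra zify.
From mathcomp Require Import all_classical all_reals all_analysis.
From mathcomp Require Import ring lra.
Require Import Defs.
Set Implicit Arguments.
Unset Strict Implicit.
Unset Printing Implicit Defensive.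
Import Order.TTheory GRing.Theory Num.Theory.

(** * Polynomial-time computation *)

(** Distances are estimated through their p-th powers, which add up under concatenation; the
    exponent 2/p is applied only at the end. The obstacle is the order of the constants. Collisions
    occur in a fraction of at most (z + y)^2 / r of the positions, and each may add up to [M]. So
    [r] must be large compared with [M], although [M] bounds distances in a gadget on 4^r letters;
    the uniform diameter bound breaks this circle. Then eps gives [th], [th] and [M] give [r] and
    the tag scale [m], these give the gadget with its dimension [d] and gap [lam], and [d] gives the
    constant in the dimension bound. The copies of each [T] are needed because the threshold is
    stated through log n whereas the cost is governed by b: ln |E| can be anything from 0 to z b ln
    2, which is negligible only next to 2 r b ln 2. In the soundness case, in units of b^(2/p), at
    most alpha |E| sets cost about 1 and all others about lam^2 or more. The average is therefore
    about 1 + (1 - alpha) (lam^2 - 1) or more, which is zeta up to the loss between lam and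
    gamma. *)

Lemma teqbP : Equality.axiom teqb.
Proof.
elim=> [|a IHa b IHb] [|c d] /=; try by constructor.
by apply: (iffP andP) => [[/IHa -> /IHb ->]|[<- <-]] //; split; [apply/IHa|apply/IHb].
Qed.

HB.instance Definition _ := hasDecEq.Build tree teqbP.

Lemma tsize_gt0 t : 0 < tsize t.
Proof. by case: t. Qed.

Lemma leq_expl m n e : m <= n -> m ^ e <= n ^ e.
Proof. by case: e => // e mn; rewrite leq_exp2r. Qed.

(** The base is at least 2, so constants and sums can be absorbed into the single exponent. *)
Definition pbound (A : Type) (D : A -> Prop) (h f : A -> nat) : Prop :=
  exists e, forall a, D a -> f a <= (h a + 2) ^ e.

Lemma pbound_le A (D : A -> Prop) h f g :
  pbound D h g -> (forall a, D a -> f a <= g a) -> pbound D h f.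
Proof. by move=> [e He] fg; exists e => a Da; apply: leq_trans (fg a Da) (He a Da). Qed.

Lemma pbound_const A (D : A -> Prop) h c : pbound D h (fun=> c).
Proof.
exists c => a _; apply: leq_trans (ltnW (ltn_expl c (isT : 1 < 2))) _.
by apply: leq_expl; rewrite leq_addl.
Qed.

Lemma pbound_id A (D : A -> Prop) h : pbound D h h.
Proof. by exists 1 => a _; rewrite expn1 leq_addr. Qed.

Lemma pbound_mul A (D : A -> Prop) h f g :
  pbound D h f -> pbound D h g -> pbound D h (fun a => f a * g a).
Proof.
move=> [e He] [e' He']; exists (e + e') => a Da.
by rewrite expnD leq_mul ?He ?He'.
Qed.

Lemma pbound_add A (D : A -> Prop) h f g :
  pbound D h f -> pbound D h g -> pbound D h (fun a => f a + g a).
Proof.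
move=> [e He] [e' He']; exists (e + e').+1 => a Da.
have h2 : 0 < h a + 2 by lia.
have h1 : f a <= (h a + 2) ^ (e + e').
  by apply: leq_trans (He a Da) _; rewrite leq_pexp2l ?leq_addr.
have h1' : g a <= (h a + 2) ^ (e + e').
  by apply: leq_trans (He' a Da) _; rewrite leq_pexp2l ?leq_addl.
by rewrite expnS; nia.
Qed.

Lemma pbound_exp A (D : A -> Prop) h f c :
  pbound D h f -> pbound D h (fun a => f a ^ c).
Proof.
move=> [e He]; exists (e * c) => a Da.
by rewrite expnM leq_expl ?He.
Qed.

Ltac pbounds := repeat first
  [ assumption | apply: pbound_add | apply: pbound_mul | apply: pbound_exp
  | apply: pbound_const | apply: pbound_id ].

(* [ptime D u v]: on [D], [v a] is computed from [u a] in polynomial time, by a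
   program that works in any register [k], whatever the contents of the registers
   above [k], and preserves those below [k]. *)
Definition ptime (A : Type) (D : A -> Prop) (u v : A -> tree) : Prop :=
  exists e, forall k, exists c, forall a s, D a -> s k = u a ->
    exists s' n, [/\ exec c s s' n, s' k = v a,
      forall j, j < k -> s' j = s j & n <= (tsize (u a) + 2) ^ e].

Lemma ecost_size s a : tsize (eval s a) <= ecost s a.
Proof. by case: a => [?||? ?|?|?|? ?] /=; lia. Qed.

Lemma exec_size c s s' n : exec c s s' n -> forall j, tsize (s' j) <= tsize (s j) + n.
Proof.
elim=> {c s s' n} [s x a|c1 c2 s1 s2 s3 n1 n2 _ IH1 _ IH2|a c1 c2 s s' n _ IH||
    a c s1 s2 s3 n1 n2 _ _ IH1 _ IH2] j.
- by rewrite /update; case: eqP => _; have := ecost_size s a; lia.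
- by have := IH1 j; have := IH2 j; lia.
- by have := IH j; lia.
- by move=> *; lia.
- by have := IH1 j; have := IH2 j; lia.
Qed.

(** A program pays for the size of every value that it writes ([exec_size]), so a time bound is also
    a bound on the output. This keeps compositions polynomial. *)
Lemma ptime_size A (D : A -> Prop) u v : ptime D u v -> pbound D (tsize \o u) (tsize \o v).
Proof.
move=> [e He]; have [c Hc] := He 0.
apply: (@pbound_le _ _ _ _ (fun a => (tsize \o u) a + ((tsize \o u) a + 2) ^ e)).
  by pbounds.
move=> a Da; have [s' [n [Hx /= <- _ Hn]]] := Hc a (fun=> u a) Da erefl.
by have /= := exec_size Hx 0; lia.
Qed.

(* The exponent must not depend on [k], hence the bound is chosen first. *)
Lemma ptimeI A (D : A -> Prop) (u v : A -> tree) (g : A -> nat) :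
  pbound D (tsize \o u) g ->
  (forall k, exists c, forall a s, D a -> s k = u a ->
    exists s' n, [/\ exec c s s' n, s' k = v a,
      forall j, j < k -> s' j = s j & n <= g a]) -> ptime D u v.
Proof.
move=> [e He] H; exists e => k; have [c Hc] := H k; exists c => a s Da sk.
have [s' [n [H1 H2 H3 H4]]] := Hc a s Da sk.
by exists s', n; split => //; apply: leq_trans H4 (He a Da).
Qed.

Lemma updateE s x t : update s x t x = t.
Proof. by rewrite /update eqxx. Qed.

Lemma updateN s x t j : j != x -> update s x t j = s j.
Proof. by rewrite /update => /negbTE ->. Qed.

Lemma ptime_eq A (D : A -> Prop) u v w :
  ptime D u v -> (forall a, D a -> v a = w a) -> ptime D u w.
Proof.
move=> [e He] vw; exists e => k; have [c Hc] := He k; exists c => a s Da sk.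
have [s' [n [H1 H2 H3 H4]]] := Hc a s Da sk.
by exists s', n; split => //; rewrite H2 vw.
Qed.

Lemma ptime_sub A A' (D : A -> Prop) (D' : A' -> Prop) (j : A' -> A) u v :
  ptime D u v -> (forall a, D' a -> D (j a)) -> ptime D' (u \o j) (v \o j).
Proof.
move=> [e He] DD; exists e => k; have [c Hc] := He k; exists c => a s Da sk.
exact: Hc (DD _ Da) sk.
Qed.

Lemma ptime_expr A (D : A -> Prop) u v (x : nat -> expr) (g : A -> nat) :
  pbound D (tsize \o u) g ->
  (forall a k s, D a -> s k = u a -> eval s (x k) = v a /\ ecost s (x k) <= g a) ->
  ptime D u v.
Proof.
move=> bg H; apply: (ptimeI bg) => k; exists (Assign k (x k)) => a s Da sk.
have [Hv Hc] := H a k s Da sk.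
exists (update s k (eval s (x k))), (ecost s (x k)); split=> //.
- exact: exec_assign.
- by rewrite updateE.
- by move=> j jk; rewrite updateN //; lia.
Qed.

Lemma ptime_refl A (D : A -> Prop) u : ptime D u u.
Proof.
apply: (@ptime_expr _ _ _ _ Var (tsize \o u)); first by pbounds.
by move=> a k s _ /= ->; split => //; lia.
Qed.

Lemma ptime_trans A (D : A -> Prop) u v w : ptime D u v -> ptime D v w -> ptime D u w.
Proof.
move=> uv; have bv := ptime_size uv.
move: uv => [e1 H1] [e2 H2].
apply: (@ptimeI _ _ _ _ (fun a => ((tsize \o u) a + 2) ^ e1 + ((tsize \o v) a + 2) ^ e2)).
  by pbounds.
move=> k; have [c1 Hc1] := H1 k; have [c2 Hc2] := H2 k; exists (Seq c1 c2) => a s Da sk.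
have [s1 [n1 [X1 Y1 Z1 W1]]] := Hc1 a s Da sk.
have [s2 [n2 [X2 Y2 Z2 W2]]] := Hc2 a s1 Da Y1.
exists s2, (n1 + n2); split=> //; first exact: exec_seq X1 X2.
- by move=> j jk; rewrite Z2 ?Z1.
- by rewrite leq_add.
Qed.

Lemma ptime_hd A (D : A -> Prop) u v : ptime D u v -> ptime D u (fun a => thead (v a)).
Proof.
move=> /ptime_trans; apply.
apply: (@ptime_expr _ _ _ _ (fun k => Hd (Var k)) (fun a => (tsize \o v) a * 3)).
  by pbounds.
move=> a k s _ /= ->; split => //.
by case: (v a) => /= *; lia.
Qed.

Lemma ptime_tl A (D : A -> Prop) u v : ptime D u v -> ptime D u (fun a => ttail (v a)).
Proof.
move=> /ptime_trans; apply.
apply: (@ptime_expr _ _ _ _ (fun k => Tl (Var k)) (fun a => (tsize \o v) a * 3)).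
  by pbounds.
move=> a k s _ /= ->; split => //.
by case: (v a) => /= *; lia.
Qed.

(** The two programs are instantiated at registers [k.+1] and [k.+2]: each preserves what lies
    below, so the input in [k] and the first result in [k.+1] survive. *)
Lemma ptime_pair A (D : A -> Prop) u v w :
  ptime D u v -> ptime D u w -> ptime D u (fun a => Node (v a) (w a)).
Proof.
move=> uv uw; have bv := ptime_size uv; have bw := ptime_size uw.
move: uv uw => [e1 H1] [e2 H2].
apply: (@ptimeI _ _ _ _ (fun a => ((tsize \o u) a + 2) ^ e1 + ((tsize \o u) a + 2) ^ e2
   + 2 * (tsize \o u) a + 2 * (tsize \o v) a + 2 * (tsize \o w) a + 1)).
  by pbounds.
move=> k; have [c1 Hc1] := H1 k.+1; have [c2 Hc2] := H2 k.+2.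
exists (Seq (Assign k.+1 (Var k)) (Seq c1 (Seq (Assign k.+2 (Var k)) (Seq c2
  (Assign k (Cons (Var k.+1) (Var k.+2))))))) => a s Da sk.
have [s1 [n1 [X1 Y1 Z1 W1]]] := Hc1 a (update s k.+1 (s k)) Da ltac:(by rewrite updateE).
have s1k : s1 k = u a by rewrite Z1 ?updateN //; lia.
have [s2 [n2 [X2 Y2 Z2 W2]]] := Hc2 a (update s1 k.+2 (s1 k)) Da ltac:(by rewrite updateE).
have s2k : s2 k.+1 = v a by rewrite Z2 ?updateN ?Y1 //; lia.
eexists; eexists; split.
- apply: exec_seq; first exact: exec_assign.
  apply: exec_seq; first exact: X1.
  apply: exec_seq; first exact: exec_assign.
  apply: exec_seq; first exact: X2.
  exact: exec_assign.
- by rewrite updateE /= s2k Y2.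
- move=> j jk; rewrite updateN ?Z2 ?updateN ?Z1 ?updateN //; lia.
- by rewrite /= sk s1k s2k Y2; move: W1 W2 => /=; lia.
Qed.

Lemma ptime_const A (D : A -> Prop) u t : ptime D u (fun=> t).
Proof.
elim: t => [|t1 IH1 t2 IH2]; last exact: ptime_pair IH1 IH2.
apply: (@ptime_expr _ _ _ _ (fun=> Nil) (fun=> 1)); first by pbounds.
by move=> a k s _ _ /=.
Qed.

Lemma ptime_eqb A (D : A -> Prop) u v w :
  ptime D u v -> ptime D u w -> ptime D u (fun a => enc_bool (v a == w a)).
Proof.
move=> uv uw; apply: (ptime_trans (ptime_pair uv uw)).
apply: (@ptime_expr _ _ _ _ (fun k => Eq (Hd (Var k)) (Tl (Var k)))
  (fun a => 3 + 4 * (tsize \o (fun a => Node (v a) (w a))) a)).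
  by pbounds.
move=> a k s _ /= -> /=; split => //.
by have : tsize (enc_bool (teqb (v a) (w a))) <= 3 by [case: teqb]; lia.
Qed.

Lemma ptime_if A (D : A -> Prop) u (b : A -> bool) v w :
  ptime D u (fun a => enc_bool (b a)) ->
  ptime (fun a => D a /\ b a) u v -> ptime (fun a => D a /\ ~~ b a) u w ->
  ptime D u (fun a => if b a then v a else w a).
Proof.
move=> [e0 H0] [e1 H1] [e2 H2].
apply: (@ptimeI _ _ _ _ (fun a => ((tsize \o u) a + 2) ^ e0 + ((tsize \o u) a + 2) ^ e1 +
   ((tsize \o u) a + 2) ^ e2 + (tsize \o u) a + 5)).
  by pbounds.
move=> k; have [c0 Hc0] := H0 k.+1; have [c1 Hc1] := H1 k; have [c2 Hc2] := H2 k.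
exists (Seq (Assign k.+1 (Var k)) (Seq c0 (If (Var k.+1) c1 c2))) => a s Da sk.
have [s0 [n0 [X0 Y0 Z0 W0]]] := Hc0 a (update s k.+1 (s k)) Da ltac:(by rewrite updateE).
have s0k : s0 k = u a by rewrite Z0 ?updateN //; lia.
case ba: (b a) in Y0 *.
- have [s1 [n1 [X1 Y1 Z1 W1]]] := Hc1 a s0 (conj Da ba) s0k.
  eexists; eexists; split.
  + apply: exec_seq; first exact: exec_assign.
    apply: exec_seq; first exact: X0.
    by apply: exec_if; rewrite /= Y0; exact: X1.
  + exact: Y1.
  + by move=> j jk; rewrite Z1 ?Z0 ?updateN //; lia.
  + by rewrite /= sk Y0 /=; move: W0 W1 => /=; lia.
- have [s1 [n1 [X1 Y1 Z1 W1]]] := Hc2 a s0 (conj Da (negbT ba)) s0k.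
  eexists; eexists; split.
  + apply: exec_seq; first exact: exec_assign.
    apply: exec_seq; first exact: X0.
    by apply: exec_if; rewrite /= Y0; exact: X1.
  + exact: Y1.
  + by move=> j jk; rewrite Z1 ?Z0 ?updateN //; lia.
  + by rewrite /= sk Y0 /=; move: W0 W1 => /=; lia.
Qed.

(** * Relocating an arbitrary program to higher registers *)

Fixpoint shift_expr k (a : expr) : expr :=
  match a with
  | Var x => Var (x + k)
  | Nil => Nil
  | Cons b c => Cons (shift_expr k b) (shift_expr k c)
  | Hd b => Hd (shift_expr k b)
  | Tl b => Tl (shift_expr k b)
  | Eq b c => Eq (shift_expr k b) (shift_expr k c)
  end.

Fixpoint shift_cmd k (c : cmd) : cmd :=
  match c with
  | Assign x a => Assign (x + k) (shift_expr k a)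
  | Seq c1 c2 => Seq (shift_cmd k c1) (shift_cmd k c2)
  | If a c1 c2 => If (shift_expr k a) (shift_cmd k c1) (shift_cmd k c2)
  | While a c => While (shift_expr k a) (shift_cmd k c)
  end.

Fixpoint expr_below M (a : expr) : bool :=
  match a with
  | Var x => x < M
  | Nil => true
  | Cons b c | Eq b c => expr_below M b && expr_below M c
  | Hd b | Tl b => expr_below M b
  end.

Fixpoint cmd_below M (c : cmd) : bool :=
  match c with
  | Assign x a => (x < M) && expr_below M a
  | Seq c1 c2 => cmd_below M c1 && cmd_below M c2
  | If a c1 c2 => [&& expr_below M a, cmd_below M c1 & cmd_below M c2]
  | While a c => expr_below M a && cmd_below M c
  end.

Lemma expr_below_le M N a : M <= N -> expr_below M a -> expr_below N a.
Proof.
move=> MN; elim: a => //= [x xM|b IHb c IHc /andP[/IHb -> /IHc ->]|b IHb c IHc /andP[/IHb ->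
  /IHc ->]] //.
exact: leq_trans MN.
Qed.

Lemma cmd_below_le M N c : M <= N -> cmd_below M c -> cmd_below N c.
Proof.
move=> MN; elim: c => /= [x a|c1 IH1 c2 IH2|a c1 IH1 c2 IH2|a c IH].
- by move=> /andP[xM aM]; rewrite (leq_trans xM MN) (expr_below_le MN aM).
- by move=> /andP[/IH1 -> /IH2 ->].
- by move=> /and3P[/(expr_below_le MN) -> /IH1 -> /IH2 ->].
- by move=> /andP[/(expr_below_le MN) -> /IH ->].
Qed.

Lemma expr_below_ex a : exists M, expr_below M a.
Proof.
elim: a => [x||b [M HM] c [N HN]|b [M HM]|b [M HM]|b [M HM] c [N HN]] /=.
- by exists x.+1.
- by exists 0.
- by exists (M + N); rewrite (expr_below_le _ HM) ?(expr_below_le _ HN) //; lia.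
- by exists M.
- by exists M.
- by exists (M + N); rewrite (expr_below_le _ HM) ?(expr_below_le _ HN) //; lia.
Qed.

Lemma cmd_below_ex c : exists M, cmd_below M c.
Proof.
elim: c => [x a|c1 [M HM] c2 [N HN]|a c1 [M HM] c2 [N HN]|a c [M HM]] /=.
- have [M HM] := expr_below_ex a; exists (M + x.+1).
  by rewrite (expr_below_le _ HM) ?leq_addr //; lia.
- by exists (M + N); rewrite (cmd_below_le _ HM) ?(cmd_below_le _ HN) //; lia.
- have [P HP] := expr_below_ex a; exists (M + N + P).
  by rewrite (cmd_below_le _ HM) ?(cmd_below_le _ HN) ?(expr_below_le _ HP) //; lia.
- have [P HP] := expr_below_ex a; exists (M + P).
  by rewrite (cmd_below_le _ HM) ?(expr_below_le _ HP) //; lia.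
Qed.

Definition sim M k (s t : store) := forall j, j < M -> t (j + k) = s j.

Lemma eval_shift M k s t a : sim M k s t -> expr_below M a ->
  eval t (shift_expr k a) = eval s a /\ ecost t (shift_expr k a) = ecost s a.
Proof.
move=> st; elim: a => [x||b IHb c IHc|b IHb|b IHb|b IHb c IHc] //=.
- by move=> xM; rewrite st.
- by move=> /andP[/IHb [-> ->] /IHc [-> ->]].
- by move=> /IHb [-> ->].
- by move=> /IHb [-> ->].
- by move=> /andP[/IHb [-> ->] /IHc [-> ->]].
Qed.

Lemma exec_shift M k c s s' n t : exec c s s' n -> cmd_below M c -> sim M k s t ->
  exists t', [/\ exec (shift_cmd k c) t t' n, sim M k s' t' & forall j, j < k -> t' j = t j].
Proof.
move=> Hx; elim: Hx t => {c s s' n} [s x a|c1 c2 s1 s2 s3 n1 n2 _ IH1 _ IH2|a c1 c2 s s' n _ IH|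
    a c s na|a c s1 s2 s3 n1 n2 ta _ IH1 _ IH2] t /=.
- move=> /andP[xM aM] st; have [e1 e2] := eval_shift st aM.
  exists (update t (x + k) (eval s a)); split.
  + by rewrite -e1 -e2; exact: exec_assign.
  + move=> j jM; rewrite /update eqn_add2r; case: eqP => // _; exact: st.
  + by move=> j jk; rewrite updateN //; lia.
- move=> /andP[b1 b2] st.
  have [t1 [X1 S1 P1]] := IH1 t b1 st; have [t2 [X2 S2 P2]] := IH2 t1 b2 S1.
  by exists t2; split=> //; [exact: exec_seq X1 X2|move=> j jk; rewrite P2 ?P1].
- move=> /and3P[ba b1 b2] st; have [e1 e2] := eval_shift st ba.
  have [|t1 [X1 S1 P1]] := IH t _ st; first by case: truthy.
  exists t1; split=> //; rewrite -e2; apply: exec_if; rewrite e1.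
  by move: X1; case: truthy.
- move=> /andP[ba b1] st; have [e1 e2] := eval_shift st ba.
  by exists t; split=> //; rewrite -e2; apply: exec_while_stop; rewrite e1.
- move=> /andP[ba b1] st; have [e1 e2] := eval_shift st ba.
  have [t1 [X1 S1 P1]] := IH1 t b1 st.
  have [|t2 [X2 S2 P2]] := IH2 t1 _ S1; first by rewrite /= ba b1.
  exists t2; split=> //; last by move=> j jk; rewrite P2 ?P1.
  by rewrite -e2; apply: exec_while_step X1 X2; rewrite e1.
Qed.

(** [Assign k (Var k)] plays the role of a skip command. *)
Fixpoint clear k m : cmd :=
  if m is m'.+1 then Seq (clear k m') (Assign (m + k) Nil) else Assign k (Var k).

Lemma exec_clear k m s : exists s', [/\ exec (clear k m) s s' (tsize (s k) + m),
  s' k = s k, (forall j, j < k -> s' j = s j)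
  & forall j, 0 < j -> j <= m -> s' (j + k) = Leaf].
Proof.
elim: m => [|m [s' [X Y Z W]]] /=.
  exists (update s k (s k)); split.
  - exact: exec_assign.
  - by rewrite updateE.
  - by move=> j jk; rewrite updateN //; lia.
  - by move=> j; case: j.
exists (update s' (m.+1 + k) Leaf); split.
- have -> : tsize (s k) + m.+1 = (tsize (s k) + m) + 1 by lia.
  by apply: (exec_seq X); exact: exec_assign.
- by rewrite updateN //; lia.
- by move=> j jk; rewrite updateN ?Z //; lia.
- move=> j j0; rewrite leq_eqVlt => /orP[/eqP ->|jm]; first by rewrite updateE.
  by rewrite updateN ?W //; lia.
Qed.

(** A program for [poly_time] relies on empty work variables. It touches only finitely many, so it
    suffices to clear that many registers above [k] before running the shifted copy. [M] is a
    successor so that the output variable 0 is among the simulated ones. *)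
Lemma ptime_of_poly_time f : poly_time f -> ptime (fun=> True) id f.
Proof.
move=> [c [e H]]; have [M0 HM0] := cmd_below_ex c; pose M := M0.+1.
have HM : cmd_below M c by apply: cmd_below_le HM0; rewrite /M.
apply: (@ptimeI _ _ _ _ (fun x => (tsize \o id) x + M + ((tsize \o id) x ^ e + e))).
  by pbounds.
move=> k; exists (Seq (clear k M) (shift_cmd k c)) => x s _ sk.
have [s1 [X1 Y1 Z1 W1]] := exec_clear k M s.
have [n [s2 [X2 Y2]] Hn] := H x.
have st : sim M k (update (fun=> Leaf) 0 x) s1.
  move=> [|j] jM; first by rewrite updateE Y1.
  by rewrite updateN // W1 //; lia.
have [t [X3 S3 P3]] := exec_shift X2 HM st.
exists t, (tsize (s k) + M + n); split.
- exact: exec_seq X1 X3.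
- by rewrite -Y2 -[k]add0n S3.
- by move=> j jk; rewrite P3 // Z1.
- by rewrite sk; move: Hn; rewrite /polyb /=; lia.
Qed.

Lemma poly_time_of_ptime f : ptime (fun=> True) id f -> poly_time f.
Proof.
(* The summand [3 ^ e] covers inputs of size 1. From size 2 on, adding 2 at most squares the size,
   whence the exponent [2 * e]. *)
move=> [e H]; have [c Hc] := H 0; exists c, (3 ^ e + 2 * e) => x.
have [s' [n [X Y _ Hn]]] := Hc x (update (fun=> Leaf) 0 x) I (updateE _ _ _).
exists n; first by exists s'.
apply: leq_trans Hn _; rewrite /polyb /=.
have [x1|x1] := leqP (tsize x) 1.
  have -> : tsize x = 1 by have := tsize_gt0 x; lia.
  by rewrite exp1n (_ : 1 + 2 = 3) //; set y := 3 ^ e; lia.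
apply: leq_trans (_ : (tsize x ^ 2) ^ e <= _); first by apply: leq_expl; rewrite -mulnn; nia.
rewrite -expnM; apply: leq_trans (leq_addr _ _).
by rewrite leq_pexp2l ?leq_addl //; lia.
Qed.

(** * Loops and list functions *)

Lemma size_enc_seq (T : Type) (enc : T -> tree) l : size l <= tsize (enc_seq enc l).
Proof. by elim: l => //= x l; have := tsize_gt0 (enc x); lia. Qed.

Lemma enc_seq_drop l i : tsize (enc_seq id (drop i l)) <= tsize (enc_seq id l).
Proof.
elim: l i => [|x l IH] [|i] //=; rewrite ?drop0 //.
by apply: leq_trans (IH i) _; lia.
Qed.

(** [acc a i] is the accumulator after [i] rounds. A polynomial body alone could make it grow
    exponentially over the rounds, hence the uniform size bound [g]. *)
Lemma ptime_loop A (D : A -> Prop) u (l : A -> seq tree) (acc : A -> nat -> tree) (g : A -> nat) :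
  pbound D (tsize \o u) g ->
  (forall a i, D a -> i <= size (l a) -> tsize (acc a i) <= g a) ->
  ptime D u (fun a => enc_seq id (l a)) ->
  ptime D u (acc^~ 0) ->
  ptime (fun p : A * nat => D p.1 /\ p.2 < size (l p.1))
      (fun p => Node (u p.1) (Node (nth Leaf (l p.1) p.2) (acc p.1 p.2)))
      (fun p => acc p.1 p.2.+1) ->
  ptime D u (fun a => acc a (size (l a))).
Proof.
move=> bg Hg rl ra [e Hb].
have bl := ptime_size rl.
move: rl ra => [e1 Hl] [e2 Ha].
pose tl a := (tsize \o (fun a => enc_seq id (l a))) a.
(* A bound for one round: the linear part pays for the test and the moves between registers, the
   power for the body, whose input is a triple made with two nodes. *)
pose W a := 12 * ((tsize \o u) a + tl a + g a + 2)
   + ((tsize \o u) a + tl a + g a + 4) ^ e.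
have bW : pbound D (tsize \o u) W by rewrite /W /tl; pbounds.
apply: (@ptimeI _ _ _ _ (fun a => 4 * (tsize \o u) a + ((tsize \o u) a + 2) ^ e1 + ((tsize \o
  u) a + 2) ^ e2
   + tl a * W a + W a + g a)).
  by rewrite /tl; pbounds.
move=> k; have [c1 Hc1] := Hl k.+1; have [c2 Hc2] := Ha k.+2; have [c Hc] := Hb k.+3.
pose w := While (Var k.+1) (Seq (Assign k.+3
    (Cons (Var k) (Cons (Hd (Var k.+1)) (Var k.+2))))
    (Seq c (Seq (Assign k.+2 (Var k.+3)) (Assign k.+1 (Tl (Var k.+1)))))).
(* Invariant after [i] rounds: the input is in [k], the rest of the list in [k.+1], the accumulator
   in [k.+2]; the body works from [k.+3] on. *)
have Hw a m : D a -> forall i s, i + m = size (l a) -> s k = u a ->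
    s k.+1 = enc_seq id (drop i (l a)) -> s k.+2 = acc a i ->
    exists s' n, [/\ exec w s s' n, s' k.+2 = acc a (size (l a)),
      forall j, j <= k -> s' j = s j & n <= m * W a + W a].
  move=> Da; elim: m => [|m IH] i s im sk sl sa.
    move: sl sa; rewrite addn0 in im; rewrite im drop_size => sl sa.
    exists s, (ecost s (Var k.+1)); split => //.
    - by apply: exec_while_stop; rewrite /= sl.
    - by rewrite /= sl /=; rewrite /W; lia.
  have il : i < size (l a) by lia.
  pose s1 := update s k.+3 (Node (u a) (Node (nth Leaf (l a) i) (acc a i))).
  have [s2 [n2 [X2 Y2 Z2 W2]]] := Hc (a, i) s1 (conj Da il) (updateE _ _ _).
  pose s3 := update s2 k.+2 (acc a i.+1).
  pose s4 := update s3 k.+1 (enc_seq id (drop i.+1 (l a))).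
  have dl : drop i (l a) = nth Leaf (l a) i :: drop i.+1 (l a) by rewrite -drop_nth.
  have [||||s5 [n5 [X5 Y5 Z5 W5]]] := IH i.+1 s4.
  - by rewrite addSnnS.
  - by rewrite /s4 /s3 !updateN ?Z2 ?/s1 ?updateN //; lia.
  - by rewrite /s4 updateE.
  - by rewrite /s4 /s3 updateN ?updateE //; lia.
  have X1 : exec (Assign k.+3 (Cons (Var k) (Cons (Hd (Var k.+1)) (Var k.+2)))) s s1
      (ecost s (Cons (Var k) (Cons (Hd (Var k.+1)) (Var k.+2)))).
    have -> : s1 = update s k.+3 (eval s (Cons (Var k) (Cons (Hd (Var k.+1)) (Var k.+2)))).
      by rewrite /s1 /= sk sl sa dl.
    exact: exec_assign.
  have X3 : exec (Assign k.+2 (Var k.+3)) s2 s3 (ecost s2 (Var k.+3)).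
    have -> : s3 = update s2 k.+2 (eval s2 (Var k.+3)) by rewrite /s3 /= Y2.
    exact: exec_assign.
  have s3l : s3 k.+1 = enc_seq id (drop i (l a)).
    by rewrite /s3 updateN ?Z2 ?/s1 ?updateN //; lia.
  have X4 : exec (Assign k.+1 (Tl (Var k.+1))) s3 s4 (ecost s3 (Tl (Var k.+1))).
    have -> : s4 = update s3 k.+1 (eval s3 (Tl (Var k.+1))) by rewrite /s4 /= s3l dl.
    exact: exec_assign.
  exists s5; eexists; split.
  - apply: exec_while_step X5; first by rewrite /= sl dl.
    apply: exec_seq X1 _; apply: exec_seq X2 _; apply: exec_seq X3 X4.
  - exact: Y5.
  - by move=> j jk; rewrite Z5 // /s4 /s3 !updateN ?Z2 ?/s1 ?updateN //; lia.
  have t1 : tsize (enc_seq id (drop i (l a))) <= tl a by apply: enc_seq_drop.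
  have t2 : tsize (acc a i) <= g a by apply: Hg => //; lia.
  have t3 : tsize (acc a i.+1) <= g a by apply: Hg.
  have n2W : n2 <= ((tsize \o u) a + tl a + g a + 4) ^ e.
    apply: leq_trans W2 _; apply: leq_expl => /=.
    by move: t1 t2; rewrite dl /=; lia.
  rewrite /= s3l Y2 sk sl sa dl /=; move: t1; rewrite dl /= => t1.
  move: W5; rewrite mulSn; set mW := m * W a; have := erefl (W a).
  rewrite {2}/W; move: n2W t1 t2 t3; clear; set P := _ ^ e; move=> /=; lia.
exists (Seq (Assign k.+1 (Var k)) (Seq c1 (Seq (Assign k.+2 (Var k)) (Seq c2 (Seq w
   (Assign k (Var k.+2))))))) => a s Da sk.
have [s1 [n1 [X1 Y1 Z1 W1]]] := Hc1 a (update s k.+1 (s k)) Da ltac:(by rewrite updateE).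
have s1k : s1 k = u a by rewrite Z1 ?updateN //; lia.
have [s2 [n2 [X2 Y2 Z2 W2]]] := Hc2 a (update s1 k.+2 (s1 k)) Da ltac:(by rewrite updateE).
have s2k : s2 k = u a by rewrite Z2 ?updateN //; lia.
have s2l : s2 k.+1 = enc_seq id (l a) by rewrite Z2 ?updateN //; lia.
have [|s3 [n3 [X3 Y3 Z3 W3]]] := Hw a (size (l a)) Da 0 s2 erefl s2k _ Y2.
  by rewrite drop0.
eexists; eexists; split.
- apply: exec_seq; first exact: exec_assign.
  apply: exec_seq; first exact: X1.
  apply: exec_seq; first exact: exec_assign.
  apply: exec_seq; first exact: X2.
  apply: exec_seq; first exact: X3.
  exact: exec_assign.
- by rewrite updateE /= Y3.
- by move=> j jk; rewrite updateN ?Z3 ?Z2 ?updateN ?Z1 ?updateN //; lia.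
- rewrite /= sk s1k Y3; move: W1 W2 W3 => /=.
  have h1 : size (l a) * W a <= tl a * W a by rewrite leq_mul // /tl /= size_enc_seq.
  have h2 : tsize (acc a (size (l a))) <= g a by apply: Hg.
  by move: h1 h2; set x := size (l a) * _; set y := tl a * _; lia.
Qed.

Lemma ptime_reindex A A' (D : A -> Prop) (D' : A' -> Prop) u v u' v' :
  ptime D u v ->
  (forall a', D' a' -> exists a, [/\ D a, u a = u' a' & v a = v' a']) ->
  ptime D' u' v'.
Proof.
move=> [e He] H; exists e => k; have [c Hc] := He k; exists c => a' s Da sk.
have [a [Ha ua va]] := H a' Da; rewrite -ua -va; apply: Hc => //; by rewrite ua.
Qed.

Lemma ptime_call A A' (D : A -> Prop) (D' : A' -> Prop) (j : A' -> A) U u v :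
  ptime D u v -> (forall a, D' a -> D (j a)) -> ptime D' U (fun a => u (j a)) ->
  ptime D' U (fun a => v (j a)).
Proof. by move=> uv DD /ptime_trans; apply; apply: (ptime_sub uv). Qed.

Lemma ptime_l A (D : A -> Prop) u v w : ptime D u w -> ptime D (fun a => Node (u a) (v a)) w.
Proof. exact: (ptime_trans (ptime_hd (ptime_refl D (fun a => Node (u a) (v a))))). Qed.

Lemma ptime_r A (D : A -> Prop) u v w : ptime D v w -> ptime D (fun a => Node (u a) (v a)) w.
Proof. exact: (ptime_trans (ptime_tl (ptime_refl D (fun a => Node (u a) (v a))))). Qed.

Lemma ptime_up A A' (D : A -> Prop) (D' : A' -> Prop) (j : A' -> A) u v w :
  ptime D u v -> (forall a, D' a -> D (j a)) ->
  ptime D' (fun a => Node (u (j a)) (w a)) (fun a => v (j a)).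
Proof. by move=> uv DD; apply: ptime_l; apply: (ptime_sub (j := j) uv). Qed.
Arguments ptime_up {A A' D D'} j {u v w}.

Ltac proj := first [ exact: ptime_refl | (apply: ptime_l; proj) | (apply: ptime_r; proj) ].

Lemma enc_seq_map (T T' : Type) (f : T -> T') e l : enc_seq e (map f l) = enc_seq (e \o f) l.
Proof. by elim: l => //= x l ->. Qed.

Lemma tsize_mem (T : eqType) (e : T -> tree) x l :
  x \in l -> tsize (e x) <= tsize (enc_seq e l).
Proof.
elim: l => //= y l IH; rewrite inE => /orP[/eqP ->|/IH]; lia.
Qed.

Lemma tsize_enc_seq (T : eqType) (e : T -> tree) G l :
  (forall x, x \in l -> tsize (e x) <= G) -> tsize (enc_seq e l) <= size l * (G + 1) + 1.
Proof.
elim: l => //= x l IH H; have h1 := H x (mem_head _ _).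
have := IH (fun y yl => H y (mem_behead (s := x :: l) yl)).
by rewrite mulSn; set w := size l * _; lia.
Qed.

Lemma tsize_cat (T : Type) (e : T -> tree) l1 l2 :
  tsize (enc_seq e (l1 ++ l2)) + 1 = tsize (enc_seq e l1) + tsize (enc_seq e l2).
Proof. by elim: l1 => //= [|x l1 IH]; lia. Qed.

(** The step has to be computable only on states reached from a prefix of the list. This lets later
    proofs use invariants of the fold, such as equal lengths of words, as preconditions of the
    body. *)
Lemma ptime_foldl A (T : eqType) (S : Type) (D : A -> Prop) u (eT : T -> tree) (eS : S -> tree)
    (l : A -> seq T) (init : A -> S) (step : A -> S -> T -> S) (g : A -> nat) :
  pbound D (tsize \o u) g ->
  (forall a l1 l2, D a -> l a = l1 ++ l2 -> tsize (eS (foldl (step a) (init a) l1)) <= g a) ->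
  ptime D u (fun a => enc_seq eT (l a)) ->
  ptime D u (fun a => eS (init a)) ->
  ptime (fun p : A * (S * T) => D p.1 /\
        exists l1 l2, l p.1 = l1 ++ p.2.2 :: l2 /\ p.2.1 = foldl (step p.1) (init p.1) l1)
      (fun p => Node (u p.1) (Node (eT p.2.2) (eS p.2.1)))
      (fun p => eS (step p.1 p.2.1 p.2.2)) ->
  ptime D u (fun a => eS (foldl (step a) (init a) (l a))).
Proof.
move=> bg Hg Hl Hi Hb.
pose l' a := map eT (l a).
pose acc a i := eS (foldl (step a) (init a) (take i (l a))).
apply: (@ptime_eq _ _ _ (fun a => acc a (size (l' a)))); last first.
  by move=> a Da; rewrite /acc /l' size_map take_size.
apply: (@ptime_loop _ _ _ l' acc g) => //.
- by move=> a i Da _; apply: (Hg _ _ (drop i (l a))) => //; rewrite cat_take_drop.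
- by apply: (ptime_eq Hl) => a _; rewrite /l' enc_seq_map.
- by apply: (ptime_eq Hi) => a _; rewrite /acc take0.
apply: (ptime_reindex Hb) => -[a i] /= [Da]; rewrite /l' size_map => il.
case E : (drop i (l a)) => [|x l2].
  by move/(congr1 size): E; rewrite size_drop /=; lia.
have El : l a = take i (l a) ++ x :: l2 by rewrite -E cat_take_drop.
have st : size (take i (l a)) = i by rewrite size_take il.
have nx : nth x (l a) i = x by rewrite El nth_cat st ltnn subnn.
exists (a, (foldl (step a) (init a) (take i (l a)), x)); split=> /=.
- by split=> //; exists (take i (l a)), l2.
- by rewrite (nth_map x) // nx.
- by rewrite /acc (take_nth x) // nx foldl_rcons.
Qed.

Lemma tsize_catrev (T : Type) (e : T -> tree) l1 l2 :
  tsize (enc_seq e (catrev l1 l2)) + 1 = tsize (enc_seq e l1) + tsize (enc_seq e l2).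
Proof. by elim: l1 l2 => //= [|x l1 IH] l2; rewrite ?IH /=; lia. Qed.

Lemma foldl_catrev (T : Type) (s h : seq T) : foldl (fun s x => x :: s) s h = catrev h s.
Proof. by elim: h s => //= x h IH s; rewrite IH. Qed.

Lemma ptime_catrev A (T : eqType) (D : A -> Prop) u (e : T -> tree) (l1 l2 : A -> seq T) :
  ptime D u (fun a => enc_seq e (l1 a)) -> ptime D u (fun a => enc_seq e (l2 a)) ->
  ptime D u (fun a => enc_seq e (catrev (l1 a) (l2 a))).
Proof.
move=> H1 H2.
apply: (@ptime_eq _ _ _ (fun a => enc_seq e (foldl (fun s x => x :: s) (l2 a) (l1 a)))); last
  first.
  by move=> a _; rewrite foldl_catrev.
have b1 := ptime_size H1; have b2 := ptime_size H2.
apply: (@ptime_foldl _ _ _ _ _ e (enc_seq e) l1 l2 (fun a s x => x :: s) (fun a =>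
  (tsize \o (fun a => enc_seq e (l1 a))) a + (tsize \o (fun a => enc_seq e (l2 a))) a)) => //.
- by pbounds.
- move=> a h1 h2 Da E /=; rewrite foldl_catrev E.
  have := tsize_catrev e h1 (l2 a); have := tsize_cat e h1 h2.
  by have := tsize_gt0 (enc_seq e h2); lia.
- by apply: ptime_pair => /=; proj.
Qed.

Lemma ptime_rev A (T : eqType) (D : A -> Prop) u (e : T -> tree) (l : A -> seq T) :
  ptime D u (fun a => enc_seq e (l a)) -> ptime D u (fun a => enc_seq e (rev (l a))).
Proof. by move=> H; apply: (@ptime_catrev _ _ _ _ _ l (fun=> [::])) => //; apply: ptime_const.
  Qed.

Lemma ptime_cat A (T : eqType) (D : A -> Prop) u (e : T -> tree) (l1 l2 : A -> seq T) :
  ptime D u (fun a => enc_seq e (l1 a)) -> ptime D u (fun a => enc_seq e (l2 a)) ->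
  ptime D u (fun a => enc_seq e (l1 a ++ l2 a)).
Proof.
move=> H1 H2; apply: ptime_eq (ptime_catrev (ptime_rev H1) H2) _ => a _.
by rewrite catrevE revK.
Qed.

Lemma ptime_cons A (T : eqType) (D : A -> Prop) u (e : T -> tree) (x : A -> T) (l : A -> seq T) :
  ptime D u (fun a => e (x a)) -> ptime D u (fun a => enc_seq e (l a)) ->
  ptime D u (fun a => enc_seq e (x a :: l a)).
Proof. exact: ptime_pair. Qed.

(** The images are computed independently of one another, so [ptime_size] bounds each of them and
    the bounds add up instead of compounding. They are collected in reverse order and reversed at
    the end. *)
Lemma ptime_map A (T T' : eqType) (D : A -> Prop) u (eT : T -> tree) (eT' : T' -> tree)
    (l : A -> seq T) (f : A -> T -> T') :
  ptime D u (fun a => enc_seq eT (l a)) ->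
  ptime (fun p : A * T => D p.1 /\ p.2 \in l p.1) (fun p => Node (u p.1) (eT p.2))
      (fun p => eT' (f p.1 p.2)) ->
  ptime D u (fun a => enc_seq eT' (map (f a) (l a))).
Proof.
move=> Hl Hf; have [e He] := ptime_size Hf; have bl := ptime_size Hl.
pose tl a := (tsize \o (fun a => enc_seq eT (l a))) a.
pose g a := tl a * (((tsize \o u) a + tl a + 1 + 2) ^ e + 1) + 1.
have bg : pbound D (tsize \o u) g by rewrite /g /tl; pbounds.
have Hg (h : A -> seq T) : (forall a, D a -> {subset h a <= l a} /\ size (h a) <= size (l a)) ->
    forall a, D a -> tsize (enc_seq eT' (map (f a) (h a))) <= g a.
  move=> Hh a Da; have [sub sz] := Hh a Da; rewrite /g.
  apply: leq_trans (tsize_enc_seq (G := ((tsize \o u) a + tl a + 1 + 2) ^ e) _) _.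
    move=> y /mapP[x xh ->]; have xl := sub _ xh.
    apply: leq_trans (He (a, x) (conj Da xl)) _; apply: leq_expl => /=.
    by have := tsize_mem eT xl; rewrite /tl /=; lia.
  rewrite leq_add2r leq_mul // size_map; apply: leq_trans sz _.
  by rewrite /tl /= size_enc_seq.
have revE a s h : foldl (fun s x => f a x :: s) s h = catrev (map (f a) h) s.
  by elim: h s => //= x h IH s; rewrite IH.
have R1 : ptime D u (fun a => enc_seq eT' (rev (map (f a) (l a)))).
  apply: (@ptime_eq _ _ _ (fun a => enc_seq eT' (foldl (fun s x => f a x :: s) [::] (l a))));
    last first.
    by move=> a _; rewrite revE.
  apply: (@ptime_foldl _ _ _ _ _ eT (enc_seq eT') l (fun=> [::]) (fun a s x => f a x :: s) g)
    => //.
  - move=> a l1 l2 Da El; rewrite revE -/(rev _) -map_rev.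
    have -> : l1 = take (size l1) (l a) by rewrite El take_size_cat.
    apply: (Hg (fun a' => rev (take (size l1) (l a')))) => //.
    move=> a' _; split; last by rewrite size_rev size_take; case: ifP; lia.
    by move=> x; rewrite mem_rev => /mem_take.
  - exact: ptime_const.
  - apply: ptime_pair => /=; last by proj.
    apply: (ptime_call (j := fun p : A * (seq T' * T) => (p.1, p.2.2)) Hf) => /=.
      by move=> [a [s x]] [Da [l1 [l2 [/= -> _]]]] /=; split; rewrite // mem_cat mem_head orbT.
    by apply: ptime_pair; proj.
by apply: ptime_eq (ptime_rev R1) _ => a _; rewrite revK.
Qed.

Lemma ptime_flatten A (T : eqType) (D : A -> Prop) u (e : T -> tree) (l : A -> seq (seq T)) :
  ptime D u (fun a => enc_seq (enc_seq e) (l a)) ->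
  ptime D u (fun a => enc_seq e (flatten (l a))).
Proof.
move=> H; have bl := ptime_size H.
have fE s h : foldl (fun s (x : seq T) => catrev x s) s h = rev (flatten h) ++ s.
  elim: h s => //= x h IH s; rewrite IH catrevE rev_cat -!catA //.
have R1 : ptime D u (fun a => enc_seq e (rev (flatten (l a)))).
  apply: (@ptime_eq _ _ _ (fun a => enc_seq e (foldl (fun s (x : seq T) => catrev x s) [::] (l
    a)))); last first.
    by move=> a _; rewrite fE cats0.
  apply: (@ptime_foldl _ _ _ _ _ (enc_seq e) (enc_seq e) l (fun=> [::]) (fun a s x => catrev x s)
     (tsize \o (fun a => enc_seq (enc_seq e) (l a)))) => //.
  - move=> a l1 l2 Da /= ->; rewrite fE cats0.
    have E := tsize_catrev e (flatten l1) [::]; rewrite /= in E.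
    have : tsize (enc_seq e (flatten l1)) <= tsize (enc_seq (enc_seq e) l1).
      by elim: (l1) => //= x h IH; have := tsize_cat e x (flatten h); lia.
    have := tsize_cat (enc_seq e) l1 l2; have := tsize_gt0 (enc_seq (enc_seq e) l2).
    by rewrite /rev; lia.
  - exact: ptime_const.
  - by apply: ptime_catrev; proj.
by apply: ptime_eq (ptime_rev R1) _ => a _; rewrite revK.
Qed.

Lemma ptime_ifT A (T : Type) (D : A -> Prop) u (e : T -> tree) (b : A -> bool) (x y : A -> T) :
  ptime D u (fun a => enc_bool (b a)) ->
  ptime (fun a => D a /\ b a) u (fun a => e (x a)) ->
  ptime (fun a => D a /\ ~~ b a) u (fun a => e (y a)) ->
  ptime D u (fun a => e (if b a then x a else y a)).
Proof. by move=> Hb Hx Hy; apply: ptime_eq (ptime_if Hb Hx Hy) _ => a _; case: (b a). Qed.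

Lemma ptime_filter A (T : eqType) (D : A -> Prop) u (e : T -> tree) (l : A -> seq T)
    (P : A -> pred T) :
  ptime D u (fun a => enc_seq e (l a)) ->
  ptime (fun p : A * T => D p.1 /\ p.2 \in l p.1) (fun p => Node (u p.1) (e p.2))
      (fun p => enc_bool (P p.1 p.2)) ->
  ptime D u (fun a => enc_seq e [seq x <- l a | P a x]).
Proof.
move=> Hl HP.
apply: (@ptime_eq _ _ _ (fun a => enc_seq e (flatten (map (fun x => if P a x then [:: x] else
  [::]) (l a))))).
  apply: ptime_flatten; apply: ptime_map Hl _.
  apply: (@ptime_ifT _ _ _ _ _ (fun p : A * T => P p.1 p.2) (fun p => [:: p.2]) (fun=> [::])
    HP) => /=.
    by apply: ptime_pair; [proj | exact: ptime_const].
  exact: ptime_const.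
by move=> a _; congr enc_seq; elim: (l a) => //= x h ->; case: ifP.
Qed.

Lemma ptime_nilp A (T : Type) (D : A -> Prop) u (e : T -> tree) (l : A -> seq T) :
  ptime D u (fun a => enc_seq e (l a)) -> ptime D u (fun a => enc_bool (nilp (l a))).
Proof.
move=> /ptime_eqb /(_ (ptime_const _ _ Leaf)) H; apply: ptime_eq H _ => a _.
by case: (l a).
Qed.

Lemma ptime_not A (D : A -> Prop) u (b : A -> bool) :
  ptime D u (fun a => enc_bool (b a)) -> ptime D u (fun a => enc_bool (~~ b a)).
Proof.
move=> /ptime_eqb /(_ (ptime_const _ _ Leaf)) H; apply: ptime_eq H _ => a _.
by case: (b a).
Qed.

Lemma ptime_has A (T : eqType) (D : A -> Prop) u (e : T -> tree) (l : A -> seq T)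
    (P : A -> pred T) :
  ptime D u (fun a => enc_seq e (l a)) ->
  ptime (fun p : A * T => D p.1 /\ p.2 \in l p.1) (fun p => Node (u p.1) (e p.2))
      (fun p => enc_bool (P p.1 p.2)) ->
  ptime D u (fun a => enc_bool (has (P a) (l a))).
Proof.
move=> Hl HP; apply: ptime_eq (ptime_not (ptime_nilp (ptime_filter Hl HP))) _ => a _.
by rewrite has_filter /nilp size_eq0.
Qed.

Lemma ptime_eqT A (T : eqType) (D : A -> Prop) u (e : T -> tree) (x y : A -> T) :
  injective e -> ptime D u (fun a => e (x a)) -> ptime D u (fun a => e (y a)) ->
  ptime D u (fun a => enc_bool (x a == y a)).
Proof.
move=> ei Hx Hy; apply: ptime_eq (ptime_eqb Hx Hy) _ => a _.
by rewrite (inj_eq ei).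
Qed.

Lemma ptime_mem A (T : eqType) (D : A -> Prop) u (e : T -> tree) (x : A -> T) (l : A -> seq T) :
  injective e -> ptime D u (fun a => e (x a)) -> ptime D u (fun a => enc_seq e (l a)) ->
  ptime D u (fun a => enc_bool (x a \in l a)).
Proof.
move=> ei Hx Hl; apply: ptime_eq (ptime_has (P := fun a => pred1 (x a)) Hl _) _ => /=.
  apply: (ptime_eqT ei); first by proj.
  by apply: (ptime_up fst Hx) => p [].
by move=> a _; rewrite has_pred1.
Qed.

Lemma ptime_head A (T : eqType) (D : A -> Prop) u (e : T -> tree) (x : A -> T) (l : A -> seq T) :
  (forall a, D a -> ~~ nilp (l a)) ->
  ptime D u (fun a => enc_seq e (l a)) -> ptime D u (fun a => e (head (x a) (l a))).
Proof.
move=> ne Hl; apply: ptime_eq (ptime_hd Hl) _ => a Da.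
by have := ne a Da; case: (l a).
Qed.

Lemma ptime_behead A (T : eqType) (D : A -> Prop) u (e : T -> tree) (l : A -> seq T) :
  ptime D u (fun a => enc_seq e (l a)) -> ptime D u (fun a => enc_seq e (behead (l a))).
Proof. by move=> Hl; apply: ptime_eq (ptime_tl Hl) _ => a Da; case: (l a). Qed.

Definition enc_pair (T T' : Type) (e : T -> tree) (e' : T' -> tree) (p : T * T') :=
  Node (e p.1) (e' p.2).

Lemma ptime_drop A (T T' : eqType) (D : A -> Prop) u (e : T -> tree) (e' : T' -> tree)
    (l : A -> seq T) (l' : A -> seq T') :
  ptime D u (fun a => enc_seq e (l a)) -> ptime D u (fun a => enc_seq e' (l' a)) ->
  ptime D u (fun a => enc_seq e (drop (size (l' a)) (l a))).
Proof.
move=> Hl Hl'; have bl := ptime_size Hl.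
have fE (s : seq T) (h : seq T') : foldl (fun s _ => behead s) s h = drop (size h) s.
  by elim: h s => [|x h IH] s /=; rewrite ?drop0 // IH -drop1 drop_drop addn1.
apply: (@ptime_eq _ _ _ (fun a => enc_seq e (foldl (fun s _ => behead s) (l a) (l' a)))); last
  first.
  by move=> a _; rewrite fE.
apply: (@ptime_foldl _ _ _ _ _ e' (enc_seq e) l' l (fun a s x => behead s)
   (tsize \o (fun a => enc_seq e (l a)))) => //.
- move=> a l1 l2 Da /= _; rewrite fE.
  have := tsize_cat e (take (size l1) (l a)) (drop (size l1) (l a)).
  by have := tsize_gt0 (enc_seq e (take (size l1) (l a))); rewrite cat_take_drop; lia.
- by apply: ptime_behead; proj.
Qed.

Lemma ptime_leq_size A (T T' : eqType) (D : A -> Prop) u (e : T -> tree) (e' : T' -> tree)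
    (l : A -> seq T) (l' : A -> seq T') :
  ptime D u (fun a => enc_seq e (l a)) -> ptime D u (fun a => enc_seq e' (l' a)) ->
  ptime D u (fun a => enc_bool (size (l a) <= size (l' a))).
Proof.
move=> Hl Hl'; apply: ptime_eq (ptime_nilp (ptime_drop Hl Hl')) _ => a _.
by rewrite /nilp size_drop subn_eq0.
Qed.

(** One pass over [l] that carries the rest of [l']. The length hypothesis keeps this rest nonempty,
    so its head and tail are taken without a test. *)
Lemma ptime_zip A (T T' : eqType) (D : A -> Prop) u (e : T -> tree) (e' : T' -> tree)
    (l : A -> seq T) (l' : A -> seq T') :
  (forall a, D a -> size (l a) <= size (l' a)) ->
  ptime D u (fun a => enc_seq e (l a)) -> ptime D u (fun a => enc_seq e' (l' a)) ->
  ptime D u (fun a => enc_seq (enc_pair e e') (zip (l a) (l' a))).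
Proof.
move=> sz Hl Hl'; have bl := ptime_size Hl; have bl' := ptime_size Hl'.
pose S := (seq (T * T') * seq T')%type.
pose eS (s : S) := Node (enc_seq (enc_pair e e') s.1) (enc_seq e' s.2).
pose step (a : A) (s : S) (x : T) : S :=
  if s.2 is y :: r then ((x, y) :: s.1, r) else s.
have fE a s h : size h <= size s.2 -> foldl (step a) s h = (catrev (zip h s.2) s.1, drop (size
  h) s.2).
  elim: h s => [|x h IH] [s1 [|y r]] //= hr; by rewrite IH.
have R : ptime D u (fun a => eS (foldl (step a) ([::], l' a) (l a))).
  apply: (@ptime_foldl _ _ _ _ _ e eS l (fun a => ([::], l' a)) step
    (fun a => 1 + (tsize \o (fun a => enc_seq e (l a))) a + 2 * (tsize \o (fun a => enc_seq e'
      (l' a))) a)) => //.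
  - by pbounds.
  - move=> a l1 l2 Da E; rewrite fE /=; last first.
      by have := sz _ Da; rewrite E size_cat; lia.
    have := tsize_catrev (enc_pair e e') (zip l1 (l' a)) [::].
    have : tsize (enc_seq (enc_pair e e') (zip l1 (l' a))) <= tsize (enc_seq e l1) + tsize
      (enc_seq e' (l' a)).
      by elim: (l1) (l' a) => [|x h IH] [|y r] /=; try lia; have := IH r; lia.
    have := tsize_cat e l1 l2; rewrite E; have := tsize_gt0 (enc_seq e l2).
    have := tsize_cat e' (take (size l1) (l' a)) (drop (size l1) (l' a)).
    have := tsize_gt0 (enc_seq e' (take (size l1) (l' a))); rewrite cat_take_drop.
    by rewrite /eS /=; lia.
  - by apply: ptime_pair => //; exact: ptime_const.
  - apply: (@ptime_eq _ _ _ (fun p => Node (Node (Node (e p.2.2) (thead (enc_seq e' p.2.1.2)))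
    (enc_seq (enc_pair e e') p.2.1.1)) (ttail (enc_seq e' p.2.1.2)))).
      apply: ptime_pair; first (apply: ptime_pair; first apply: ptime_pair).
      + by proj.
      + by apply: ptime_hd; rewrite /eS; proj.
      + by rewrite /eS; proj.
      + by apply: ptime_tl; rewrite /eS; proj.
    move=> [a [s x]] /= [Da [l1 [l2 [El Es]]]].
    have sz1 : size l1 < size (l' a) by have := sz a Da; rewrite El size_cat /=; lia.
    move: Es; rewrite fE /=; last lia.
    case Ed : (drop (size l1) (l' a)) => [|y r] -> //=.
    by move/(congr1 size): Ed; rewrite size_drop /=; lia.
have Rr : ptime D u (fun a => enc_seq (enc_pair e e') (rev (zip (l a) (l' a)))).
  by apply: ptime_eq (ptime_hd R) _ => a Da; rewrite fE ?sz.
by apply: ptime_eq (ptime_rev Rr) _ => a _; rewrite revK.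
Qed.

(** * A greedy code *)

Fixpoint words (T : Type) (sg : seq T) (b : nat) : seq (seq T) :=
  if b is b'.+1 then [seq a :: w | a <- sg, w <- words sg b'] else [:: [::]].

Lemma size_words (T : Type) (sg : seq T) b : size (words sg b) = size sg ^ b.
Proof. by elim: b => //= b IH; rewrite size_allpairs IH expnS. Qed.

Lemma mem_words (T : eqType) (sg : seq T) b w :
  (w \in words sg b) = (size w == b) && all (mem sg) w.
Proof.
elim: b w => [|b IH] [|a w] //=.
- by apply/negbTE/negP => /allpairsP[[x v] [_ _]].
- rewrite eqSS; apply/allpairsP/idP => [[[x v] /= [xs vw [-> ->]]]|/and3P[sw asg aw]].
    by rewrite IH in vw; case/andP: vw => -> ->; rewrite xs.
  by exists (a, w); split; rewrite // IH sw.
Qed.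

Lemma uniq_words (T : eqType) (sg : seq T) b : uniq sg -> uniq (words sg b).
Proof.
move=> us; elim: b => //= b IH; apply: allpairs_uniq => // -[a w] [a' w'] _ _ /= [-> ->] //.
Qed.

Definition agree (T : eqType) (w c : seq T) : nat :=
  count (fun p => p.1 == p.2) (zip w c).

Definition conflict (T : eqType) r (w c : seq T) : bool := size w <= r * agree w c.

Definition greedy (T : eqType) r (W : seq (seq T)) : seq (seq T) :=
  foldl (fun C w => if has (conflict r w) C then C else w :: C) [::] W.

Lemma agree_sym (T : eqType) (w c : seq T) : agree w c = agree c w.
Proof.
elim: w c => [|x w IH] [|y c] //=.
by rewrite /agree /= -!/(agree _ _) IH eq_sym.
Qed.

Lemma agreexx (T : eqType) (w : seq T) : agree w w = size w.
Proof. by elim: w => //= x w IH; rewrite /agree /= eqxx -/(agree w w) IH. Qed.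

Lemma greedy_sub (T : eqType) r (W C : seq (seq T)) :
  {subset foldl (fun C w => if has (conflict r w) C then C else w :: C) C W <= W ++ C}.
Proof.
elim: W C => [|w W IH] C x //= /IH; rewrite mem_cat => /orP[xW|xC].
  by rewrite inE mem_cat xW orbT.
move: xC; rewrite inE mem_cat; case: ifP => _; first by move=> ->; rewrite !orbT.
by rewrite inE => /orP[->//|->]; rewrite !orbT.
Qed.

Lemma greedy_subW (T : eqType) r (W : seq (seq T)) : {subset greedy r W <= W}.
Proof. by move=> x /greedy_sub; rewrite cats0. Qed.

Lemma greedy_pairwise (T : eqType) r (W C : seq (seq T)) :
  pairwise (fun w c => ~~ conflict r w c) C ->
  pairwise (fun w c => ~~ conflict r w c)
    (foldl (fun C w => if has (conflict r w) C then C else w :: C) C W).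
Proof.
elim: W C => //= w W IH C HC; apply: IH; case: ifP => // /negbT; rewrite -all_predC /= => ->.
by rewrite HC.
Qed.

(** For positive [r] a word is in conflict with itself, so selected words are covered just like
    rejected ones. *)
Lemma greedy_maximal (T : eqType) r (W C : seq (seq T)) : 0 < r ->
  let C' := foldl (fun C w => if has (conflict r w) C then C else w :: C) C W in
  {subset C <= C'} /\ forall w, w \in W -> has (conflict r w) C'.
Proof.
move=> r0; elim: W C => [|w W IH] C /=; first by split.
set C1 := if _ then _ else _.
have [s1 m1] := IH C1.
have sC : {subset C <= C1} by rewrite /C1 => x xC; case: ifP => _ //; rewrite inE xC orbT.
split; first by move=> x /sC /s1.
move=> x; rewrite inE => /orP[/eqP ->|/m1 //].
have : has (conflict r w) C1.
  rewrite /C1; case: ifP => //= _.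
  by rewrite /conflict agreexx leq_pmull.
by move=> /hasP[c cC h]; apply/hasP; exists c => //; apply: s1.
Qed.

Lemma sum_const_seq (T : Type) (s : seq T) c : \sum_(a <- s) c = size s * c.
Proof. by rewrite big_const_seq count_predT iter_addn_0 mulnC. Qed.

(* The weights [q ^ agree] turn the greedy covering argument into a Markov
   inequality: over all words they sum to at most [(2 q) ^ b]. *)
Lemma sum_agree (T : eqType) (sg c : seq T) b : uniq sg -> 0 < size sg ->
  \sum_(w <- words sg b) size sg ^ agree w c <= (2 * size sg) ^ b.
Proof.
move=> us q0; elim: b c => [|b IH] c /=.
  by rewrite big_seq1; case: c.
rewrite big_allpairs_dep /= expnS.
case: c => [|y c].
  have le1 : forall a, \sum_(w <- words sg b) size sg ^ agree (a :: w) [::] <= (2 * size sg) ^ b.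
    move=> a; apply: leq_trans (IH [::]); apply: leq_sum => w _.
    by rewrite /agree /= expn_gt0 q0.
  apply: (@leq_trans (\sum_(a <- sg) (2 * size sg) ^ b)); first by apply: leq_sum => a _;
    exact: le1.
  by rewrite sum_const_seq leq_mul2r; apply/orP; right; lia.
have E a : \sum_(w <- words sg b) size sg ^ agree (a :: w) (y :: c) =
    size sg ^ (a == y) * \sum_(w <- words sg b) size sg ^ agree w c.
  by rewrite big_distrr /=; apply: eq_bigr => w _; rewrite -expnD.
under eq_bigr => a _ do rewrite E.
rewrite -big_distrl /= leq_mul //.
(* In one position the letter [y] has weight q and every other letter weight 1, in total at most 2
   q. *)
apply: (@leq_trans (\sum_(a <- sg) (1 + size sg * (a == y)))).
  by apply: leq_sum => a _; case: eqP => _ /=; rewrite ?expn1 ?expn0; lia.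
rewrite big_split /= sum1_size -big_distrr /= mul2n -addnn leq_add2l.
rewrite (_ : \sum_(a <- sg) (a == y) = count_mem y sg); last first.
  by rewrite -sum1_count [RHS]big_mkcond; apply: eq_bigr => a _ /=; case: eqP.
by rewrite count_uniq_mem // -[leqRHS]muln1 leq_mul2l leq_b1 orbT.
Qed.

(** Let q = 4^r. A word in conflict with [c] agrees with it in at least b / r positions, so its
    weight is at least q^(b / r) = 4^b. By [sum_agree] a codeword is then in conflict with at most
    (2 q)^b / 4^b = (q / 2)^b words. As each of the q^b words conflicts with some codeword, there
    are at least 2^b codewords. *)
Lemma greedy_size (T : eqType) r (sg : seq T) b : 0 < r -> uniq sg -> size sg = 4 ^ r ->
  2 ^ b <= size (greedy r (words sg b)).
Proof.
move=> r0 us sq; set C := greedy _ _; set q := size sg.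
have q0 : 0 < q by rewrite /q sq expn_gt0.
have [_ Hm] := greedy_maximal (words sg b) [::] r0.
have one c : c \in C -> \sum_(w <- words sg b | conflict r w c) 4 ^ b <= (2 * q) ^ b.
  move=> _; apply: leq_trans (sum_agree c b us q0).
  rewrite big_mkcond; rewrite [leqLHS]big_seq [leqRHS]big_seq; apply: leq_sum => w.
  rewrite mem_words => /andP[/eqP sw _]; case: ifP => // cf.
  by rewrite -/q /q sq -expnM leq_exp2l // -sw.
have tot : q ^ b * 4 ^ b <= size C * (2 * q) ^ b.
  rewrite -(size_words sg b) -sum_const_seq.
  apply: (@leq_trans (\sum_(w <- words sg b) \sum_(c <- C | conflict r w c) 4 ^ b)).
    rewrite [leqLHS]big_seq [leqRHS]big_seq; apply: leq_sum => w /Hm /hasP[c cC cf].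
    by rewrite (big_rem c) //= cf leq_addr.
  rewrite (exchange_big_dep predT) //=; rewrite -sum_const_seq.
  by rewrite [leqLHS]big_seq [leqRHS]big_seq; apply: leq_sum => c; apply: one.
have e4 : 4 ^ b = 2 ^ b * 2 ^ b by rewrite -expnMn.
have p2 : 0 < 2 ^ b * q ^ b by rewrite muln_gt0 !expn_gt0 q0.
rewrite -(leq_pmul2r p2); apply: leq_trans (_ : q ^ b * 4 ^ b <= _); first by rewrite e4; nia.
by apply: leq_trans tot _; rewrite expnMn.
Qed.

(** * Binary numerals *)

Definition bits n : seq bool := if bin_of_nat n is Npos m then bits_pos m else [::].

Fixpoint incr (c : bool) (s : seq bool) : seq bool :=
  match s with
  | [::] => if c then [:: true] else [::]
  | x :: s => (x != c) :: incr (c && x) s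
  end.

Lemma incr0 s : incr false s = s.
Proof. by elim: s => //= x s ->; case: x. Qed.

Lemma incr_pos m : incr true (bits_pos m) = bits_pos (Pos.succ m).
Proof. by elim: m => [m /= ->|m /=|] //; rewrite incr0. Qed.

Lemma bitsS n : bits n.+1 = incr true (bits n).
Proof.
have E : bin_of_nat n.+1 = Npos (if bin_of_nat n is Npos m then Pos.succ m else xH).
  apply: (can_inj nat_of_binK); rewrite bin_of_natK /=.
  rewrite -[n in LHS]bin_of_natK; case: (bin_of_nat n) => //= m.
  by rewrite nat_of_succ_pos.
by rewrite /bits E; case: (bin_of_nat n) => //= m; rewrite incr_pos.
Qed.

Lemma bits_pos_bounds m : 2 ^ (size (bits_pos m)).-1 <= nat_of_pos m < 2 ^ size (bits_pos m).
Proof.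
have p0 m' : 0 < size (bits_pos m') by case: m'.
elim: m => [m IH|m IH|] //; have := p0 m; rewrite /= NatTrec.doubleE -muln2.
  by case E : (size _) IH => [|k] //=; rewrite !expnS; lia.
by case E : (size _) IH => [|k] //=; rewrite !expnS; lia.
Qed.

Lemma bits_lt n : n < 2 ^ size (bits n).
Proof.
rewrite -[n in n < _]bin_of_natK /bits; case: (bin_of_nat n) => //= m.
by case/andP: (bits_pos_bounds m).
Qed.

Lemma bits_ge n : 0 < n -> 2 ^ (size (bits n)).-1 <= n.
Proof.
rewrite -{1 3}[n]bin_of_natK /bits; case: (bin_of_nat n) => //= m _.
by case/andP: (bits_pos_bounds m).
Qed.

Lemma bits_inj : injective bits.
Proof.
have pinj m m' : bits_pos m = bits_pos m' -> m = m'.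
  have ne k : bits_pos k <> [::] by case: k.
  elim: m m' => [m IH|m IH|] [m'|m'|] //= [].
  - by move=> /IH ->.
  - by move=> /ne.
  - by move=> /IH ->.
  - by move=> /esym /ne.
move=> n n'; rewrite -{2}[n]bin_of_natK -{2}[n']bin_of_natK /bits.
case: (bin_of_nat n) (bin_of_nat n') => [|m] [|m'] //.
- by case: m'.
- by case: m.
- by move=> /pinj ->.
Qed.

Lemma enc_seq_inj (T : Type) (e : T -> tree) : injective e -> injective (enc_seq e).
Proof. by move=> ei; elim=> [|x s IH] [|y t] //= [/ei -> /IH ->]. Qed.

Lemma enc_bool_inj : injective enc_bool.
Proof. by case=> [] []. Qed.

Lemma enc_natE n : enc_nat n = enc_seq enc_bool (bits n).
Proof. by []. Qed.

Lemma enc_nat_inj : injective enc_nat.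
Proof. by move=> n n' /(enc_seq_inj enc_bool_inj) /bits_inj. Qed.

Lemma enc_int_inj : injective enc_int.
Proof.
move=> m m' [/enc_bool_inj E /enc_nat_inj E'].
by case: m m' E E' => m [] m' //=; lia.
Qed.

Lemma enc_rat_inj : injective enc_rat.
Proof.
move=> x y E; have /enc_int_inj E1 := congr1 thead E; have /enc_int_inj E2 := congr1 ttail E.
by rewrite -[x]divq_num_den -[y]divq_num_den E1 E2.
Qed.

(** * The reduction as a program *)

(** The list [sg] is a constant, so the iteration over it is unrolled in the program text. *)
Lemma ptime_seqconst A (T : eqType) (T' : Type) (D : A -> Prop) u (e : T' -> tree)
    (sg : seq T) (f : A -> T -> seq T') :
  (forall x, x \in sg -> ptime D u (fun a => enc_seq (enc_seq e) [:: f a x])) ->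
  ptime D u (fun a => enc_seq (enc_seq e) [seq f a x | x <- sg]).
Proof.
elim: sg => [|x sg IH] H /=; first exact: ptime_const.
apply: ptime_pair; first by apply: ptime_eq (ptime_hd (H x (mem_head _ _))) _.
by apply: IH => y ys; apply: H; rewrite inE ys orbT.
Qed.

Definition enc_words : seq (seq rat) -> tree := enc_seq (enc_seq enc_rat).

Lemma ptime_words_step A (D : A -> Prop) u (sg : seq rat) (W : A -> seq (seq rat)) :
  ptime D u (fun a => enc_words (W a)) ->
  ptime D u (fun a => enc_words [seq x :: w | x <- sg, w <- W a]).
Proof.
move=> HW; apply: ptime_flatten; apply: ptime_seqconst => x _.
apply: ptime_pair; last exact: ptime_const.
apply: (ptime_map (f := fun _ w => x :: w) HW) => /=.
by apply: ptime_pair; [exact: ptime_const | proj].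
Qed.

(** The output is exponential in the length of [B a], which the second hypothesis compensates.
    [pbound_words] provides it when [B a] is the binary form of a number given in unary. *)
Lemma ptime_words A (D : A -> Prop) u (sg : seq rat) (B : A -> seq bool) :
  0 < size sg ->
  pbound D (tsize \o u) (fun a => size sg ^ size (B a)) ->
  ptime D u (fun a => enc_seq enc_bool (B a)) ->
  ptime D u (fun a => enc_words (words sg (size (B a)))).
Proof.
move=> q0 bq HB; have bB := ptime_size HB.
have fE (h : seq bool) b : foldl (fun W (_ : bool) => [seq x :: w | x <- sg, w <- W]) (words sg
  b) h
    = words sg (size h + b).
  by elim: h b => //= x h IH b; rewrite (IH b.+1) addnS.
apply: (@ptime_eq _ _ _ (fun a => enc_words (foldl (fun W (_ : bool) => [seq x :: w | x <- sg,
  w <- W]) [:: [::]] (B a)))); last first.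
  by move=> a _; rewrite -[[:: [::]]]/(words sg 0) fE addn0.
pose G := tsize (enc_seq enc_rat sg).
pose tl a := (tsize \o (fun a => enc_seq enc_bool (B a))) a.
apply: (@ptime_foldl _ _ _ _ _ enc_bool enc_words B (fun=> [:: [::]]) (fun _ W _ => [seq x :: w
  | x <- sg, w <- W])
  (fun a => size sg ^ size (B a) * ((tl a * (G + 1) + 1) + 1) + 1)) => //.
- by rewrite /tl; pbounds.
- move=> a l1 l2 Da El; rewrite -[[:: [::]]]/(words sg 0) fE addn0.
  have s1 : size l1 <= size (B a) by rewrite El size_cat leq_addr.
  apply: leq_trans (tsize_enc_seq (G := tl a * (G + 1) + 1) _) _.
    move=> w; rewrite mem_words => /andP[/eqP sw /allP aw].
    apply: leq_trans (tsize_enc_seq (G := G) _) _.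
      by move=> x /aw xs; apply: tsize_mem.
    rewrite leq_add2r leq_mul // sw; apply: leq_trans s1 _.
    by rewrite /tl /= size_enc_seq.
  by rewrite leq_add2r leq_mul // size_words leq_pexp2l.
- exact: ptime_const.
- by apply: ptime_words_step; proj.
Qed.

Lemma zip_nseq_size (T : Type) (x : unit) r (s : seq T) :
  size (flatten (map (fun=> nseq r x) s)) = r * size s.
Proof. by rewrite size_flatten /shape -map_comp sumnE big_map sum_const_seq /= size_nseq mulnC.
  Qed.

(** Numbers are compared as lengths of lists: each position of agreement contributes [r] dummy
    elements. *)
Lemma ptime_conflict A (D : A -> Prop) u r (w c : A -> seq rat) :
  (forall a, D a -> size (w a) <= size (c a)) ->
  ptime D u (fun a => enc_seq enc_rat (w a)) -> ptime D u (fun a => enc_seq enc_rat (c a)) ->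
  ptime D u (fun a => enc_bool (conflict r (w a) (c a))).
Proof.
move=> sz Hw Hc.
pose ag a := [seq p <- zip (w a) (c a) | p.1 == p.2].
have Hag : ptime D u (fun a => enc_seq (enc_pair enc_rat enc_rat) (ag a)).
  apply: (ptime_filter (P := fun _ (p : rat * rat) => p.1 == p.2) (ptime_zip sz Hw Hc)) => /=.
  by apply: (ptime_eqT enc_rat_inj); rewrite /enc_pair; proj.
pose mk a := flatten (map (fun=> nseq r tt) (ag a)).
have Hmk : ptime D u (fun a => enc_seq (fun=> Leaf) (mk a)).
  by apply: ptime_flatten; apply: (ptime_map Hag) => /=; apply: ptime_const.
apply: ptime_eq (ptime_leq_size Hw Hmk) _ => a Da.
by rewrite /conflict /mk zip_nseq_size /ag size_filter.
Qed.

Lemma ptime_greedy A (D : A -> Prop) u r (W : A -> seq (seq rat)) (N : A -> nat) :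
  (forall a w, D a -> w \in W a -> size w = N a) ->
  ptime D u (fun a => enc_words (W a)) -> ptime D u (fun a => enc_words (greedy r (W a))).
Proof.
move=> sz HW; have bW := ptime_size HW.
apply: (@ptime_foldl _ _ _ _ _ (enc_seq enc_rat) enc_words W (fun=> [::])
   (fun _ C w => if has (conflict r w) C then C else w :: C) (tsize \o (fun a => enc_words (W
     a)))) => //.
- move=> a l1 l2 Da /= ->.
  have H : forall l C, tsize (enc_words (foldl (fun C w => if has (conflict r w) C then C else
    w :: C) C l)) + 1
       <= tsize (enc_words C) + tsize (enc_words l).
    elim=> [|x l IH] C //=; apply: leq_trans (IH _) _.
    by case: ifP => _ /=; rewrite /enc_words /=; lia.
  have := H l1 [::]; have := tsize_cat (enc_seq enc_rat) l1 l2.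
  by have := tsize_gt0 (enc_words l2); rewrite /enc_words /=; lia.
- exact: ptime_const.
- set D' := (X in ptime X).
  apply: (@ptime_ifT _ _ D' _ enc_words (fun p => has (conflict r p.2.2) p.2.1) (fun p =>
    p.2.1) (fun p => p.2.2 :: p.2.1)).
  + apply: (@ptime_has _ _ D' _ (enc_seq enc_rat) (fun p => p.2.1) (fun p => conflict r
    p.2.2)); first by rewrite -/enc_words; proj.
    apply: ptime_conflict => /=; [|by proj|by proj].
    move=> [[a [C w]] c] /= [[/= Da [l1 [l2 [/= El EC]]]] /= cC].
    (* The current code is the greedy code of a prefix, so its words come from [W a] and have the
       same length as [w]. *)
    have cW : c \in W a.
      have : c \in greedy r l1 by rewrite /greedy -EC.
      by move=> /greedy_subW; rewrite El mem_cat => ->.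
    have wW : w \in W a by rewrite El mem_cat mem_head orbT.
    by rewrite (sz _ _ Da cW) (sz _ _ Da wW).
  + by proj.
  + by apply: ptime_pair; proj.
Qed.

Lemma ptime_incr A (D : A -> Prop) u (s : A -> seq bool) :
  ptime D u (fun a => enc_seq enc_bool (s a)) ->
  ptime D u (fun a => enc_seq enc_bool (incr true (s a))).
Proof.
move=> Hs; have bs := ptime_size Hs.
(* The state is the carry together with the output so far in reverse; [fin] adds a last carry. *)
pose stp (p : bool * seq bool) (x : bool) := (p.1 && x, (x != p.1) :: p.2).
pose fin (p : bool * seq bool) := catrev p.2 (if p.1 then [:: true] else [::]).
pose e := enc_pair enc_bool (enc_seq enc_bool).
have fE l p : fin (foldl stp p l) = catrev p.2 (incr p.1 l).
  by elim: l p => //= x l IH p; rewrite IH.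
have sE l p : size (foldl stp p l).2 = size l + size p.2.
  by elim: l p => //= x l IH p; rewrite IH /= addnS.
have szb (l : seq bool) : tsize (enc_seq enc_bool l) <= size l * 4 + 1.
  by apply: (tsize_enc_seq (G := 3)) => -[].
have R : ptime D u (fun a => e (foldl stp (true, [::]) (s a))).
  apply: (@ptime_foldl _ _ _ _ _ enc_bool e s (fun=> (true, [::])) (fun=> stp)
    (fun a => 4 * (tsize \o (fun a => enc_seq enc_bool (s a))) a + 5)) => //.
  - by pbounds.
  - move=> a l1 l2 Da El; rewrite /e /enc_pair /=.
    have := szb (foldl stp (true, [::]) l1).2; rewrite sE addn0.
    have := size_enc_seq enc_bool (s a); rewrite El size_cat.
    by case: (_.1) => /=; lia.
  - exact: ptime_const.
  - rewrite /e /enc_pair /=; apply: ptime_pair; last apply: ptime_pair.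
    + apply: (@ptime_eq _ _ _ (fun p => enc_bool (if p.2.1.1 then p.2.2 else false))); last first.
        by move=> [a [[[] l] x]].
      by apply: ptime_ifT; [proj|proj|exact: ptime_const].
    + by apply: ptime_not; apply: (ptime_eqT enc_bool_inj); proj.
    + by proj.
apply: (@ptime_eq _ _ _ (fun a => enc_seq enc_bool (fin (foldl stp (true, [::]) (s a))))); last
  first.
  by move=> a _; rewrite fE.
apply: ptime_catrev; first exact: ptime_tl R.
by apply: ptime_ifT; [exact: ptime_hd R|exact: ptime_const|exact: ptime_const].
Qed.

Lemma size_bits n : size (bits n) <= n.
Proof.
case: n => // n; have := bits_ge (isT : 0 < n.+1).
move=> /(leq_trans (ltn_expl _ (isT : 1 < 2))); case: (size _) => //.
Qed.

Lemma tsize_enc_nat n : tsize (enc_nat n) <= 4 * n + 1.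
Proof.
rewrite enc_natE; apply: leq_trans (tsize_enc_seq (G := 3) _) _; first by case.
by rewrite mulnC leq_add2r leq_mul // size_bits.
Qed.

(** The numerals are produced by counting up. Adding each one in front yields the descending order
    that [codebook] uses. *)
Lemma ptime_nat_iota A (D : A -> Prop) u (n : A -> nat) :
  ptime D u (fun a => enc_unary (n a)) ->
  ptime D u (fun a => Node (enc_nat (n a)) (enc_seq enc_nat (rev (iota 0 (n a))))).
Proof.
move=> Hn; have bn := ptime_size Hn.
have nE m : enc_unary m = enc_seq (fun _ : unit => Leaf) (nseq m tt).
  by elim: m => //= m ->.
have sE m : m < tsize (enc_unary m) by elim: m => //= m IH; lia.
pose eS m := Node (enc_nat m) (enc_seq enc_nat (rev (iota 0 m))).
have fE l m : foldl (fun i (_ : unit) => i.+1) m l = size l + m.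
  by elim: l m => //= x l IH m; rewrite IH addnS.
apply: (@ptime_eq _ _ _ (fun a => eS (foldl (fun i (_ : unit) => i.+1) 0 (nseq (n a) tt))));
  last first.
  by move=> a _; rewrite fE size_nseq addn0.
pose t a := (tsize \o (fun a => enc_unary (n a))) a.
apply: (@ptime_foldl _ _ _ _ _ (fun=> Leaf) eS (fun a => nseq (n a) tt) (fun=> 0) (fun _ i _ =>
  i.+1)
  (fun a => (4 * t a + 1) + (t a * ((4 * t a + 1) + 1) + 1) + 1)) => //.
- by rewrite /t; pbounds.
- move=> a l1 l2 Da El; rewrite fE addn0.
  have sn : size l1 < t a.
    apply: leq_ltn_trans (sE (n a)).
    by rewrite -(size_nseq (n a) tt) El size_cat leq_addr.
  rewrite /eS [leqLHS]/= -addn1 leq_add2r leq_add //.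
    by apply: leq_trans (tsize_enc_nat _) _; rewrite leq_add2r leq_mul // ltnW.
  apply: leq_trans (tsize_enc_seq (G := 4 * t a + 1) _) _.
    move=> x; rewrite mem_rev mem_iota => /andP[_ xs].
    by apply: leq_trans (tsize_enc_nat _) _; rewrite leq_add2r leq_mul // ltnW // (leq_trans
      xs) // ltnW.
  by rewrite leq_add2r leq_mul // size_rev size_iota ltnW.
- by apply: ptime_eq Hn _ => a _; rewrite nE.
- exact: ptime_const.
- apply: (@ptime_eq _ _ _ (fun p : A * (nat * unit) => Node (enc_nat p.2.1.+1) (enc_seq enc_nat
  (p.2.1 :: rev (iota 0 p.2.1))))); last first.
    move=> [a [m x]] _; have E : iota 0 m.+1 = iota 0 m ++ [:: m] by rewrite -addn1 iotaD.
    by rewrite /eS E rev_cat.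
  rewrite /eS; apply: ptime_pair.
    apply: (@ptime_eq _ _ _ (fun p => enc_seq enc_bool (incr true (bits p.2.1)))); last first.
      by move=> p _; rewrite enc_natE bitsS.
    by apply: ptime_incr; proj.
  by apply: ptime_cons; proj.
Qed.

Definition lookup (x : nat) (l : seq (nat * seq rat)) : seq rat :=
  head [::] [seq p.2 | p <- l & p.1 == x].

Lemma ptime_lookup A (D : A -> Prop) u (x : A -> nat) (l : A -> seq (nat * seq rat)) :
  (forall a, D a -> x a \in unzip1 (l a)) ->
  ptime D u (fun a => enc_nat (x a)) ->
  ptime D u (fun a => enc_seq (enc_pair enc_nat (enc_seq enc_rat)) (l a)) ->
  ptime D u (fun a => enc_seq enc_rat (lookup (x a) (l a))).
Proof.
move=> Hin Hx Hl; apply: (@ptime_head _ _ _ _ (enc_seq enc_rat)).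
  move=> a /Hin /mapP[p pl px]; rewrite /nilp size_map size_eq0.
  by rewrite -has_filter; apply/hasP; exists p; rewrite ?px.
apply: (@ptime_map _ _ _ _ _ (enc_pair enc_nat (enc_seq enc_rat)) _ _ (fun _ p => p.2)).
  apply: (ptime_filter (P := fun a (p : nat * seq rat) => p.1 == x a) Hl) => /=.
  apply: (ptime_eqT enc_nat_inj); first by rewrite /enc_pair; proj.
  by apply: (ptime_up fst Hx) => p [].
by rewrite /enc_pair; proj.
Qed.

(** A transposition in which [b] only supplies the number of columns. Adding rows in front reverses
    each column, whence [rev] in [columnsE]; [key_set] later reads a column as a set, for which the
    order is immaterial. *)
Definition columns (b : seq bool) (rows : seq (seq rat)) : seq (seq rat) :=
  foldl (fun cols row => [seq p.1 :: p.2 | p <- zip row cols]) (map (fun=> [::]) b) rows.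

Lemma columnsE (b : seq bool) rows : (forall w, w \in rows -> size w = size b) ->
  columns b rows = [seq rev [seq nth 0%R w i | w <- rows] | i <- iota 0 (size b)].
Proof.
move=> sz.
have fE (cols : seq (seq rat)) : size cols = size b ->
    foldl (fun cols row => [seq p.1 :: p.2 | p <- zip row cols]) cols rows =
    [seq catrev [seq nth 0%R w i | w <- rows] (nth [::] cols i) | i <- iota 0 (size b)].
  elim: rows sz cols => [|w rows IH] sz cols sc /=.
    by rewrite -sc map_nth_iota0 // take_size.
  have sw : size w = size b by apply: sz; rewrite mem_head.
  rewrite IH.
  - apply/eq_in_map => i; rewrite mem_iota => /andP[_ ib].
    rewrite (nth_map (0%R, [::])) ?size_zip ?sw ?sc ?minnn //.
    by rewrite nth_zip ?sw ?sc.
  - by move=> v vr; apply: sz; rewrite inE vr orbT.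
  - by rewrite size_map size_zip sw sc minnn.
rewrite /columns fE ?size_map //; apply/eq_in_map => i; rewrite mem_iota => /andP[_ ib].
by rewrite (nth_map true).
Qed.

Lemma ptime_columns A (D : A -> Prop) u (b : A -> seq bool) (rows : A -> seq (seq rat)) :
  (forall a w, D a -> w \in rows a -> size w = size (b a)) ->
  ptime D u (fun a => enc_seq enc_bool (b a)) ->
  ptime D u (fun a => enc_words (rows a)) ->
  ptime D u (fun a => enc_words (columns (b a) (rows a))).
Proof.
move=> sz Hb Hr; have bb := ptime_size Hb; have br := ptime_size Hr.
pose stp (cols : seq (seq rat)) row := [seq p.1 :: p.2 | p <- zip row cols].
have tE row cols : tsize (enc_words (stp cols row)) <= tsize (enc_seq enc_rat row) + tsize
  (enc_words cols).
  rewrite /enc_words /stp; elim: row cols => [|x row IH] [|c cols] /=.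
  - by [].
  - by lia.
  - by lia.
  - by have := IH cols; lia.
have fE cols l : tsize (enc_words (foldl stp cols l)) <= tsize (enc_words l) + tsize (enc_words
  cols).
  elim: l cols => [|x l IH] cols /=; first by lia.
  by apply: leq_trans (IH _) _; have := tE x cols; rewrite /enc_words /=; lia.
have szf (b0 : seq bool) l cols : size cols = size b0 ->
    (forall w, w \in l -> size w = size b0) -> size (foldl stp cols l) = size b0.
  elim: l cols => //= w l IH cols sc sl; apply: IH.
    by rewrite size_map size_zip sc sl ?minnn // mem_head.
  by move=> v vl; apply: sl; rewrite inE vl orbT.
apply: (@ptime_foldl _ _ _ _ _ (enc_seq enc_rat) enc_words rows (fun a => map (fun=> [::]) (b
  a)) (fun=> stp)
  (fun a => (tsize \o (fun a => enc_words (rows a))) a + (2 * (tsize \o (fun a => enc_seq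
    enc_bool (b a))) a + 1))) => //.
- by pbounds.
- move=> a l1 l2 Da El; apply: leq_trans (fE _ _) _; apply: leq_add.
    by rewrite /= El -(leq_add2r 1) /enc_words tsize_cat leq_add2l tsize_gt0.
  apply: leq_trans (tsize_enc_seq (G := 1) _) _; first by move=> x /mapP[? _ ->].
  by rewrite size_map mulnC leq_add2r leq_mul // size_enc_seq.
- by apply: (ptime_map (f := fun _ _ => [::]) Hb); apply: ptime_const.
- apply: (@ptime_map _ _ _ _ _ (enc_pair enc_rat (enc_seq enc_rat)) _ _ (fun _ p => p.1 :: p.2)).
    apply: ptime_zip; [|by proj|by rewrite -/enc_words; proj].
    move=> [a [cols w]] /= [Da [l1 [l2 [/= El ->]]]].
    rewrite (szf (b a)) ?size_map // ?(sz a) //; first by rewrite El mem_cat mem_head orbT.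
    by move=> v vl; apply: (sz a); rewrite // El mem_cat vl.
  by rewrite /enc_pair; apply: ptime_pair; proj.
Qed.

(** A function restricted to a fixed finite list becomes a cascade of comparisons with constants.
    This is how the gadget enters the program. *)
Lemma ptime_table A (T : eqType) (D : A -> Prop) u (e : T -> tree) (g : T -> tree) (K : seq T)
  (x : A -> T) :
  injective e -> (forall a, D a -> x a \in K) ->
  ptime D u (fun a => e (x a)) -> ptime D u (fun a => g (x a)).
Proof.
move=> ei; elim: K D => [|k K IH] D HK Hx.
  by apply: ptime_eq (ptime_const _ _ Leaf) _ => a /HK.
apply: (@ptime_eq _ _ _ (fun a => if x a == k then g k else g (x a))); last first.
  by move=> a _; case: eqP => // ->.
apply: (@ptime_if _ _ _ (fun a => x a == k)).
- by apply: (ptime_eqT ei) => //; apply: ptime_const.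
- exact: ptime_const.
apply: IH; first by move=> a [/HK]; rewrite inE => /orP[/eqP ->|//]; rewrite eqxx.
by apply: (ptime_sub (j := id) Hx) => a [].
Qed.

Definition emb (tab : seq rat -> seq rat) (b : seq bool) (rows : seq (seq rat)) : seq rat :=
  flatten (map tab (columns b rows)).

Lemma ptime_emb A (D : A -> Prop) u (tab : seq rat -> seq rat) (sg : seq rat) t
    (b : A -> seq bool) (rows : A -> seq (seq rat)) :
  (forall a w, D a -> w \in rows a -> w \in words sg (size (b a))) ->
  (forall a, D a -> size (rows a) = t) ->
  ptime D u (fun a => enc_seq enc_bool (b a)) ->
  ptime D u (fun a => enc_words (rows a)) ->
  ptime D u (fun a => enc_seq enc_rat (emb tab (b a) (rows a))).
Proof.
move=> Hw st Hb Hr.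
have sz a w : D a -> w \in rows a -> size w = size (b a).
  by move=> Da wr; have := Hw a w Da wr; rewrite mem_words => /andP[/eqP].
apply: ptime_flatten; apply: (ptime_map (f := fun=> tab) (ptime_columns sz Hb Hr)) => /=.
apply: (@ptime_table _ _ _ _ (enc_seq enc_rat) (fun k => enc_seq enc_rat (tab k)) (words sg t)).
- exact: enc_seq_inj enc_rat_inj.
- move=> [a k] /= [Da]; rewrite columnsE; last by move=> w; apply: sz.
  move=> /mapP[i]; rewrite mem_iota => /andP[_ ib] ->.
  rewrite mem_words size_rev size_map st // eqxx all_rev.
  apply/allP => _ /mapP[w wr ->].
  have := Hw a w Da wr; rewrite mem_words => /andP[/eqP sw /allP]; apply.
  by rewrite mem_nth ?sw.
- by proj.
Qed.

(** Tuples are ordered and free of repetitions, so every y-subset of [C] occurs in all its orders.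
    The resulting centers still differ, since their tags record the order. *)
Fixpoint tuples (C : seq (seq rat)) (y : nat) : seq (seq (seq rat)) :=
  if y is y'.+1 then
    flatten [seq [seq c :: t | t <- tuples C y' & c \notin t] | c <- C]
  else [:: [::]].

Lemma ptime_tuples A (D : A -> Prop) u y (C : A -> seq (seq rat)) :
  ptime D u (fun a => enc_words (C a)) ->
  ptime D u (fun a => enc_seq enc_words (tuples (C a) y)).
Proof.
move=> HC; elim: y => [|y IH] /=; first exact: ptime_const.
apply: ptime_flatten.
apply: (ptime_map (f := fun a c => [seq c :: t | t <- tuples (C a) y & c \notin t]) HC).
apply: (@ptime_map _ _ _ _ _ enc_words _ _ (fun (p : A * seq rat) t => p.2 :: t)).
  apply: (@ptime_filter _ _ _ _ enc_words _ (fun (p : A * seq rat) t => p.2 \notin t)).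
    by apply: (ptime_up fst IH) => p [].
  by apply: ptime_not; apply: (ptime_mem (enc_seq_inj enc_rat_inj)); rewrite -/enc_words; proj.
by apply: ptime_cons; rewrite -/enc_words; proj.
Qed.

Definition codebook r (sg : seq rat) n : seq (nat * seq rat) :=
  zip (rev (iota 0 n)) (greedy r (words sg (size (bits n)))).

Definition codeword r sg n x : seq rat := lookup x (codebook r sg n).

Definition enc_codebook : seq (nat * seq rat) -> tree :=
  enc_seq (enc_pair enc_nat (enc_seq enc_rat)).

Definition km_points r sg tab n (E : seq (seq nat)) : seq (seq rat) :=
  [seq (emb tab (bits n) T ++ flatten T) ++ w
    | T <- [seq map (codeword r sg n) T | T <- E], w <- words sg (size (bits n))].

(** The zero blocks equalize the dimensions: a point carries z + 1 tag blocks, a center y + m, and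
    [m] will be z - y + 1. *)
Definition km_centers r sg tab y m n : seq (seq rat) :=
  [seq (emb tab (bits n) t ++ flatten t) ++ flatten (nseq m (map (fun=> 0%R) (bits n)))
    | t <- tuples (unzip2 (codebook r sg n)) y].

Lemma size_greedy_ge r (sg : seq rat) n : 0 < r -> uniq sg -> size sg = 4 ^ r ->
  n <= size (greedy r (words sg (size (bits n)))).
Proof.
move=> r0 us sq; apply: leq_trans (greedy_size _ r0 us sq).
exact: ltnW (bits_lt n).
Qed.

Lemma unzip1_codebook r (sg : seq rat) n : 0 < r -> uniq sg -> size sg = 4 ^ r ->
  unzip1 (codebook r sg n) = rev (iota 0 n).
Proof.
move=> r0 us sq; apply: unzip1_zip.
by rewrite size_rev size_iota size_greedy_ge.
Qed.

Lemma mem_unzip2_codebook r (sg : seq rat) n c :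
  c \in unzip2 (codebook r sg n) -> c \in greedy r (words sg (size (bits n))).
Proof.
rewrite /codebook; elim: (rev _) (greedy _ _) => [|x s IH] [|d t] //=.
by rewrite !inE => /orP[->//|/IH ->]; rewrite orbT.
Qed.

Lemma codeword_mem r (sg : seq rat) n x : 0 < r -> uniq sg -> size sg = 4 ^ r -> x < n ->
  codeword r sg n x \in unzip2 (codebook r sg n).
Proof.
move=> r0 us sq xn; rewrite /codeword /lookup.
have : x \in unzip1 (codebook r sg n).
  by rewrite unzip1_codebook // mem_rev mem_iota.
elim: (codebook r sg n) => //= -[x' c] l IH /=; rewrite !inE eq_sym.
by case: eqP => [_ _ /=|_ /IH ->]; rewrite ?eqxx ?orbT.
Qed.

Lemma codeword_word r (sg : seq rat) n x : 0 < r -> uniq sg -> size sg = 4 ^ r -> x < n ->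
  codeword r sg n x \in words sg (size (bits n)).
Proof.
by move=> r0 us sq xn; apply: greedy_subW (mem_unzip2_codebook (codeword_mem r0 us sq xn)).
Qed.

(** With b the binary length of a positive n, 2^b is at most 2 n, so 4^(r b) is at most (2 n)^(2 r),
    where [r] is a constant. *)
Lemma pbound_words A (D : A -> Prop) u (n : A -> nat) r (sg : seq rat) :
  size sg = 4 ^ r -> ptime D u (fun a => enc_unary (n a)) ->
  pbound D (tsize \o u) (fun a => size sg ^ size (bits (n a))).
Proof.
move=> sq Hn; have bn := ptime_size Hn.
pose t a := (tsize \o (fun a => enc_unary (n a))) a.
apply: (@pbound_le _ _ _ _ (fun a => (2 * t a) ^ (2 * r))); first by rewrite /t; pbounds.
have sE m : m < tsize (enc_unary m) by elim: m => //= m IH; lia.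
have e4 k : (4 ^ r) ^ k = (2 ^ k) ^ (2 * r).
  by rewrite (_ : 4 = 2 ^ 2) // -!expnM; congr (2 ^ _); lia.
move=> a _; rewrite sq e4; apply: leq_expl; have := sE (n a); rewrite -/(t a) /t /=.
have [->|n0] := posnP (n a); first by move=> _; rewrite /= ; lia.
have := bits_ge n0; case: (size _) => [|k] /=; first by lia.
by rewrite expnS; lia.
Qed.

Lemma ptime_points A (D : A -> Prop) u r sg tab z (n : A -> nat) (E : A -> seq (seq nat)) :
  0 < r -> uniq sg -> size sg = 4 ^ r ->
  (forall a T, D a -> T \in E a -> size T = z /\ forall x, x \in T -> x < n a) ->
  ptime D u (fun a => enc_unary (n a)) ->
  ptime D u (fun a => enc_seq (enc_seq enc_nat) (E a)) ->
  ptime D u (fun a => enc_words (km_points r sg tab (n a) (E a))).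
Proof.
move=> r0 us sq HE Hn He.
have s0 : 0 < size sg by rewrite sq expn_gt0.
have HNI := ptime_nat_iota Hn.
have HB : ptime D u (fun a => enc_seq enc_bool (bits (n a))) := ptime_hd HNI.
have HI : ptime D u (fun a => enc_seq enc_nat (rev (iota 0 (n a)))) := ptime_tl HNI.
have HW : ptime D u (fun a => enc_words (words sg (size (bits (n a))))).
  by apply: ptime_words => //; apply: pbound_words sq Hn.
have HG : ptime D u (fun a => enc_words (greedy r (words sg (size (bits (n a)))))).
  by apply: (@ptime_greedy _ _ _ _ _ (fun a => size (bits (n a)))) => // a w _; rewrite
    mem_words => /andP[/eqP].
have HC : ptime D u (fun a => enc_codebook (codebook r sg (n a))).
  by apply: ptime_zip => // a _; rewrite size_rev size_iota size_greedy_ge.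
have HT : ptime D u (fun a => enc_seq enc_words [seq map (codeword r sg (n a)) T | T <- E a]).
  apply: (ptime_map (f := fun a => map (codeword r sg (n a))) He) => /=.
  apply: (@ptime_map _ _ _ _ _ enc_nat _ snd (fun p => codeword r sg (n p.1))); first by proj.
  apply: ptime_lookup => /=.
  - move=> [[a T] x] /= [[Da TE] xT]; rewrite unzip1_codebook // mem_rev mem_iota /=.
    exact: (HE a T Da TE).2.
  - by proj.
  - by apply: ptime_l; apply: (ptime_up (fun p => p.1.1) HC) => p [[]].
apply: ptime_flatten.
apply: (ptime_map (f := fun a T => [seq (emb tab (bits (n a)) T ++ flatten T) ++ w | w <- words
  sg (size (bits (n a)))]) HT).
apply: (@ptime_map _ _ _ _ _ (enc_seq enc_rat) _ (fun p => words sg (size (bits (n p.1)))) (fun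
  (p : A * _) w => (emb tab (bits (n p.1)) p.2 ++ flatten p.2) ++ w)).
  by apply: (ptime_up fst HW) => p [].
apply: ptime_cat; last by proj.
apply: ptime_cat; last by apply: ptime_flatten; rewrite -/enc_words; proj.
apply: (@ptime_emb _ _ _ _ sg z).
- move=> [[a T'] w] x /= [[Da /mapP[T TE ->]] _] /mapP[i iT ->].
  by apply: codeword_word => //; apply: (HE a T Da TE).2.
- move=> [[a T'] w] /= [[Da /mapP[T TE ->]] _]; rewrite size_map.
  exact: (HE a T Da TE).1.
- by apply: ptime_l; apply: (ptime_up (fun p => p.1.1) HB) => p [[]].
- by proj.
Qed.

Lemma mem_tuples (C : seq (seq rat)) y t :
  (t \in tuples C y) = [&& size t == y, uniq t & all (mem C) t].
Proof.
elim: y t => [|y IH] [|c t] //=.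
- by apply/negbTE/negP => /flattenP[s /mapP[c _ ->]] /mapP[].
- rewrite eqSS; apply/flattenP/idP.
    move=> [s /mapP[c' cC ->]] /mapP[t']; rewrite mem_filter IH => /andP[h1 /and3P[h2 h3 h4]]
      [-> ->].
    by rewrite h1 h2 h3 h4 /= cC.
  move=> /and3P[h1 /andP[h2 h3] /andP[h4 h5]].
  eexists; first by apply/mapP; exists c.
  by apply/mapP; exists t; rewrite // mem_filter h2 IH h1 h3 h5.
Qed.

Lemma ptime_centers A (D : A -> Prop) u r sg tab y m (n : A -> nat) :
  0 < r -> uniq sg -> size sg = 4 ^ r ->
  ptime D u (fun a => enc_unary (n a)) ->
  ptime D u (fun a => enc_words (km_centers r sg tab y m (n a))).
Proof.
move=> r0 us sq Hn.
have s0 : 0 < size sg by rewrite sq expn_gt0.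
have HNI := ptime_nat_iota Hn.
have HB : ptime D u (fun a => enc_seq enc_bool (bits (n a))) := ptime_hd HNI.
have HI : ptime D u (fun a => enc_seq enc_nat (rev (iota 0 (n a)))) := ptime_tl HNI.
have HW : ptime D u (fun a => enc_words (words sg (size (bits (n a))))).
  by apply: ptime_words => //; apply: pbound_words sq Hn.
have HG : ptime D u (fun a => enc_words (greedy r (words sg (size (bits (n a)))))).
  by apply: (@ptime_greedy _ _ _ _ _ (fun a => size (bits (n a)))) => // a w _; rewrite
    mem_words => /andP[/eqP].
have HC : ptime D u (fun a => enc_codebook (codebook r sg (n a))).
  by apply: ptime_zip => // a _; rewrite size_rev size_iota size_greedy_ge.
have HU : ptime D u (fun a => enc_words (unzip2 (codebook r sg (n a)))).
  by apply: (ptime_map (f := fun _ p => p.2) HC); rewrite /enc_pair; proj.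
have HZ : ptime D u (fun a => enc_seq enc_rat (flatten (nseq m (map (fun=> 0%R) (bits (n a)))))).
  elim: m => [|m IH] /=; first exact: ptime_const.
  by apply: ptime_cat => //; apply: (ptime_map (f := fun _ _ => 0%R) HB); apply: ptime_const.
apply: (@ptime_map _ _ _ _ _ enc_words _ _ (fun a t => (emb tab (bits (n a)) t ++ flatten t) ++
  flatten (nseq m (map (fun=> 0%R) (bits (n a)))))).
  exact: ptime_tuples.
apply: ptime_cat; last by apply: (ptime_up fst HZ) => p [].
apply: ptime_cat; last by apply: ptime_flatten; rewrite -/enc_words; proj.
apply: (@ptime_emb _ _ _ _ sg y).
- move=> [a t] x /= [Da]; rewrite mem_tuples => /and3P[_ _ /allP H] /H xU.
  exact: greedy_subW (mem_unzip2_codebook xU).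
- by move=> [a t] /= [Da]; rewrite mem_tuples => /and3P[/eqP].
- by apply: (ptime_up fst HB) => p [].
- by proj.
Qed.

Local Open Scope ring_scope.

(** * Rational gap gadgets *)

Lemma powRKV (R : realType) (p x : R) : 0 < p -> 0 <= x -> (x `^ p^-1) `^ p = x.
Proof. by move=> p0 x0; rewrite -powRrM mulVf ?gt_eqF // powRr1. Qed.

Lemma powRVK (R : realType) (p x : R) : 0 < p -> 0 <= x -> (x `^ p) `^ p^-1 = x.
Proof. by move=> p0 x0; rewrite -powRrM mulfV ?gt_eqF // powRr1. Qed.

Lemma ler_powRl (R : realType) (p x y : R) : 0 <= p -> 0 <= x -> x <= y -> x `^ p <= y `^ p.
Proof.
by move=> p0 x0 xy; apply: ge0_ler_powR => //; rewrite nnegrE // (le_trans x0).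
Qed.

(** By monotonicity it suffices to solve for the points [u] and [l] where the power equals c^p + e
    and c^p - e. If c^p is at most e, nonnegativity replaces the lower point. *)
Lemma powR_cont (R : realType) (p c e : R) : 0 < p -> 0 <= c -> 0 < e ->
  exists2 del : R, 0 < del & forall x, 0 <= x -> `|x - c| <= del -> `|x `^ p - c `^ p| <= e.
Proof.
move=> p0 c0 e0; have cp := powR_ge0 c p.
have ip : 0 < p^-1 by rewrite invr_gt0.
pose u := (c `^ p + e) `^ p^-1.
have cu : c < u.
  by rewrite -[c in c < _](powRVK p0 c0) gt0_ltr_powR ?nnegrE //; lra.
have up : u `^ p = c `^ p + e by rewrite powRKV //; lra.
have upper x : 0 <= x -> x - c <= u - c -> x `^ p - c `^ p <= e.
  move=> x0 xu; have : x `^ p <= u `^ p by apply: ler_powRl => //; lra.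
  by rewrite up; lra.
have [ce|ce] := leP (c `^ p) e.
  exists (u - c); first lra.
  move=> x x0; rewrite ler_norml => /andP[_ /(upper x x0)] h.
  by rewrite ler_norml h andbT; have := powR_ge0 x p; lra.
pose l := (c `^ p - e) `^ p^-1.
have lc : l < c.
  by rewrite -[c in _ < c](powRVK p0 c0) gt0_ltr_powR ?nnegrE //; lra.
have lp : l `^ p = c `^ p - e by rewrite powRKV //; lra.
exists (Num.min (u - c) (c - l)); first by rewrite lt_min !subr_gt0 cu lc.
move=> x x0; rewrite le_min => /andP[]; rewrite ler_norml => /andP[_ /(upper x x0) h].
rewrite ler_norml => /andP[h2 _]; rewrite ler_norml h andbT.
have : l `^ p <= x `^ p.
  apply: ler_powRl; [exact: ltW|exact: powR_ge0|].
  by move: h2; rewrite opprB lerD2r.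
by rewrite lp; clear; lra.
Qed.

Lemma fin_lower_bound (R : realType) (I : finType) (del : I -> R) :
  (forall i, 0 < del i) -> exists2 d0 : R, 0 < d0 & forall i, d0 <= del i.
Proof.
move=> del0; have s0 : 0 <= \sum_i (del i)^-1.
  by apply: sumr_ge0 => i _; rewrite invr_ge0 ltW.
(* This stands in for a minimum; the summand 1 keeps it meaningful for an empty index type. *)
exists (1 + \sum_i (del i)^-1)^-1; first by rewrite invr_gt0; lra.
move=> i; rewrite -[leRHS]invrK lef_pV2 ?posrE ?invr_gt0 //; last lra.
rewrite (bigD1 i) //= in s0 *.
have : 0 <= \sum_(j | j != i) (del j)^-1 by apply: sumr_ge0 => j _; rewrite invr_ge0 ltW.
by lra.
Qed.

(** The p-th power of the lp-distance. *)
Definition pdist (R : realType) (p : R) (d : nat) (f g : 'I_d -> R) : R :=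
  \sum_i `|f i - g i| `^ p.

Lemma pdist_ge0 (R : realType) (p : R) d (f g : 'I_d -> R) : 0 <= pdist p f g.
Proof. by apply: sumr_ge0 => i _; apply: powR_ge0. Qed.

Lemma rat_approx (R : realType) (p e : R) (V : finType) d (tau : V -> 'I_d -> R) :
  0 < p -> 0 < e -> exists a : V -> 'I_d -> rat, forall u v,
    `|pdist p (ratr \o a u) (ratr \o a v) - pdist p (tau u) (tau v)| <= e.
Proof.
(* Each coordinate gets an equal share of the error; [d.+1] avoids a division by zero for d = 0. *)
move=> p0 e0; have e1 : 0 < e / d.+1%:R by rewrite divr_gt0.
have /choice[del Hdel] : forall t : V * V * 'I_d, exists del : R, 0 < del /\
    forall x, 0 <= x -> `|x - `|tau t.1.1 t.2 - tau t.1.2 t.2| | <= del ->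
    `|x `^ p - `|tau t.1.1 t.2 - tau t.1.2 t.2| `^ p| <= e / d.+1%:R.
  move=> t; have [del h1 h2] := powR_cont p0 (normr_ge0 (tau t.1.1 t.2 - tau t.1.2 t.2)) e1.
  by exists del.
have [d0 d0p Hd0] := @fin_lower_bound R _ del (fun t => (Hdel t).1).
have /choice[a Ha] : forall t : V * 'I_d, exists r : rat, `|ratr r - tau t.1 t.2| <= d0 / 2.
  move=> t; have [|r] := @rat_in_itvoo R (tau t.1 t.2 - d0 / 2) (tau t.1 t.2 + d0 / 2); first lra.
  rewrite in_itv /= => /andP[h1 h2]; exists r; rewrite ler_norml; apply/andP; split; lra.
exists (fun v i => a (v, i)) => u v; rewrite /pdist -sumrB.
apply: le_trans (ler_norm_sum _ _ _) _.
apply: (@le_trans _ _ (\sum_(i < d) e / d.+1%:R)); last first.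
  rewrite sumr_const card_ord -[_ *+ d]mulr_natr mulrAC ler_pdivrMr ?ltr0n //.
  by rewrite ler_wpM2l ?ler_nat // ltW.
apply: ler_sum => i _; apply: (Hdel (u, v, i)).2 => //=.
apply: le_trans (ler_dist_dist _ _) _.
have := Ha (u, i); have := Ha (v, i); have := Hd0 (u, v, i) => /= h0 hv hu.
apply: le_trans h0.
rewrite (_ : _ - _ = (ratr (a (u, i)) - tau u i) - (ratr (a (v, i)) - tau v i)); last by ring.
by apply: le_trans (ler_normB _ _) _; lra.
Qed.

(** Coordinatewise, |x + y| is at most twice the larger of |x| and |y|. The constant 2^p is crude
    but depends on [p] only. *)
Lemma pdist_triangle (R : realType) (p : R) d (f g h : 'I_d -> R) : 0 < p ->
  pdist p f h <= 2 `^ p * (pdist p f g + pdist p g h).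
Proof.
move=> p0; rewrite /pdist -big_split /= big_distrr /=; apply: ler_sum => i _.
have key (x y : R) : `|x + y| `^ p <= 2 `^ p * (`|x| `^ p + `|y| `^ p).
  wlog xy : x y / `|x| <= `|y|.
    move=> W; have [|/ltW] := leP `|x| `|y|; first exact: W.
    by move/W; rewrite addrC [X in _ * X]addrC.
  apply: (@le_trans _ _ (2 `^ p * `|y| `^ p)); last first.
    by rewrite ler_pM2l ?powR_gt0 // lerDr powR_ge0.
  rewrite -powRM //; apply: ler_powRl; rewrite ?normr_ge0 //; first exact: ltW.
  by apply: le_trans (ler_normD _ _) _; lra.
by rewrite -[f i - h i](subrKA (g i)); apply: key.
Qed.

Lemma pdistC (R : realType) (p : R) d (f g : 'I_d -> R) : pdist p f g = pdist p g f.
Proof. by apply: eq_bigr => i _; rewrite distrC. Qed.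

(** Bounds [pdist] between two z-sets that are [m] swaps apart: one swap costs at most 2^p * 2 for
    its two edges, and joining it to the rest costs another factor 2^p. *)
Fixpoint diam (R : realType) (p : R) (m : nat) : R :=
  if m is m'.+1 then 2 `^ p * (diam p m' + 2 `^ p * 2) else 0.

Lemma diam_ge0 (R : realType) (p : R) m : 0 <= diam p m.
Proof.
elim: m => //= m IH; have h := powR_ge0 2 p.
by apply: mulr_ge0 => //; apply: addr_ge0 => //; apply: mulr_ge0.
Qed.

Lemma subset_card_ex (T : finType) (A : {set T}) m : (m <= #|A|)%N ->
  exists2 B : {set T}, B \subset A & #|B| = m.
Proof.
move=> mA; have [s sm] : exists s : seq T, s = take m (enum A) by eexists.
exists [set x in s].
  by apply/fintype.subsetP => x; rewrite inE sm => /mem_take; rewrite mem_enum.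
rewrite cardsE (card_uniqP _) ?sm ?take_uniq ?enum_uniq //.
by rewrite size_takel // -cardE.
Qed.

Lemma supset_card_ex (T : finType) (A : {set T}) m : (#|A| <= m <= #|T|)%N ->
  exists2 B : {set T}, A \subset B & #|B| = m.
Proof.
move=> /andP[Am mT]; have [|C CA Cm] := @subset_card_ex _ (~: A) (m - #|A|).
  by have := cardsC A; lia.
exists (A :|: C); first exact: finset.subsetUl.
rewrite cardsU (_ : A :&: C = finset.set0) ?cards0; first lia.
apply/finset.setP => x; rewrite !inE; apply/negbTE/negP => /andP[xA /(fintype.subsetP CA)].
by rewrite inE xA.
Qed.

(* One swap moves along two edges through a common [y]-subset, so the distances
   in a realization are bounded independently of [q]. *)
Lemma johnson_diam (R : realType) (p : R) q z y d (tL tR : {set 'I_q} -> 'I_d -> R) :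
  0 < p -> (y < z)%N -> (z <= q)%N ->
  (forall S S' : {set 'I_q}, #|S| = z -> #|S'| = y -> S' \subset S -> pdist p (tL S) (tR S') =
    1) ->
  forall S S' : {set 'I_q}, #|S| = z -> #|S'| = y -> pdist p (tL S) (tR S') <= 2 `^ p * (diam p
    z + 1).
Proof.
move=> p0 yz zq He.
have step m (S S' : {set 'I_q}) : #|S| = z -> #|S'| = z -> (#|S :\: S'| <= m)%N ->
    pdist p (tL S) (tL S') <= diam p m.
  elim: m S S' => [|m IH] S S' cS cS'.
    rewrite leqn0 cards_eq0 finset.setD_eq0 => sub.
    have -> : S = S' by apply/eqP; rewrite eqEcard sub cS cS' leqnn.
    by rewrite /pdist big1 /= ?lexx // => i _; rewrite subrr normr0 powR0 // gt_eqF.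
  rewrite leq_eqVlt => /orP[/eqP Sm|]; last first.
    rewrite ltnS => /(IH _ _ cS cS') h0; apply: le_trans h0 _ => /=.
    have h : 1 <= 2 `^ p.
      have e1 : 1 `^ p = 1 :> R by rewrite powR1.
      by rewrite -[leLHS]e1; apply: ler_powRl; lra.
    have := @diam_ge0 R p m; nra.
  have [a aS] : exists a, a \in S :\: S' by apply/finset.set0Pn; rewrite -card_gt0 Sm.
  have [b bS] : exists b, b \in S' :\: S.
    by apply/finset.set0Pn; rewrite -card_gt0; have := cardsID S' S; have := cardsID S S';
      rewrite finset.setIC; lia.
  move: aS bS; rewrite !inE => /andP[aS' aS] /andP[bS bS'].
  pose S2 := a |: S' :\ b.
  have cb : #|S' :\ b| = z.-1 by have := finset.cardsD1 b S'; rewrite bS' cS'; lia.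
  have cS2 : #|S2| = z.
    by rewrite /S2 cardsU1 cb !inE (negbTE aS') andbF /=; lia.
  have SD : (#|S :\: S2| <= m)%N.
    have -> : S :\: S2 = (S :\: S') :\ a.
      apply/finset.setP => x; rewrite !inE; case: eqP => //= _.
      by case: (x =P b) => [->|_] //=; rewrite (negbTE bS) !andbF.
    by have := finset.cardsD1 a (S :\: S'); rewrite !inE aS aS' Sm; lia.
  (* [S2] is [S'] with [b] exchanged for [a]. A common y-subset must avoid both, and it exists
     because y < z. *)
  have [|v vb cv] := @subset_card_ex _ (S' :\ b) y; first by rewrite cb; lia.
  have e1 : pdist p (tL S2) (tR v) = 1.
    by apply: He => //; exact: fintype.subset_trans vb (finset.subsetUr _ _).
  have e2 : pdist p (tL S') (tR v) = 1.
    by apply: He => //; exact: fintype.subset_trans vb (finset.subD1set _ _).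
  have h1 := pdist_triangle (tL S) (tL S2) (tL S') p0.
  have h2 := pdist_triangle (tL S2) (tR v) (tL S') p0.
  rewrite e1 [pdist p (tR v) _]pdistC e2 in h2.
  apply: le_trans h1 _ => /=; rewrite ler_pM2l ?powR_gt0 //.
  by apply: lerD; [apply: IH|].
move=> S S' cS cS'.
have [|U SU cU] := @supset_card_ex _ S' z; first by rewrite cS' card_ord; lia.
apply: le_trans (pdist_triangle _ (tL U) _ p0) _.
rewrite ler_pM2l ?powR_gt0 // (He U S') // lerD2r step //.
by rewrite -cS subset_leq_card // finset.subsetDl.
Qed.

(** * Realizations with a nearly optimal gap *)

Lemma gamma_le (R : realType) (p : R) q z y : (1 <= y)%N -> (y < z)%N -> (z <= q)%N ->
  (gamma p (z - y) <= gap_number p (johnson_graph q z y))%E.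
Proof.
move=> y1 yz zq; apply: ereal_inf_lbound; exists q, z; split => //; first lia.
by rewrite subKn // ltnW.
Qed.

Lemma gap_number_ge1 (R : realType) (p : R) G : (-oo < gap_number p G -> 1 <= gap_number p G)%E.
Proof.
move=> /ereal_sup_gt[_ [lam [lam1 h] <-] _].
by apply: le_ereal_sup_tmp; exists lam%:E; [exists lam|rewrite lee_fin].
Qed.

(** A finite infimum excludes gap numbers equal to -oo, that is, suprema of the empty set. Every gap
    number is then a supremum of values that are at least 1. *)
Lemma gamma_ge1 (R : realType) (p : R) D r : gamma p D = r%:E -> 1 <= r.
Proof.
move=> E; rewrite -lee_fin -E; apply: le_ereal_inf_tmp => _ [q [t [Dt tq ->]]].
apply: gap_number_ge1; apply: (@lt_le_trans _ _ r%:E); first exact: ltNyr.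
by rewrite -E; apply: ereal_inf_lbound; exists q, t.
Qed.

Lemma lp_norm_pow (R : realType) (p : R) d (v : 'rV[R]_d) : 0 < p ->
  lp_norm p v `^ p = \sum_(i < d) `|v 0 i| `^ p.
Proof.
by move=> p0; rewrite powRKV //; apply: sumr_ge0 => i _; apply: powR_ge0.
Qed.

Lemma johnson_realization (R : realType) (p k : R) q z y :
  1 <= p -> 0 < k -> (1 <= y)%N -> (y < z)%N -> (z <= q)%N ->
  exists (lam : R) (d : nat) (tL tR : {set 'I_q} -> 'I_d -> R),
  [/\ 1 <= lam, fine (gamma p (z - y)) ^+ 2 - k <= lam ^+ 2,
     forall S S' : {set 'I_q}, #|S| = z -> #|S'| = y -> S' \subset S -> pdist p (tL S) (tR S') = 1
   & forall S S' : {set 'I_q}, #|S| = z -> #|S'| = y -> ~~ (S' \subset S) ->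
       lam `^ p <= pdist p (tL S) (tR S')].
Proof.
move=> p1 k0 y1 yz zq; have p0 : 0 < p by lra.
(* [fine] sends infinite values to 0. In that case [lam] = 1 with all distances equal to 1 is
   enough. *)
have triv : fine (gamma p (z - y)) = 0 ->
   exists (lam : R) (d : nat) (tL tR : {set 'I_q} -> 'I_d -> R),
  [/\ 1 <= lam, fine (gamma p (z - y)) ^+ 2 - k <= lam ^+ 2,
     forall S S' : {set 'I_q}, #|S| = z -> #|S'| = y -> S' \subset S -> pdist p (tL S) (tR S') = 1
   & forall S S' : {set 'I_q}, #|S| = z -> #|S'| = y -> ~~ (S' \subset S) ->
       lam `^ p <= pdist p (tL S) (tR S')].
  move=> ->; exists 1, 1%N, (fun _ _ => 0), (fun _ _ => 1).
  have E : pdist p (fun _ : 'I_1 => 0) (fun _ : 'I_1 => 1) = 1 :> R.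
    by rewrite /pdist big_ord1 sub0r normrN1 powR1.
  by split => // *; rewrite ?E ?powR1 ?expr1n ?expr0n /=; lra.
case Eg : (gamma p (z - y)) => [r| |] /=; [|by move: triv; rewrite Eg; apply..].
have r1 := gamma_ge1 Eg.
(* The supremum need not be attained. A loss of k / (2 r) in [lam] is a loss of at most k in its
   square. *)
have kr : 0 < k / (2 * r) by rewrite divr_gt0 //; lra.
have : ((r - k / (2 * r))%:E < gap_number p (johnson_graph q z y))%E.
  apply: lt_le_trans (gamma_le p y1 yz zq); rewrite Eg lte_fin; lra.
move=> /ereal_sup_gt[_ [lam [lam1 [d [e [tau [_ [[beta b0 Hb] _]]]]]] <-]].
rewrite lte_fin => rlam.
(* Division by [beta] puts adjacent vertices at distance 1; [insub] extends the map from the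
   vertices to all sets. *)
pose tL (S : {set 'I_q}) (i : 'I_d) : R :=
  if insub S is Some u then beta^-1 * tau (inl u) 0 i else 0.
pose tR (S : {set 'I_q}) (i : 'I_d) : R :=
  if insub S is Some u then beta^-1 * tau (inr u) 0 i else 0.
have bi : 0 < beta^-1 by rewrite invr_gt0.
have dE (u : lside (johnson_graph q z y)) (v : rside (johnson_graph q z y)) :
    pdist p (tL (val u)) (tR (val v)) = (beta^-1 * lp_norm p (tau (inl u) - tau (inr v))) `^ p.
  rewrite powRM; [|exact: ltW|exact: powR_ge0].
  rewrite lp_norm_pow // big_distrr /=.
  apply: eq_bigr => i _; rewrite /tL /tR !valK -mulrBr normrM gtr0_norm //.
  by rewrite powRM ?normr_ge0 ?(ltW bi) // !mxE.
exists lam, d, tL, tR; split => //.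
- have [|lr] := leP r lam; first by nra.
  have E : k = 2 * r * (k / (2 * r)) by field; lra.
  set w := k / (2 * r) in E kr rlam; rewrite E; nra.
- move=> S S' /eqP cS /eqP cS' SS.
  have := Hb (Sub S cS) (Sub S' cS'); have := dE (Sub S cS) (Sub S' cS').
  by rewrite /edge /= SS => -> ->; rewrite mulVf ?gt_eqF // powR1.
- move=> S S' /eqP cS /eqP cS' SS.
  have := Hb (Sub S cS) (Sub S' cS'); have := dE (Sub S cS) (Sub S' cS').
  rewrite /edge /= (negbTE SS) => -> h; apply: ler_powRl; [lra|lra|].
  by rewrite ler_pdivlMl // mulrC.
Qed.

Definition sdist (R : realType) (p : R) (s t : seq rat) : R :=
  \sum_(xy <- zip s t) `|ratr xy.1 - ratr xy.2| `^ p.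

Lemma sdist_ge0 (R : realType) (p : R) s t : 0 <= sdist p s t.
Proof. by apply: sumr_ge0 => i _; apply: powR_ge0. Qed.

Lemma sdist_cat (R : realType) (p : R) s t s' t' : size s = size t ->
  sdist p (s ++ s') (t ++ t') = sdist p s t + sdist p s' t'.
Proof. by move=> st; rewrite /sdist zip_cat // big_cat. Qed.

(** The order of the quantifiers is the point: [M] precedes [q], so that the alphabet can be chosen
    large in terms of [M]. The final + 1 in its value absorbs the error of the rational
    approximation. *)
Lemma johnson_gadget (R : realType) (p : R) z y :
  1 <= p -> (1 <= y)%N -> (y < z)%N -> exists2 M : R, 0 <= M &
  forall q th, (z <= q)%N -> 0 < th -> th <= 1 ->
  exists (lam : R) (d : nat) (gL gR : {set 'I_q} -> seq rat),
  [/\ 1 <= lam, fine (gamma p (z - y)) ^+ 2 - th <= lam ^+ 2,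
     forall S, size (gL S) = d /\ size (gR S) = d,
     forall S S', sdist p (gL S) (gR S') <= M
   & forall S S' : {set 'I_q}, #|S| = z -> #|S'| = y ->
      [/\ S' \subset S -> sdist p (gL S) (gR S') <= 1 + th,
          1 - th <= sdist p (gL S) (gR S')
        & ~~ (S' \subset S) -> lam `^ p - th <= sdist p (gL S) (gR S')]].
Proof.
move=> p1 y1 yz; have p0 : 0 < p by lra.
exists (2 `^ p * (diam p z + 1) + 1).
  by apply: addr_ge0 => //; apply: mulr_ge0; rewrite ?powR_ge0 // addr_ge0 ?diam_ge0.
move=> q th zq th0 th1.
have [lam [d [tL [tR [lam1 lamg He Hn]]]]] := johnson_realization p1 th0 y1 yz zq.
have HM := johnson_diam p0 yz zq He.
pose V := ({set 'I_q} + {set 'I_q})%type.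
pose tau (v : V) := match v with inl A => tL A | inr A => tR A end.
have [a Ha] := rat_approx tau p0 th0.
have [|U _ cU] := @supset_card_ex 'I_q finset.set0 z; first by rewrite cards0 card_ord.
have [|W _ cW] := @supset_card_ex 'I_q finset.set0 y.
  by rewrite cards0 card_ord (leq_trans (ltnW yz)).
(* At a position with a collision a set of letters may have the wrong size. It is then sent to a
   fixed vertex, so that [M] bounds the distances for all pairs of sets. *)
pose fL (A : {set 'I_q}) := if #|A| == z then A else U.
pose fR (A : {set 'I_q}) := if #|A| == y then A else W.
have cL S : #|fL S| = z by rewrite /fL; case: eqP.
have cR S : #|fR S| = y by rewrite /fR; case: eqP.
exists lam, d, (fun S => map (a (inl (fL S))) (enum 'I_d)), (fun S => map (a (inr (fR S)))
  (enum 'I_d)).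
have sE (f g : 'I_d -> rat) : sdist p (map f (enum 'I_d)) (map g (enum 'I_d)) = pdist p (ratr
  \o f) (ratr \o g).
  by rewrite /sdist zip_map big_map big_enum.
have h0 (v w : V) := pdist_ge0 p (tau v) (tau w).
split => //.
- by move=> S; split; rewrite size_map size_enum_ord.
- move=> S S'; rewrite sE; have := Ha (inl (fL S)) (inr (fR S')).
  have := HM _ _ (cL S) (cR S'); rewrite ler_norml => h /andP[_ h2]; move: h h2 th1 => /=;
    clear; lra.
move=> S S' cS cS'; rewrite sE /fL /fR cS cS' !eqxx.
have := Ha (inl S) (inr S'); rewrite ler_norml => /andP[].
set x := pdist p (ratr \o _) _; rewrite /=; move=> h1 h2; split.
- by move=> SS; move: h2; rewrite He //; clear; lra.
- have [SS|SS] := boolP (S' \subset S); first by move: h1; rewrite He //; clear; lra.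
  have := Hn _ _ cS cS' SS; have : 1 <= lam `^ p.
    have e1 : 1 `^ p = 1 :> R by rewrite powR1.
    by rewrite -[leLHS]e1; apply: ler_powRl; lra.
  by move: h1; clear; lra.
- by move=> SS; have := Hn _ _ cS cS' SS; move: h1; clear; lra.
Qed.

Local Close Scope ring_scope.

(** * Distances between points and centers *)

Lemma uniq_greedy (T : eqType) r (W : seq (seq T)) : 0 < r -> uniq (greedy r W).
Proof.
move=> r0; have := @greedy_pairwise T r W [::] isT; rewrite -/(greedy r W) uniq_pairwise.
apply: sub_pairwise => w c; apply: contra => /eqP ->.
by rewrite /conflict agreexx leq_pmull.
Qed.

Lemma greedy_agree (T : eqType) r b (W : seq (seq T)) w c :
  (forall w, w \in W -> size w = b) ->
  w \in greedy r W -> c \in greedy r W -> w != c -> r * agree w c < b.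
Proof.
move=> szW; have sz : forall w, w \in greedy r W -> size w = b.
  by move=> x /greedy_subW; apply: szW.
have := @greedy_pairwise T r W [::] isT; rewrite -/(greedy r W).
elim: (greedy r W) sz => //= x C IH sz /andP[xC pC].
have szC : forall w, w \in C -> size w = b by move=> v vC; apply: sz; rewrite inE vC orbT.
have hx v : v \in C -> r * agree x v < b.
  move=> vC; have := allP xC _ vC; rewrite /conflict -ltnNge.
  by rewrite sz // mem_head.
rewrite !inE => /orP[/eqP ->|wC] /orP[/eqP ->|cC]; rewrite ?eqxx //.
- by move=> _; apply: hx.
- by move=> _; rewrite agree_sym; apply: hx.
- exact: IH.
Qed.

Lemma agree_nth (T : eqType) (x0 : T) b w c : size w = b -> size c = b ->
  agree w c = \sum_(i <- iota 0 b) (nth x0 w i == nth x0 c i).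
Proof.
move=> sw sc; rewrite /agree; have -> : zip w c = [seq (nth x0 w i, nth x0 c i) | i <- iota 0 b].
  apply: (@eq_from_nth _ (x0, x0)); first by rewrite size_zip size_map size_iota sw sc minnn.
  move=> i; rewrite size_zip sw sc minnn => ib; rewrite nth_zip ?sw //.
  by rewrite (nth_map 0) ?size_iota // nth_iota.
rewrite count_map -sum1_count big_mkcond; apply: eq_bigr => i _ /=.
by case: eqP.
Qed.

Definition good_col (T : eqType) (x0 : T) (L : seq (seq T)) (i : nat) : bool :=
  all (fun w => all (fun c => (nth x0 w i == nth x0 c i) ==> (w == c)) L) L.

Lemma good_colP (T : eqType) (x0 : T) (L : seq (seq T)) i w c :
  good_col x0 L i -> w \in L -> c \in L -> nth x0 w i = nth x0 c i -> w = c.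
Proof.
move=> /allP h wL cL e; have /allP /(_ c cL) := h w wL.
by rewrite e eqxx => /eqP.
Qed.

(** Double counting: every bad column is charged to an ordered pair of distinct words that agree
    there, and each of the at most |L|^2 pairs is charged fewer than b / r times. *)
Lemma bad_cols (T : eqType) (x0 : T) r b (L : seq (seq T)) :
  (forall w, w \in L -> size w = b) ->
  (forall w c, w \in L -> c \in L -> w != c -> r * agree w c < b) ->
  r * count (predC (good_col x0 L)) (iota 0 b) <= size L ^ 2 * b.
Proof.
move=> sz ag; pose F i w c := (w != c) && (nth x0 w i == nth x0 c i) : nat.
have : count (predC (good_col x0 L)) (iota 0 b) <=
    \sum_(i <- iota 0 b) \sum_(w <- L) \sum_(c <- L) F i w c.
  rewrite -sum1_count big_mkcond; apply: leq_sum => i _ /=.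
  case: ifP => // /allPn[w wL /allPn[c cL]]; rewrite negb_imply => /andP[e ne].
  rewrite (big_rem w) //= (big_rem c) //= /F ne e; lia.
move=> h; apply: leq_trans (leq_mul (leqnn r) h) _.
rewrite exchange_big /=; under eq_bigr do rewrite exchange_big /=.
have -> : size L ^ 2 * b = \sum_(w <- L) \sum_(c <- L) b.
  by rewrite !sum_const_seq mulnA mulnn.
rewrite big_distrr /=.
rewrite [leqLHS]big_seq [leqRHS]big_seq; apply: leq_sum => w wL.
rewrite big_distrr /= [leqLHS]big_seq [leqRHS]big_seq; apply: leq_sum => c cL.
have [<-|ne] := eqVneq w c; first by rewrite big1 ?muln0 // => i _; rewrite /F eqxx.
apply: ltnW; apply: leq_ltn_trans (ag w c wL cL ne).
by rewrite leq_mul // (agree_nth x0 (sz w wL) (sz c cL)); apply: leq_sum => i _; rewrite /F ne.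
Qed.

Lemma sdist_flatten (R : realType) (p : R) (I : Type) (F G : I -> seq rat) (s : seq I) :
  (forall i, size (F i) = size (G i)) ->
  sdist p (flatten (map F s)) (flatten (map G s)) = (\sum_(i <- s) sdist p (F i) (G i))%R.
Proof.
move=> FG; elim: s => [|i s IH] /=; first by rewrite /sdist big_nil big_nil.
by rewrite sdist_cat // IH big_cons.
Qed.

(* [sym] identifies the abstract alphabet ['I_q] with small rationals, so that a
   codeword is itself a short vector and serves as an identifying tag. *)
Definition sym (q m : nat) (j : nat) : rat := (j%:R / (q * m)%:R)%R.

Definition alphabet q m : seq rat := [seq sym q m j | j <- iota 0 q].

Definition key_set q m (k : seq rat) : {set 'I_q} := [set j : 'I_q | sym q m j \in k].

Lemma sym_inj q m : 0 < q -> 0 < m -> injective (sym q m).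
Proof.
move=> q0 m0 i j /divIf h; apply/eqP; rewrite -(@eqr_nat rat); apply/eqP; apply: h.
by rewrite pnatr_eq0 -lt0n muln_gt0 q0.
Qed.

Lemma uniq_alphabet q m : 0 < q -> 0 < m -> uniq (alphabet q m).
Proof. by move=> q0 m0; rewrite map_inj_uniq ?iota_uniq //; apply: sym_inj. Qed.

Lemma size_alphabet q m : size (alphabet q m) = q.
Proof. by rewrite size_map size_iota. Qed.

Lemma key_set_mem q m k x : x \in k -> x \in alphabet q m ->
  exists2 j : 'I_q, j \in key_set q m k & x = sym q m j.
Proof.
move=> xk /mapP[j]; rewrite mem_iota add0n => /andP[_ jq] E.
by exists (Ordinal jq); rewrite // inE -E.
Qed.

Lemma card_key_set q m k : 0 < q -> 0 < m -> uniq k -> all (mem (alphabet q m)) k ->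
  #|key_set q m k| = size k.
Proof.
move=> q0 m0 uk /allP ak.
rewrite cardE -(size_map (fun j : 'I_q => sym q m j)); apply: perm_size.
apply: uniq_perm => //.
  by rewrite map_inj_uniq ?enum_uniq // => i j /(sym_inj q0 m0) /val_inj.
move=> x; apply/mapP/idP => [[j]|xk]; first by rewrite mem_enum inE => ? ->.
have [j jk ->] := key_set_mem xk (ak x xk).
by exists j; rewrite ?mem_enum.
Qed.

Local Open Scope ring_scope.

Lemma sum_upper (R : realType) (s : seq nat) (P : pred nat) (f : nat -> R) A M :
  0 <= A -> (forall i, i \in s -> P i -> f i <= A) -> (forall i, f i <= M) ->
  \sum_(i <- s) f i <= (size s)%:R * A + (count (predC P) s)%:R * M.
Proof.
move=> A0 h1 h2; elim: s h1 => [|i s IH] h1; first by rewrite big_nil /= !mul0r addr0.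
rewrite big_cons /=; have {}IH := IH (fun j js => h1 j (mem_behead (s := i :: s) js)).
rewrite -[(size s).+1]addn1 !natrD !mulrDl.
have [Pi|Pi] /= := boolP (P i); first by have := h1 i (mem_head _ _) Pi; move: IH; lra.
by have := h2 i; move: IH A0; lra.
Qed.

Lemma sum_lower (R : realType) (s : seq nat) (P : pred nat) (f : nat -> R) a :
  (forall i, i \in s -> P i -> a <= f i) -> (forall i, 0 <= f i) ->
  ((size s)%:R - (count (predC P) s)%:R) * a <= \sum_(i <- s) f i.
Proof.
move=> h1 h2; elim: s h1 => [|i s IH] h1; first by rewrite big_nil /= subrr mul0r.
rewrite big_cons /=; have {}IH := IH (fun j js => h1 j (mem_behead (s := i :: s) js)).
rewrite -[(size s).+1]addn1 !natrD.
have [Pi|Pi] /= := boolP (P i); first by have := h1 i (mem_head _ _) Pi; move: IH; lra.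
by have := h2 i; move: IH; lra.
Qed.

(** In a good column, reading the letter is injective on the rows of both lists together; this gives
    the sizes of the key sets and reflects non-inclusion. A bad column contributes between 0 and
    [M]. *)
Lemma emb_dist (R : realType) (p : R) r z y q m M th lam d
    (gL gR : {set 'I_q} -> seq rat) (bs : seq bool) (rows1 rows2 : seq (seq rat)) :
  (0 < q)%N -> (0 < m)%N -> 0 <= th ->
  (forall S, size (gL S) = d /\ size (gR S) = d) ->
  (forall S S', sdist p (gL S) (gR S') <= M) ->
  (forall S S' : {set 'I_q}, #|S| = z -> #|S'| = y ->
      [/\ S' \subset S -> sdist p (gL S) (gR S') <= 1 + th,
          1 - th <= sdist p (gL S) (gR S')
        & ~~ (S' \subset S) -> lam `^ p - th <= sdist p (gL S) (gR S')]) ->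
  uniq rows1 -> uniq rows2 -> size rows1 = z -> size rows2 = y ->
  (forall w, w \in rows1 ++ rows2 -> w \in words (alphabet q m) (size bs)) ->
  (forall w c, w \in rows1 ++ rows2 -> c \in rows1 ++ rows2 -> w != c -> (r * agree w c < size
    bs)%N) ->
  let X := sdist p (emb (gL \o key_set q m) bs rows1) (emb (gR \o key_set q m) bs rows2) in
  exists bad : nat, [/\ (r * bad <= (z + y) ^ 2 * size bs)%N, (bad <= size bs)%N &
   [/\ {subset rows2 <= rows1} -> X <= (size bs)%:R * (1 + th) + bad%:R * M,
       ((size bs)%:R - bad%:R) * (1 - th) <= X
     & ~ {subset rows2 <= rows1} -> ((size bs)%:R - bad%:R) * (lam `^ p - th) <= X]].
Proof.
move=> q0 m0 th0 gs gM gE u1 u2 s1 s2 inW ag X.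
have szb w : w \in rows1 ++ rows2 -> size w = size bs.
  by move=> /inW; rewrite mem_words => /andP[/eqP].
have sub1 : {subset rows1 <= rows1 ++ rows2} by move=> w; rewrite mem_cat => ->.
have sub2 : {subset rows2 <= rows1 ++ rows2} by move=> w; rewrite mem_cat orbC => ->.
pose P i := good_col 0 (rows1 ++ rows2) i.
pose key (rows : seq (seq rat)) i := rev [seq nth 0 w i | w <- rows].
have XE : X = \sum_(i <- iota 0 (size bs)) sdist p (gL (key_set q m (key rows1 i))) (gR
  (key_set q m (key rows2 i))).
  rewrite /X /emb !columnsE; [|by move=> w /sub2 /szb|by move=> w /sub1 /szb].
  rewrite -!map_comp (sdist_flatten p (F := fun i => gL (key_set q m (key rows1 i))) (G := fun
    i => gR (key_set q m (key rows2 i)))) //.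
  by move=> i; rewrite (gs _).1 (gs _).2.
have card_key rows i : uniq rows -> {subset rows <= rows1 ++ rows2} -> i \in iota 0 (size bs)
  -> P i ->
    #|key_set q m (key rows i)| = size rows.
  move=> ur sub; rewrite mem_iota add0n => /andP[_ ib] Pi.
  rewrite card_key_set // ?size_rev ?size_map //.
    rewrite rev_uniq map_inj_in_uniq // => w c /sub wL /sub cL; exact: (good_colP Pi wL cL).
  rewrite all_rev; apply/allP => _ /mapP[w /sub wL ->].
  have := inW w wL; rewrite mem_words => /andP[/eqP sw /allP]; apply.
  by rewrite mem_nth ?sw.
have key_mem rows i w : i \in iota 0 (size bs) -> w \in rows -> w \in rows1 ++ rows2 ->
    exists2 j, j \in key_set q m (key rows i) & nth 0 w i = sym q m j.
  rewrite mem_iota add0n => /andP[_ ib] wr wL; apply: key_set_mem.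
    by rewrite mem_rev; apply: map_f.
  have := inW w wL; rewrite mem_words => /andP[/eqP sw /allP]; apply.
  by rewrite mem_nth ?sw.
have key_sub i : {subset rows2 <= rows1} -> key_set q m (key rows2 i) \subset key_set q m (key
  rows1 i).
  move=> sub; apply/fintype.subsetP => j; rewrite !inE !mem_rev => /mapP[w wr E].
  by apply/mapP; exists w; rewrite ?sub.
have key_nsub i : i \in iota 0 (size bs) -> P i -> ~ {subset rows2 <= rows1} ->
    ~~ (key_set q m (key rows2 i) \subset key_set q m (key rows1 i)).
  move=> ib Pi ns; apply/negP => /fintype.subsetP sub; apply: ns => w w2.
  have [j /sub j1 E] := key_mem rows2 i w ib w2 (sub2 w w2).
  move: j1; rewrite inE mem_rev => /mapP[c c1]; rewrite -E => E'.
  by rewrite (good_colP Pi (sub2 w w2) (sub1 c c1) E').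
exists (count (predC P) (iota 0 (size bs))); split.
- have := @bad_cols _ 0 r _ _ szb ag; rewrite size_cat s1 s2; exact.
- by rewrite -[leqRHS](size_iota 0); apply: count_size.
have nn i := sdist_ge0 p (gL (key_set q m (key rows1 i))) (gR (key_set q m (key rows2 i))).
have G i : i \in iota 0 (size bs) -> P i -> _ := fun ib Pi =>
  gE _ _ (etrans (card_key _ _ u1 sub1 ib Pi) s1) (etrans (card_key _ _ u2 sub2 ib Pi) s2).
rewrite XE -{2 4 7}(size_iota 0 (size bs)); split.
- move=> sub; apply: sum_upper => [|i ib Pi|i] //; first by rewrite addr_ge0.
  by have [h _ _] := G i ib Pi; apply: h; apply: key_sub.
- by apply: sum_lower => // i ib Pi; have [_ h _] := G i ib Pi.
- move=> ns; apply: sum_lower => // i ib Pi.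
  by have [_ _ h] := G i ib Pi; apply: h; apply: key_nsub.
Qed.

Local Close Scope ring_scope.

(** * The correspondence between elements and codewords *)

Lemma unzip2_zip_take (T T' : Type) (s : seq T) (t : seq T') :
  unzip2 (zip s t) = take (size s) t.
Proof. by elim: s t => [|a s IH] [|b t] //=; rewrite IH. Qed.

Lemma uniq_unzip2_inj (T T' : eqType) (l : seq (T * T')) x x' c :
  uniq (unzip2 l) -> (x, c) \in l -> (x', c) \in l -> x = x'.
Proof.
elim: l => //= -[a b] l IH /andP[/= bl ul]; rewrite !inE.
have nb v : (v, b) \in l -> False by move=> /(map_f snd) /= h; rewrite h in bl.
move=> /orP[/eqP[-> e1]|h1] /orP[/eqP[-> e2]|h2] //.
- by case: (nb x'); rewrite -e1.
- by case: (nb x); rewrite -e2.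
- exact: IH.
Qed.

Lemma lookup_mem (l : seq (nat * seq rat)) x c :
  uniq (unzip1 l) -> (x, c) \in l -> lookup x l = c.
Proof.
rewrite /lookup; elim: l => //= -[a b] l IH /= /andP[al ul]; rewrite inE.
case/orP => [/eqP[<- <-]|xl]; first by rewrite eqxx.
case: eqP => [E|_]; last exact: IH.
by rewrite E (map_f fst xl) in al.
Qed.

Lemma uniq_unzip1_codebook r (sg : seq rat) n : 0 < r -> uniq sg -> size sg = 4 ^ r ->
  uniq (unzip1 (codebook r sg n)).
Proof. by move=> r0 us sq; rewrite unzip1_codebook // rev_uniq iota_uniq. Qed.

Lemma unzip2_codebook r (sg : seq rat) n :
  unzip2 (codebook r sg n) = take n (greedy r (words sg (size (bits n)))).
Proof. by rewrite unzip2_zip_take size_rev size_iota. Qed.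

Lemma codeword_codebook r (sg : seq rat) n x : 0 < r -> uniq sg -> size sg = 4 ^ r -> x < n ->
  (x, codeword r sg n x) \in codebook r sg n.
Proof.
move=> r0 us sq xn; have : x \in unzip1 (codebook r sg n).
  by rewrite unzip1_codebook // mem_rev mem_iota.
move=> /mapP[[x' c] /= xl E]; rewrite -E in xl.
by rewrite /codeword (lookup_mem _ xl) // uniq_unzip1_codebook.
Qed.

Lemma codeword_inj r (sg : seq rat) n : 0 < r -> uniq sg -> size sg = 4 ^ r ->
  {in gtn n &, injective (codeword r sg n)}.
Proof.
move=> r0 us sq x x' xn xn' E; apply: (@uniq_unzip2_inj _ _ (codebook r sg n) _ _ (codeword r
  sg n x)).
- by rewrite unzip2_codebook take_uniq // uniq_greedy.
- exact: codeword_codebook.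
- by rewrite E; apply: codeword_codebook.
Qed.

Lemma codeword_surj r (sg : seq rat) n c : 0 < r -> uniq sg -> size sg = 4 ^ r ->
  c \in unzip2 (codebook r sg n) -> exists2 x, x < n & c = codeword r sg n x.
Proof.
move=> r0 us sq /mapP[[x c'] /= xl ->]; exists x.
  by move: (map_f fst xl); rewrite -/(unzip1 _) unzip1_codebook // mem_rev mem_iota.
by rewrite /codeword (lookup_mem _ xl) // uniq_unzip1_codebook.
Qed.

Lemma size_tuples (C : seq (seq rat)) y : size (tuples C y) <= size C ^ y.
Proof.
elim: y => //= y IH; rewrite size_flatten /shape -map_comp sumnE big_map expnS -sum_const_seq.
apply: leq_sum => c _ /=; rewrite size_map; apply: leq_trans IH.
by rewrite size_filter count_size.
Qed.

Lemma uniq_tuples (C : seq (seq rat)) y : uniq C -> uniq (tuples C y).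
Proof.
move=> uC; elim: y => //= y IH.
have : forall C', uniq C' -> uniq (flatten [seq [seq c :: t | t <- tuples C y & c \notin t] | c
  <- C']).
  elim=> //= c C' IHC /andP[cC uC']; rewrite cat_uniq IHC // andbT.
  rewrite map_inj_uniq ?filter_uniq //=; last by move=> t t' [].
  apply/hasPn => t /flattenP[s /mapP[c' c'C ->]] /mapP[t' _ ->].
  apply/mapP => -[t'' _ [E _]]; by rewrite -E c'C in cC.
exact.
Qed.

Lemma size_emb tab bs rows d : (forall k, size (tab k) = d) ->
  (forall w, w \in rows -> size w = size bs) -> size (emb tab bs rows) = size bs * d.
Proof.
move=> td sz; rewrite /emb size_flatten /shape columnsE // -!map_comp sumnE big_map.
by under eq_bigr do rewrite /= td; rewrite sum_const_seq size_iota.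
Qed.

Lemma size_flatten_const (T : eqType) (rows : seq (seq T)) b :
  (forall w, w \in rows -> size w = b) -> size (flatten rows) = size rows * b.
Proof.
elim: rows => //= w rows IH sz; rewrite size_cat IH ?sz ?mem_head //.
by move=> v vr; apply: sz; rewrite inE vr orbT.
Qed.

Lemma flatten_inj (T : eqType) b (s t : seq (seq T)) : size s = size t ->
  (forall w, w \in s -> size w = b) -> (forall w, w \in t -> size w = b) ->
  flatten s = flatten t -> s = t.
Proof.
elim: s t => [|v s IH] [|w t] //= [st] hs ht /eqP.
rewrite eqseq_cat; last exact: etrans (hs v (mem_head _ _)) (esym (ht w (mem_head _ _))).
move=> /andP[/eqP -> /eqP E]; congr cons.
apply: IH => //.
- by move=> u us; apply: hs; rewrite inE us orbT.
- by move=> u us; apply: ht; rewrite inE us orbT.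
Qed.

Local Open Scope ring_scope.

(** * Lists of rationals as vectors *)

Definition vec d (s : seq rat) : 'rV[rat]_d := \row_(i < d) nth 0 s i.

Lemma enc_vecE d s : size s = d -> enc_vec (vec d s) = enc_seq enc_rat s.
Proof.
move=> sd; rewrite /enc_vec.
rewrite -[LHS]/(enc_seq (enc_rat \o (fun i => vec d s 0 i)) _) -enc_seq_map; congr enc_seq.
apply: (@eq_from_nth _ 0); first by rewrite size_map size_enum_ord.
move=> i; rewrite size_map size_enum_ord => id.
by rewrite (nth_map (Ordinal id)) ?size_enum_ord // mxE nth_enum_ord.
Qed.

Lemma vec_inj d (s t : seq rat) : size s = d -> size t = d -> vec d s = vec d t -> s = t.
Proof.
move=> sd td E; apply: (@eq_from_nth _ 0); first by rewrite sd.
move=> i; rewrite sd => id; have := congr1 (fun v : 'rV_d => v 0 (Ordinal id)) E.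
by rewrite !mxE.
Qed.

Lemma powR_sqr (R : realType) (a p : R) : (a `^ p^-1) ^+ 2 = a `^ (2 / p).
Proof. by rewrite -powR_mulrn ?powR_ge0 // -powRrM mulrC. Qed.

Lemma lp_norm_vec (R : realType) (p : R) d (s t : seq rat) :
  0 < p -> size s = d -> size t = d ->
  lp_norm p (map_mx ratr (vec d s) - map_mx ratr (vec d t)) ^+ 2 = sdist p s t `^ (2 / p).
Proof.
move=> p0 sd td; rewrite /lp_norm powR_sqr; congr (_ `^ _); rewrite /sdist (big_nth (0, 0))
  size_zip sd td minnn big_mkord.
by apply: eq_bigr => i _; rewrite !mxE nth_zip ?sd ?td.
Qed.

(** Bounds the cost of the tags: coordinates differ by at most [c], and c^p is at most c since p is
    at least 1 and c at most 1. *)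
Lemma sdist_small (R : realType) (p c : R) (s t : seq rat) : 1 <= p -> 0 <= c -> c <= 1 ->
  size s = size t -> (forall x, x \in s -> 0 <= (ratr x : R) <= c) -> (forall x, x \in t -> 0
    <= (ratr x : R) <= c) ->
  sdist p s t <= (size s)%:R * c.
Proof.
move=> p1 c0 c1; rewrite /sdist; elim: s t => [|x s IH] [|y t] //=; first by rewrite big_nil
  mul0r.
move=> [st] hs ht; rewrite big_cons /= -addn1 natrD mulrDl mul1r addrC; apply: lerD.
  apply: IH => // u us; [apply: hs|apply: ht]; by rewrite inE us orbT.
have /andP[x0 xc] := hs x (mem_head _ _); have /andP[y0 yc] := ht y (mem_head _ _).
apply: (@le_trans _ _ (c `^ p)).
  apply: ler_powRl; rewrite ?normr_ge0 //; first by move: p1; clear; lra.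
  by rewrite ler_norml; apply/andP; split; move: x0 xc y0 yc; clear; lra.
have [->|cn] := eqVneq c 0; first by rewrite powR0 // gt_eqF //; move: p1; clear; lra.
by apply: ge1r_powR => //; rewrite lt_neqAle eq_sym cn c0.
Qed.

Definition point tab (bs : seq bool) (rows : seq (seq rat)) (w : seq rat) : seq rat :=
  (emb tab bs rows ++ flatten rows) ++ w.

Definition center tab m (bs : seq bool) (rows : seq (seq rat)) : seq rat :=
  (emb tab bs rows ++ flatten rows) ++ flatten (nseq m (map (fun=> 0) bs)).

Lemma size_point tab bs rows w d : (forall k, size (tab k) = d) ->
  (forall v, v \in rows -> size v = size bs) -> size w = size bs ->
  size (point tab bs rows w) = (size bs * (d + (size rows).+1))%N.
Proof.
move=> td sz sw; rewrite /point !size_cat (size_emb td sz) (size_flatten_const sz) sw.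
by rewrite mulnDr mulnSr [(size rows * _)%N]mulnC addnA.
Qed.

Lemma size_center tab m bs rows d : (forall k, size (tab k) = d) ->
  (forall v, v \in rows -> size v = size bs) ->
  size (center tab m bs rows) = (size bs * (d + (size rows + m)))%N.
Proof.
move=> td sz; rewrite /center !size_cat (size_emb td sz) (size_flatten_const sz).
have -> : size (flatten (nseq m (map (fun=> 0 : rat) bs))) = (m * size bs)%N.
  rewrite (@size_flatten_const _ _ (size bs)) ?size_nseq // => v /nseqP[-> _].
  by rewrite size_map.
by rewrite !mulnDr !(mulnC (size bs)) addnA.
Qed.

Lemma alphabet_small (R : realType) q m x : (0 < m)%N -> x \in alphabet q m ->
  0 <= (ratr x : R) <= m%:R^-1.
Proof.
move=> m0 /mapP[j]; rewrite mem_iota add0n => /andP[_ jq] ->.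
have q0 : (0 < q)%N by apply: leq_ltn_trans jq.
have -> : m%:R^-1 = ratr m%:R^-1 :> R by rewrite fmorphV /= ratr_nat.
rewrite ler0q ler_rat /sym natrM invfM mulrA; apply/andP; split.
  by rewrite !mulr_ge0 ?invr_ge0 ?ler0n.
by rewrite ler_piMl ?invr_ge0 ?ler0n // ler_pdivrMr ?ltr0n // mul1r ler_nat ltnW.
Qed.

(** The slack [th] is spent in quarters. From above, the gadget, the collisions and the tags each
    add at most b th / 4. From below, the tags are dropped, and the gadget and the collisions each
    cost a factor 1 - th / 4, whose square is at least 1 - th; for a non-edge this uses that lam^p
    is at least 1. *)
Lemma point_center_dist (R : realType) (p th M lam : R) r z y m d n
    (gL gR : {set 'I_(4 ^ r)} -> seq rat) (xs : seq nat) (t : seq (seq rat)) (w : seq rat) :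
  let sg := alphabet (4 ^ r) m in let bs := bits n in
  let cw := codeword r sg n in
  let X := sdist p (point (gL \o key_set (4 ^ r) m) bs (map cw xs) w)
                   (center (gR \o key_set (4 ^ r) m) (z - y).+1 bs t) in
  1 <= p -> (0 < r)%N -> (0 < m)%N -> (1 <= y)%N -> (y < z)%N -> 0 <= M -> 1 <= lam ->
  0 < th -> th <= 1 ->
  4 * (M + 1) * ((z + y) ^ 2)%:R <= th * r%:R -> 4 * z.+1%:R <= th * m%:R ->
  (forall S, size (gL S) = d /\ size (gR S) = d) ->
  (forall S S', sdist p (gL S) (gR S') <= M) ->
  (forall S S' : {set 'I_(4 ^ r)}, #|S| = z -> #|S'| = y ->
      [/\ S' \subset S -> sdist p (gL S) (gR S') <= 1 + th / 4,
          1 - th / 4 <= sdist p (gL S) (gR S')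
        & ~~ (S' \subset S) -> lam `^ p - th / 4 <= sdist p (gL S) (gR S')]) ->
  uniq xs -> size xs = z -> (forall x, x \in xs -> (x < n)%N) ->
  t \in tuples (unzip2 (codebook r sg n)) y -> w \in words sg (size bs) ->
  [/\ {subset t <= map cw xs} -> X <= (size bs)%:R * (1 + th),
     (size bs)%:R * (1 - th) <= X
   & ~ {subset t <= map cw xs} -> (size bs)%:R * (1 - th) * lam `^ p <= X].
Proof.
move=> sg bs cw X p1 r0 m0 y1 yz M0 lam1 th0 th1 hr hm gs gM gE ux sx xn.
rewrite mem_tuples => /and3P[/eqP st ut /allP tU] wW.
have q0 : (0 < 4 ^ r)%N by rewrite expn_gt0.
have us : uniq sg by apply: uniq_alphabet.
have sq : size sg = (4 ^ r)%N by apply: size_alphabet.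
have lp1 : 1 <= lam `^ p.
  have e1 : 1 `^ p = 1 :> R by rewrite powR1.
  by rewrite -[leLHS]e1; apply: ler_powRl => //; move: p1; clear; lra.
have U1 v : v \in map cw xs -> v \in unzip2 (codebook r sg n).
  by move=> /mapP[x /xn xin ->]; apply: codeword_mem.
have inG v : v \in map cw xs ++ t -> v \in greedy r (words sg (size bs)).
  by rewrite mem_cat => /orP[/U1|/tU] /mem_unzip2_codebook.
have inW v : v \in map cw xs ++ t -> v \in words sg (size bs) by move=> /inG /greedy_subW.
have szW v : v \in words sg (size bs) -> size v = size bs.
  by rewrite mem_words => /andP[/eqP].
have szb v : v \in map cw xs ++ t -> size v = size bs by move=> /inW /szW.
have sz1 v : v \in map cw xs -> size v = size bs by move=> h; apply: szb; rewrite mem_cat h.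
have sz2 v : v \in t -> size v = size bs by move=> h; apply: szb; rewrite mem_cat h orbT.
have u1 : uniq (map cw xs).
  rewrite map_inj_in_uniq // => x x' /xn xin /xn xin'.
  exact: (codeword_inj r0 us sq).
have s1 : size (map cw xs) = z by rewrite size_map.
have tdL k : size ((gL \o key_set (4 ^ r) m) k) = d by rewrite /= (gs _).1.
have tdR k : size ((gR \o key_set (4 ^ r) m) k) = d by rewrite /= (gs _).2.
have th40 : 0 <= th / 4 by move: th0; clear; lra.
have [bad [b1 b2 []]] := emb_dist (r := r) q0 m0 th40 gs gM gE u1 ut s1 st inW
   (fun v c vL cL ne => greedy_agree szW (inG v vL) (inG c cL) ne).
set b := size bs in b1 b2 *.
set Y := sdist p _ _.
pose rest1 := flatten (map cw xs) ++ w.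
pose rest2 := flatten t ++ flatten (nseq (z - y).+1 (map (fun=> 0 : rat) bs)).
have XE : X = Y + sdist p rest1 rest2.
  rewrite /X /point /center -!catA sdist_cat //.
  by rewrite (size_emb tdL sz1) (size_emb tdR sz2).
have szr1 : size rest1 = (z.+1 * b)%N.
  by rewrite size_cat (size_flatten_const sz1) s1 (szW _ wW) mulSn addnC.
have szr2 : size rest2 = (z.+1 * b)%N.
  rewrite size_cat (size_flatten_const sz2) st.
  rewrite (@size_flatten_const _ _ b) ?size_nseq //; last first.
    by move=> v /nseqP[-> _]; rewrite size_map.
  by rewrite -mulnDl addnS subnKC // ltnW.
have sm1 x : x \in rest1 -> 0 <= (ratr x : R) <= m%:R^-1.
  rewrite mem_cat => h; apply: (@alphabet_small R (4 ^ r)) => //.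
  case/orP: h => [/flattenP[v /mapP[x' x'xs ->]]|].
    have := inW (cw x'); rewrite mem_cat map_f // => /(_ isT).
    by rewrite mem_words => /andP[_ /allP]; apply.
  by move: wW; rewrite mem_words => /andP[_ /allP]; apply.
have sm2 x : x \in rest2 -> 0 <= (ratr x : R) <= m%:R^-1.
  rewrite mem_cat => /orP[/flattenP[v vt]|].
    move=> xv; apply: (@alphabet_small R (4 ^ r)) => //.
    have := inW v; rewrite mem_cat vt orbT => /(_ isT).
    by rewrite mem_words => /andP[_ /allP]; apply.
  move=> /flattenP[v /nseqP[-> _] /mapP[? _ ->]].
  by rewrite rmorph0 lexx invr_ge0 ler0n.
have rest_le : sdist p rest1 rest2 <= b%:R * (th / 4).
  apply: (@le_trans _ _ ((size rest1)%:R * m%:R^-1)).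
    apply: sdist_small => //; rewrite ?invr_ge0 ?ler0n ?szr1 //.
    by rewrite invf_le1 ?ltr0n // ler1n.
  rewrite szr1 natrM mulrAC mulrC ler_wpM2l ?ler0n // ler_pdivrMr ?ltr0n //.
  by move: hm; clear; lra.
have rest_ge := sdist_ge0 p rest1 rest2.
have zy : 0 < ((z + y) ^ 2)%:R :> R by rewrite ltr0n expn_gt0 addn_gt0 y1 orbT.
(* The factor [M + 1] serves two bounds by b th / 4: on [bad * M] for the upper estimate and on
   [bad] for the lower ones. *)
have badle : 4 * (M + 1) * bad%:R <= th * b%:R.
  rewrite -(ler_pM2l zy).
  have h : (r%:R * bad%:R : R) <= ((z + y) ^ 2)%:R * b%:R by rewrite -!natrM ler_nat.
  have bp : 0 <= bad%:R :> R by rewrite ler0n.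
  have h1 := ler_wpM2r bp hr.
  have h2 := ler_wpM2l (ltW th0) h.
  move: h1 h2; set A := ((z + y) ^ 2)%:R; clear.
  set B := bad%:R; set C := r%:R; set D := b%:R => h1 h2.
  apply: (@le_trans _ _ (4 * (M + 1) * A * B)); first by rewrite le_eqVlt; apply/orP; left;
    apply/eqP; ring.
  apply: le_trans h1 _; rewrite (_ : th * C * B = th * (C * B)); last by ring.
  by apply: le_trans h2 _; rewrite le_eqVlt; apply/orP; left; apply/eqP; ring.
have bad0 : 0 <= bad%:R :> R by rewrite ler0n.
have badb : bad%:R <= b%:R :> R by rewrite ler_nat.
have bM : bad%:R * M <= b%:R * (th / 4) /\ bad%:R <= b%:R * (th / 4).
  by move: badle M0 bad0; clear; set B := bad%:R; set C := b%:R; nra.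
have b0 : 0 <= b%:R :> R by rewrite ler0n.
rewrite XE; move: rest_le rest_ge bM bad0 badb b0 th0 th1 lp1; clear.
set B := bad%:R; set C := b%:R; set S := sdist p rest1 rest2; set L := lam `^ p.
move=> rl rg [bM1 bM2] B0 BC C0 t0 t1 L1 h1 h2 h3; split.
- by move=> /h1; move: rl bM1 C0 t0; clear; nra.
- by apply: le_trans (_ : Y <= _); [apply: le_trans h2; move: bM2 B0 C0 t0; clear; nra|lra].
- move=> /h3 h; apply: (@le_trans _ _ Y); last by lra.
  apply: le_trans h.
  have a1 : C * (1 - th / 4) <= C - B by move: bM2; clear; lra.
  have a2 : L * (1 - th / 4) <= L - th / 4 by move: L1 t0; clear; nra.
  apply: (@le_trans _ _ (C * (1 - th / 4) * (L * (1 - th / 4)))).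
    have CL : 0 <= C * L by apply: mulr_ge0 => //; move: L1; clear; lra.
    rewrite (_ : C * (1 - th / 4) * (L * (1 - th / 4)) = C * L * (1 - th / 4) ^+ 2); last by ring.
    by rewrite mulrAC ler_wpM2l //; move: t0; clear; nra.
  apply: ler_pM => //; move: C0 t0 t1 L1; clear => *; [nra|nra].
Qed.

Local Close Scope ring_scope.

(** * The reduced instance *)

Definition raw_set n (T : {set 'I_n}) : seq nat := [seq val i | i <- enum T].

Definition reduction r m z y d tabL tabR (I : jc_instance) : km_instance :=
  let n := jc_n I in let sg := alphabet (4 ^ r) m in
  let dim := size (bits n) * (d + z.+1) in
  @KMInstance dim
    (map (vec dim) (km_points r sg tabL n (map (@raw_set n) (jc_E I))))
    (map (vec dim) (km_centers r sg tabR y (z - y).+1 n))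
    (jc_k I).

Lemma eq_in_enc_seq (T : eqType) (e e' : T -> tree) s :
  {in s, e =1 e'} -> enc_seq e s = enc_seq e' s.
Proof.
elim: s => //= x s IH h; rewrite h ?mem_head // IH // => w ws.
by apply: h; rewrite inE ws orbT.
Qed.

Lemma size_raw_set n (T : {set 'I_n}) : size (raw_set T) = #|T|.
Proof. by rewrite size_map -cardE. Qed.

Lemma raw_set_lt n (T : {set 'I_n}) x : x \in raw_set T -> x < n.
Proof. by move=> /mapP[i _ ->]; apply: ltn_ord. Qed.

Lemma mem_raw_set n (T : {set 'I_n}) (i : 'I_n) : (val i \in raw_set T) = (i \in T).
Proof. by rewrite /raw_set (mem_map val_inj) mem_enum. Qed.

Lemma uniq_raw_set n (T : {set 'I_n}) : uniq (raw_set T).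
Proof. by rewrite map_inj_uniq ?enum_uniq //; apply: val_inj. Qed.

Lemma raw_set_inj n : injective (@raw_set n).
Proof.
move=> T T' E; apply/finset.setP => i; by rewrite -!mem_raw_set E.
Qed.

Definition good_params r m d (tabL tabR : seq rat -> seq rat) : Prop :=
  [/\ 0 < r, 0 < m, forall k, size (tabL k) = d & forall k, size (tabR k) = d].

Lemma good_alphabet r m d tabL tabR : good_params r m d tabL tabR ->
  uniq (alphabet (4 ^ r) m) /\ size (alphabet (4 ^ r) m) = 4 ^ r.
Proof.
by move=> [r0 m0 _ _]; rewrite size_alphabet uniq_alphabet // expn_gt0.
Qed.

Lemma km_pointsP r sg tab n (E : seq (seq nat)) s : s \in km_points r sg tab n E ->
  exists T w, [/\ T \in E, w \in words sg (size (bits n)) &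
    s = point tab (bits n) (map (codeword r sg n) T) w].
Proof.
by move=> /allpairsP[[T' w] /= [/mapP[T TE ->] wW ->]]; exists T, w.
Qed.

Lemma km_centersP r sg tab y m n s : s \in km_centers r sg tab y m n ->
  exists2 t, t \in tuples (unzip2 (codebook r sg n)) y & s = center tab m (bits n) t.
Proof. by move=> /mapP[t tt ->]; exists t. Qed.

Lemma size_codeword r m d tabL tabR n x : good_params r m d tabL tabR -> x < n ->
  size (codeword r (alphabet (4 ^ r) m) n x) = size (bits n).
Proof.
move=> gp xn; have [us sq] := good_alphabet gp; have [r0 _ _ _] := gp.
by have := codeword_word r0 us sq xn; rewrite mem_words => /andP[/eqP].
Qed.

Lemma size_tuple_row r m d tabL tabR n y t v : good_params r m d tabL tabR ->
  t \in tuples (unzip2 (codebook r (alphabet (4 ^ r) m) n)) y -> v \in t -> size v = size (bits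
    n).
Proof.
move=> gp; rewrite mem_tuples => /and3P[_ _ /allP tU] /tU.
have [us sq] := good_alphabet gp; have [r0 _ _ _] := gp.
by move=> /(codeword_surj r0 us sq)[x xn ->]; apply: size_codeword gp xn.
Qed.

Lemma size_km_points r m z y d tabL tabR I s : good_params r m d tabL tabR -> jc_valid z I ->
  s \in km_points r (alphabet (4 ^ r) m) tabL (jc_n I) (map (@raw_set _) (jc_E I)) ->
  size s = km_d (reduction r m z y d tabL tabR I).
Proof.
move=> gp [_ _ cE] /km_pointsP[_ [w [/mapP[T TE ->] wW ->]]]; have [_ _ sL _] := gp.
rewrite (size_point (d := d)) // ?size_map -?cardE ?cE //.
- by move=> v /mapP[x /raw_set_lt xn ->]; apply: size_codeword gp xn.
- by move: wW; rewrite mem_words => /andP[/eqP].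
Qed.

Lemma size_km_centers r m z y d tabL tabR I s : good_params r m d tabL tabR -> y < z ->
  s \in km_centers r (alphabet (4 ^ r) m) tabR y (z - y).+1 (jc_n I) ->
  size s = km_d (reduction r m z y d tabL tabR I).
Proof.
move=> gp yz /km_centersP[t tt ->]; have [_ _ _ sR] := gp.
rewrite (size_center _ (d := d)) //; last by move=> v; apply: size_tuple_row gp tt.
by move: tt; rewrite mem_tuples => /and3P[/eqP -> _ _]; rewrite addnS subnKC // ltnW.
Qed.

Lemma ptime_reduction r m z y d tabL tabR : good_params r m d tabL tabR -> y < z ->
  ptime (jc_valid z) enc_jc (fun I => enc_km (reduction r m z y d tabL tabR I)).
Proof.
move=> gp yz; have [r0 m0 _ _] := gp; have [us sq] := good_alphabet gp.
have Hn : ptime (jc_valid z) enc_jc (fun I => enc_unary (jc_n I)) by rewrite /enc_jc; proj.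
have HE : ptime (jc_valid z) enc_jc (fun I => enc_seq (enc_seq enc_nat) (map (@raw_set _) (jc_E
  I))).
  apply: (@ptime_eq _ _ _ (fun I => enc_seq (fun T : {set 'I_(jc_n I)} =>
             enc_seq (fun i : 'I_(jc_n I) => enc_nat i) (enum T)) (jc_E I))); first by rewrite
               /enc_jc; proj.
  by move=> I _; rewrite enc_seq_map; apply: eq_in_enc_seq => T _; rewrite /= enc_seq_map.
apply: (@ptime_eq _ _ _ (fun I => Node (enc_words (km_points r (alphabet (4 ^ r) m) tabL (jc_n
  I) (map (@raw_set _) (jc_E I))))
    (Node (enc_words (km_centers r (alphabet (4 ^ r) m) tabR y (z - y).+1 (jc_n I))) (enc_nat
      (jc_k I))))).
  apply: ptime_pair; last apply: ptime_pair.
  - apply: (@ptime_points _ _ _ _ _ _ z) => //.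
    move=> I T [_ _ cE] /mapP[T' TE ->]; rewrite size_raw_set cE //; split => // x; exact:
      raw_set_lt.
  - exact: ptime_centers.
  - by rewrite /enc_jc; proj.
move=> I vI; rewrite /enc_km /enc_words /=; congr (Node _ (Node _ _)); rewrite
  [RHS]enc_seq_map; apply: eq_in_enc_seq => s /= sP.
  by rewrite enc_vecE //; apply: (size_km_points y gp vI sP).
by rewrite enc_vecE //; apply: (size_km_centers gp yz sP).
Qed.

(** Limits the contribution of |E| to ln N: at most z b bits, next to the 2 r b bits of the
    copies. *)
Lemma card_sets_bound n z (E : seq {set 'I_n}) : uniq E -> (forall T, T \in E -> #|T| = z) ->
  size E <= 2 ^ (size (bits n) * z).
Proof.
have ffle k : n ^_ k <= n ^ k.
  elim: k n {E} => [|k IH] m; first by rewrite ffactn0.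
  rewrite ffactnS expnS leq_mul //; apply: leq_trans (IH _) _; exact: leq_expl (leq_pred m).
move=> uE cE; rewrite expnM; apply: (@leq_trans (n ^ z)); last exact: leq_expl (ltnW (bits_lt n)).
apply: (@leq_trans 'C(n, z)).
  rewrite -[n in 'C(n, z)]card_ord -card_draws -(card_uniqP uE).
  by apply: subset_leq_card; apply/fintype.subsetP => T /cE; rewrite inE => ->.
apply: (@leq_trans ('C(n, z) * z`!)); first by rewrite leq_pmulr ?fact_gt0.
by rewrite bin_ffact.
Qed.

Lemma size_reduction_points r m z y d tabL tabR I :
  size (km_P (reduction r m z y d tabL tabR I)) = size (jc_E I) * (4 ^ r) ^ size (bits (jc_n I)).
Proof. by rewrite /= size_map size_allpairs !size_map size_words size_alphabet. Qed.

(** The tags alone separate the points: the flattened codewords determine the set, and the last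
    block determines the copy. *)
Lemma uniq_reduction_points r m z y d tabL tabR I : good_params r m d tabL tabR -> jc_valid z I ->
  uniq (km_P (reduction r m z y d tabL tabR I)).
Proof.
move=> gp vI; have [uE _ cE] := vI; have [us sq] := good_alphabet gp; have [r0 _ sL _] := gp.
rewrite map_inj_in_uniq; last first.
  move=> s t sP tP; apply: vec_inj; [exact: size_km_points gp vI sP|exact: size_km_points gp vI
    tP].
pose cw := codeword r (alphabet (4 ^ r) m) (jc_n I).
have szr (T : {set 'I_(jc_n I)}) v : v \in map cw (raw_set T) -> size v = size (bits (jc_n I)).
  by move=> /mapP[x /raw_set_lt xn ->]; apply: size_codeword gp xn.
apply: allpairs_uniq.
- rewrite map_inj_in_uniq ?map_inj_uniq //; first exact: raw_set_inj.
  move=> _ _ /mapP[T TE ->] /mapP[T' TE' ->] E; congr raw_set; apply/finset.setP => i.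
  have H (U V : {set 'I_(jc_n I)}) : map cw (raw_set U) = map cw (raw_set V) -> i \in U -> i
    \in V.
    move=> E' iU; have : cw (val i) \in map cw (raw_set V).
      by rewrite -E' map_f // mem_raw_set.
    move=> /mapP[x xV /(codeword_inj r0 us sq) e]; rewrite -mem_raw_set e //.
      exact: ltn_ord.
    exact: raw_set_lt xV.
  by apply/idP/idP; apply: H.
- exact: uniq_words.
move=> [T1 w1] [T2 w2] /allpairsP[[A1 v1] /= [/mapP[_ /mapP[B1 BE1 ->] ->] vW1 [-> ->]]]
   /allpairsP[[A2 v2] /= [/mapP[_ /mapP[B2 BE2 ->] ->] vW2 [-> ->]]] /eqP.
rewrite -/cw eqseq_cat; last first.
  rewrite !size_cat !(size_emb sL (szr _)) !(size_flatten_const (szr _)) !size_map.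
  by rewrite -!cardE !cE.
rewrite eqseq_cat ?(size_emb sL (szr _)) // => /andP[/andP[_ /eqP E] /eqP ->]; congr (_, _).
by apply: flatten_inj E; [rewrite !size_map -!cardE !cE|exact: szr|exact: szr].
Qed.

Lemma uniq_reduction_centers r m z y d tabL tabR I : good_params r m d tabL tabR -> y < z ->
  uniq (km_C (reduction r m z y d tabL tabR I)).
Proof.
move=> gp yz; have [us sq] := good_alphabet gp; have [r0 _ _ sR] := gp.
rewrite map_inj_in_uniq; last first.
  move=> s t sP tP; apply: vec_inj; [exact: size_km_centers gp yz sP|exact: size_km_centers gp
    yz tP].
rewrite map_inj_in_uniq; last first.
  move=> s t ss tt /eqP.
  have szs v : v \in s -> size v = size (bits (jc_n I)) by apply: size_tuple_row gp ss.
  have szt v : v \in t -> size v = size (bits (jc_n I)) by apply: size_tuple_row gp tt.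
  have st : size s = size t.
    by move: ss tt; rewrite !mem_tuples => /and3P[/eqP -> _ _] /and3P[/eqP -> _ _].
  have se : size (flatten s) = size (flatten t).
    by rewrite (size_flatten_const szs) (size_flatten_const szt) st.
  rewrite eqseq_cat; last by rewrite !size_cat (size_emb sR szs) (size_emb sR szt) se.
  move=> /andP[/eqP/eqP + _]; rewrite eqseq_cat; last by rewrite (size_emb sR szs) (size_emb sR
    szt).
  by move=> /andP[_ /eqP]; apply: (flatten_inj st szs szt).
by apply: uniq_tuples; rewrite unzip2_codebook take_uniq // uniq_greedy.
Qed.

Lemma size_reduction_centers r m z y d tabL tabR I : good_params r m d tabL tabR ->
  size (km_C (reduction r m z y d tabL tabR I)) <= 2 ^ (size (bits (jc_n I)) * y).
Proof.
move=> gp; have [us sq] := good_alphabet gp; have [r0 _ _ _] := gp.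
rewrite /= !size_map; apply: leq_trans (size_tuples _ _) _; rewrite expnM; apply: leq_expl.
by rewrite unzip2_codebook size_take_min; apply: leq_trans (geq_minl _ _) (ltnW (bits_lt _)).
Qed.

Local Open Scope ring_scope.

Lemma ln_pow2 (R : realType) k : ln ((2 ^ k)%N%:R : R) = k%:R * ln 2.
Proof. by rewrite natrX lnXn ?ltr0n // mulr_natl. Qed.

Lemma ln2_bound (R : realType) : 0 < ln (2 : R).
Proof. by rewrite ln_gt0 // ltr1n. Qed.

Lemma ln_points (R : realType) r m z y d tabL tabR I : jc_valid z I ->
  let N := size (km_P (reduction r m z y d tabL tabR I)) in
  let b := size (bits (jc_n I)) in
  [/\ (0 < N)%N, (2 ^ (2 * r * b) <= N)%N, (2 * r * b)%:R * ln 2 <= ln (N%:R : R)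
    & ln (N%:R : R) <= ((2 * r + z) * b)%:R * ln 2].
Proof.
move=> [uE nE cE] N b.
have E0 : (0 < size (jc_E I))%N by case: (jc_E I) nE.
have q2 : ((4 ^ r) ^ b = 2 ^ (2 * r * b))%N by rewrite (_ : 4 = 2 ^ 2)%N // -!expnM mulnA.
have NE : N = (size (jc_E I) * 2 ^ (2 * r * b))%N by rewrite /N size_reduction_points q2.
have lo : (2 ^ (2 * r * b) <= N)%N by rewrite NE leq_pmull.
have N0 : (0 < N)%N by apply: leq_trans lo; rewrite expn_gt0.
have hi : (N <= 2 ^ ((2 * r + z) * b))%N.
  rewrite NE mulnDl addnC expnD leq_mul // [(z * b)%N]mulnC.
  exact: card_sets_bound.
split=> //; rewrite -ln_pow2 ler_ln ?posrE ?ltr0n ?expn_gt0 //; by rewrite ler_nat.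
Qed.

Lemma universe_pos z I : (0 < z)%N -> jc_valid z I -> (0 < size (bits (jc_n I)))%N.
Proof.
move=> z0 [_ nE cE]; case E : (jc_E I) nE => [|T s] // _.
have := cE T; rewrite E mem_head => /(_ isT) cT.
have n0 : (0 < jc_n I)%N.
  apply: leq_trans z0 _; rewrite -cT; apply: leq_trans (max_card _) _.
  by rewrite card_ord.
have := bits_lt (jc_n I); case: (size _) => //; rewrite expn0; lia.
Qed.

(** There are at most 2^(y b) centers. As y is at most r, this is at most N, so the exponent 1
    suffices. The dimension is b (d + z + 1), and ln N is at least b ln 2. *)
Lemma km_valid_reduction (R : realType) r m z y d tabL tabR D I :
  good_params r m d tabL tabR -> (0 < y)%N -> (y < z)%N -> (y <= r)%N ->
  (d + z.+1)%:R <= D%:R * ln (2 : R) -> jc_valid z I ->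
  km_valid R D 1 (reduction r m z y d tabL tabR I).
Proof.
move=> gp y0 yz yr hD vI; have [r0 _ _ _] := gp.
have [N0 lo lnlo _] := @ln_points R r m z y d tabL tabR I vI.
have b0 := universe_pos (ltn_trans y0 yz) vI.
have rb : (size (bits (jc_n I)) * 1 <= 2 * r * size (bits (jc_n I)))%N by rewrite mulnC leq_mul
  //; lia.
split.
- exact: uniq_reduction_points.
- exact: uniq_reduction_centers.
- apply: leq_trans lo; rewrite -{1}[2%N]expn1 leq_exp2l //; lia.
- apply: le_trans (ler_wpM2l (ler0n R D) lnlo); rewrite /= natrM mulrCA.
  rewrite ler_pM ?ler0n //.
  by rewrite ler_nat; rewrite muln1 in rb.
- apply: leq_trans (size_reduction_centers _ _ _ gp) _.
  rewrite /polyb expn1; apply: leq_trans (leq_addr _ _); apply: leq_trans lo.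
  by rewrite leq_exp2l // mulnC leq_mul //; lia.
Qed.

(* As [p >= 1], the slack enters with an exponent [2 / p <= 2]; at this value of
   [th] it costs less than the gap between [eps / 4] and [eps]. *)
Lemma slack (R : realType) (p eps zeta th : R) : 1 <= p -> 0 < eps ->
  th = eps / (64 * (`|zeta| + 1 + eps)) -> 0 < zeta - eps ->
  (zeta - eps) * ((1 + th) ^+ 2) `^ (2 / p) <= (zeta - eps / 4) * (1 - th) `^ (2 / p).
Proof.
move=> p1 e0 thE ze.
have a0 := normr_ge0 zeta.
have zE : `|zeta| = zeta by rewrite gtr0_norm //; move: ze e0; clear; lra.
rewrite zE in thE a0.
have den : 0 < 64 * (zeta + 1 + eps) by move: a0 e0; clear; lra.
have th0 : 0 < th by rewrite thE divr_gt0.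
have thd : th * (64 * (zeta + 1 + eps)) = eps by rewrite thE divfK // gt_eqF.
have th64 : th <= 1 / 64.
  by rewrite thE ler_pdivrMr //; move: a0 e0; clear; lra.
(* Factoring out the power of 1 - th leaves X^(2/p). As X is at least 1 and 2/p at most 2, this is
   at most X^2, hence at most 1 + 48 th; and 48 th (zeta - eps) is at most 3 eps / 4 by the choice
   of [th]. *)
pose X := (1 + th) ^+ 2 / (1 - th).
have t1 : 0 < 1 - th by move: th64; clear; lra.
have X1 : 1 <= X by rewrite ler_pdivlMr //; move: th0; clear; nra.
have XE : (1 + th) ^+ 2 = X * (1 - th) by rewrite /X divfK // gt_eqF.
have Xle : X <= 1 + 8 * th.
  by rewrite ler_pdivrMr //; move: th0 th64; clear; nra.
have X0 : 0 <= X by apply: le_trans X1; exact: ler01.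
rewrite XE powRM ?(ltW t1) // mulrA; apply: ler_wpM2r; first exact: powR_ge0.
have p2 : 2 / p <= 2 by rewrite ler_pdivrMr; move: p1; clear; lra.
apply: (@le_trans _ _ ((zeta - eps) * X ^+ 2)).
  apply: ler_wpM2l; first exact: ltW.
  by rewrite -powR_mulrn //; apply: ler_powR.
have X2 : X ^+ 2 <= 1 + 48 * th by move: X1 Xle th0 th64; clear; nra.
apply: (@le_trans _ _ ((zeta - eps) * (1 + 48 * th))).
  by apply: ler_wpM2l => //; exact: ltW.
by move: thd ze e0 th0; clear; nra.
Qed.

(** * Completeness and soundness *)

(** What completeness and soundness use about distances, uniformly in the size of the universe. *)
Definition dist_bounds (R : realType) (p th lam : R) r m z y tabL tabR : Prop :=
  forall n (xs : seq nat) t w, let sg := alphabet (4 ^ r) m in let b := size (bits n) in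
  uniq xs -> size xs = z -> (forall x, x \in xs -> (x < n)%N) ->
  t \in tuples (unzip2 (codebook r sg n)) y -> w \in words sg b ->
  let X := sdist p (point tabL (bits n) (map (codeword r sg n) xs) w)
                   (center tabR (z - y).+1 (bits n) t) in
  [/\ {subset t <= map (codeword r sg n) xs} -> X <= b%:R * (1 + th),
     b%:R * (1 - th) <= X
   & ~ {subset t <= map (codeword r sg n) xs} -> b%:R * (1 - th) * lam `^ p <= X].

Lemma sum_const_seqR (R : realType) (T : Type) (s : seq T) (c : R) :
  \sum_(a <- s) c = (size s)%:R * c.
Proof. by rewrite big_const_seq count_predT iter_addr_0 mulr_natl. Qed.

Lemma reduction_complete (R : realType) (p th lam : R) r m z y d tabL tabR I :
  let J := reduction r m z y d tabL tabR I in
  0 < p -> good_params r m d tabL tabR -> dist_bounds p th lam r m z y tabL tabR -> (y < z)%N ->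
  jc_valid z I -> jc_complete y I ->
  exists C' sigma, @km_solution J C' sigma /\
    @km_cost R p J sigma <= (size (km_P J))%:R * ((size (bits (jc_n I)))%:R * (1 + th)) `^ (2 /
      p).
Proof.
move=> J p0 gp db yz vI [S [cS hS]]; have [uE _ cE] := vI.
have [us sq] := good_alphabet gp; have [r0 _ sL sR] := gp.
pose n := jc_n I; pose cw := codeword r (alphabet (4 ^ r) m) n.
pose tup i := map cw (raw_set (S i)).
have tupT i : tup i \in tuples (unzip2 (codebook r (alphabet (4 ^ r) m) n)) y.
  rewrite mem_tuples size_map size_raw_set cS eqxx /= map_inj_in_uniq ?uniq_raw_set /=.
    by apply/allP => _ /mapP[x /raw_set_lt xn ->]; apply: codeword_mem.
  by move=> x x' /raw_set_lt xn /raw_set_lt xn'; apply: (codeword_inj r0 us sq).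
pose ctr i := center tabR (z - y).+1 (bits n) (tup i).
pose C' : seq 'rV[rat]_(km_d J) := [seq vec (km_d J) (ctr i) | i <- enum 'I_(jc_k I)].
have near (a : 'rV[rat]_(km_d J)) : exists c : 'rV[rat]_(km_d J), a \in km_P J ->
    c \in C' /\ lp_norm p (map_mx ratr a - map_mx ratr c) ^+ 2 <=
      ((size (bits n))%:R * (1 + th)) `^ (2 / p) :> R.
  have [|na] := boolP (a \in km_P J); last by exists 0.
  move=> /mapP[s sP ->]; have [_ [w [/mapP[T TE ->] wW Es]]] := km_pointsP sP.
  have [i iT] := hS T TE; exists (vec (km_d J) (ctr i)) => _.
  split; first by apply: map_f; rewrite mem_enum.
  rewrite lp_norm_vec //; last 2 first.
  - exact: size_km_points gp vI sP.
  - by apply: (size_km_centers (z := z) gp yz); apply: map_f (tupT i).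
  rewrite Es; apply: ler_powRl; [by apply: divr_ge0 => //; apply: ltW|exact: sdist_ge0|].
  have [] := db n (raw_set T) (tup i) w (@uniq_raw_set _ T) _ (@raw_set_lt _ T) (tupT i) wW.
    by rewrite size_raw_set cE.
  move=> h _ _; apply: h => _ /mapP[x xi ->]; apply: map_f.
  move: xi => /mapP[j + ->]; rewrite mem_enum => ji.
  by rewrite mem_raw_set; apply: (fintype.subsetP iT).
have [sigma Hs] := choice near.
exists C', sigma; split; first split.
- by rewrite size_map size_enum_ord.
- move=> _ /mapP[i _ ->]; apply: map_f; exact: map_f (tupT i).
- by move=> a aP; have [] := Hs a aP.
rewrite /km_cost -sum_const_seqR big_seq [leRHS]big_seq; apply: ler_sum => a aP.
by have [_] := Hs a aP.
Qed.

(** The chosen centers are read back as y-sets [S i]. All copies of a set [T] obey the same lower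
    bound: at least [V] if some [S i] lies in [T], and at least [V * lam ^+ 2] otherwise. *)
Lemma reduction_sound (R : realType) (p th lam alpha : R) r m z y d tabL tabR I :
  let J := reduction r m z y d tabL tabR I in
  0 < p -> th <= 1 -> 1 <= lam ->
  good_params r m d tabL tabR -> dist_bounds p th lam r m z y tabL tabR -> (y < z)%N ->
  jc_valid z I -> jc_sound alpha y I -> forall C' sigma, @km_solution J C' sigma ->
  (size (km_P J))%:R * ((size (bits (jc_n I)))%:R * (1 - th)) `^ (2 / p)
     * (alpha + (1 - alpha) * lam ^+ 2) <= @km_cost R p J sigma.
Proof.
move=> J p0 th1 lam1 gp db yz vI hS C' sigma [szC subC sC]; have [uE _ cE] := vI.
have [us sq] := good_alphabet gp; have [r0 _ sL sR] := gp.
pose n := jc_n I; pose sg := alphabet (4 ^ r) m; pose cw := codeword r sg n.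
pose bs := bits n.
have p20 : 0 <= 2 / p by apply: divr_ge0 => //; apply: ltW.
have /choice[t Ht] : forall i : 'I_(jc_k I), exists t, t \in tuples (unzip2 (codebook r sg n))
  y /\
    nth 0 C' i = vec (km_d J) (center tabR (z - y).+1 bs t).
  move=> i; have /subC : nth 0 C' i \in C' by rewrite mem_nth // szC.
  by move=> /mapP[s /km_centersP[t tt ->] ->]; exists t.
(* Every word of the tuple [t i] is the codeword of exactly one element, so [S i] has exactly [y]
   elements. *)
pose S i : {set 'I_n} := [set x : 'I_n | cw (val x) \in t i].
have cS i : #|S i| = y.
  have := (Ht i).1; rewrite mem_tuples => /and3P[/eqP <- ut /allP tU].
  rewrite -size_raw_set -(size_map cw); apply: perm_size; apply: uniq_perm => //.
    rewrite map_inj_in_uniq ?uniq_raw_set // => x x' /raw_set_lt xn /raw_set_lt xn'.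
    exact: (codeword_inj r0 us sq).
  move=> v; apply/mapP/idP => [[x /mapP[j]]|vt].
    by rewrite mem_enum inE => jt -> ->.
  have [x xn E] := codeword_surj r0 us sq (tU v vt).
  by exists x => //; apply/mapP; exists (Ordinal xn); rewrite // mem_enum inE /= /cw -E.
pose cov (T : {set 'I_n}) := [exists i, S i \subset T].
have hcov : (count cov (jc_E I))%:R <= alpha * (size (jc_E I))%:R := hS S cS.
pose V := ((size bs)%:R * (1 - th)) `^ (2 / p).
have V0 : 0 <= V by apply: powR_ge0.
have bt0 : 0 <= (size bs)%:R * (1 - th) :> R by apply: mulr_ge0; rewrite ?ler0n // subr_ge0.
pose P (T : {set 'I_n}) (w : seq rat) := vec (km_d J) (point tabL bs (map cw (raw_set T)) w).
pose F a : R := lp_norm p (map_mx ratr a - map_mx ratr (sigma a)) ^+ 2.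
have PP T w : T \in jc_E I -> w \in words sg (size bs) ->
    point tabL bs (map cw (raw_set T)) w \in km_points r sg tabL n (map (@raw_set _) (jc_E I)).
  move=> TE wW; apply/allpairsP; exists (map cw (raw_set T), w); split => //=.
  by apply: map_f; apply: map_f.
have low T w : T \in jc_E I -> w \in words sg (size bs) ->
    V * (if cov T then 1 else lam ^+ 2) <= F (P T w).
  move=> TE wW; have aP : P T w \in km_P J by apply: map_f; apply: PP.
  have := sC _ aP => /(nthP 0)[i ik Ei]; rewrite szC in ik.
  have [tt Ec] := Ht (Ordinal ik).
  rewrite /F -Ei Ec lp_norm_vec //; last 2 first.
  - exact: size_km_points gp vI (PP T w TE wW).
  - by apply: (size_km_centers (z := z) gp yz); apply: map_f tt.
  have [] := db n (raw_set T) (t (Ordinal ik)) w (@uniq_raw_set _ T) _ (@raw_set_lt _ T) tt wW.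
    by rewrite size_raw_set cE.
  move=> _ h1 h2; case: ifP => [_|/negbT ncov].
    by rewrite mulr1; apply: ler_powRl.
  have -> : V * lam ^+ 2 = ((size bs)%:R * (1 - th) * lam `^ p) `^ (2 / p).
    rewrite [RHS]powRM ?powR_ge0 //; congr (_ * _).
    rewrite -powRrM mulrCA mulfV ?gt_eqF // mulr1 powR_mulrn //.
    by apply: le_trans lam1; apply: ler01.
  apply: ler_powRl => //; first by apply: mulr_ge0 => //; apply: powR_ge0.
  apply: h2 => sub; case: (negP ncov); apply/fintype.existsP; exists (Ordinal ik).
  apply/fintype.subsetP => x; rewrite inE => /sub /mapP[x' x'T /(codeword_inj r0 us sq)].
  move=> /(_ (ltn_ord x) (raw_set_lt x'T)) E; by rewrite -mem_raw_set E.
have -> : @km_cost R p J sigma = \sum_(T <- jc_E I) \sum_(w <- words sg (size bs)) F (P T w).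
  by rewrite /km_cost /= big_map big_allpairs_dep !big_map.
pose W := size (words sg (size bs)).
apply: (@le_trans _ _ (\sum_(T <- jc_E I) W%:R * (V * (if cov T then 1 else lam ^+ 2)))); last
  first.
  rewrite big_seq [leRHS]big_seq; apply: ler_sum => T TE.
  rewrite -sum_const_seqR big_seq [leRHS]big_seq; apply: ler_sum => w wW; exact: low.
have -> : size (km_P J) = (size (jc_E I) * W)%N.
  by rewrite size_reduction_points /W size_words size_alphabet.
rewrite -big_distrr -big_distrr /=.
have sumE (s : seq {set 'I_n}) : \sum_(T <- s) (if cov T then 1 else lam ^+ 2) =
    (count cov s)%:R + ((size s)%:R - (count cov s)%:R) * lam ^+ 2.
  elim: s => [|T s IH]; first by rewrite big_nil subrr mul0r addr0.
  by rewrite big_cons IH /= -addn1 !natrD; case: (cov T) => /=; ring.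
rewrite sumE natrM -/bs -/V.
set E := (size _)%:R in hcov *; set c := (count _ _)%:R in hcov *.
rewrite (_ : E * W%:R * V * _ = W%:R * (V * (E * (alpha + (1 - alpha) * lam ^+ 2)))); last by
  ring.
apply: ler_wpM2l; first exact: ler0n.
apply: ler_wpM2l => //.
(* Since [lam ^+ 2] is at least 1, the total decreases in the number of covered sets, and the bound
   alpha |E| on that number can be inserted. *)
have l1 : 1 <= lam ^+ 2 by rewrite expr_ge1 // (le_trans ler01).
by move: hcov l1; clear; set L := lam ^+ 2; nra.
Qed.

Theorem theorem3p12 (R : realType) (p : R) (hp : 1 <= p)
    (z y : nat) (hy : (1 <= y)%N) (hyz : (y < z)%N)
    (alpha : R) (halpha0 : 0 <= alpha) (halpha1 : alpha < 1)
    (hjc : johnson_coverage_NP_hard alpha z y) :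
  forall epsilon : R, 0 < epsilon ->
  exists2 rho : R, 0 < rho &
  exists D K : nat,
    NP_hard (km_yes p D K rho)
            (km_no p D K rho (zeta2 p (z - y) alpha - epsilon)).
Proof.
move=> eps eps0; have p0 : 0 < p by apply: lt_le_trans hp; apply: ltr01.
set zeta := zeta2 _ _ _; pose g := fine (gamma p (z - y)).
have zetaE : zeta = 1 + (1 - alpha) * (g ^+ 2 - 1) by [].
have [M M0 gadget] := johnson_gadget hp hy hyz.
(* The value for which [slack] is stated; it is at most 1 / 64 and at most [eps]. *)
pose th := eps / (64 * (`|zeta| + 1 + eps)).
have den : 0 < 64 * (`|zeta| + 1 + eps).
  by have := normr_ge0 zeta; move: eps0; clear; lra.
have th0 : 0 < th by apply: divr_gt0.
have th64 : th <= 1 / 64.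
  by rewrite /th ler_pdivrMr //; have := normr_ge0 zeta; move: eps0; clear; lra.
have theps : th <= eps.
  rewrite /th ler_pdivrMr //; have := normr_ge0 zeta; move: eps0; clear; set a := `|zeta|; nra.
have th1 : th <= 1 by move: th64; clear; lra.
(* The first summand makes collisions negligible, the second makes z at most th r, so that |E|
   hardly affects ln N. The third makes r at least z, which gives enough letters and few enough
   centers. *)
pose r := (Num.truncn (4 * (M + 1) * ((z + y) ^ 2)%:R / th + z%:R / th) + z).+1.
(* The z + 1 tag blocks, with entries of size at most 1 / m, then add at most b th / 4. *)
pose m := (Num.truncn (4 * z.+1%:R / th)).+1.
have r0 : (0 < r)%N by [].
have m0 : (0 < m)%N by [].
have rbig : 4 * (M + 1) * ((z + y) ^ 2)%:R / th + z%:R / th <= r%:R.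
  apply: le_trans (ltW (truncnS_gt _)) _; rewrite ler_nat ltnS; exact: leq_addr.
have a1 : 0 <= 4 * (M + 1) * ((z + y) ^ 2)%:R / th.
  by rewrite divr_ge0 ?(ltW th0) // !mulr_ge0 ?ler0n //; move: M0; clear; lra.
have a2 : 0 <= z%:R / th by rewrite divr_ge0 ?ler0n ?(ltW th0).
have hr : 4 * (M + 1) * ((z + y) ^ 2)%:R <= th * r%:R.
  by rewrite [leRHS]mulrC -ler_pdivrMr //; move: rbig a2; clear; lra.
have hz : z%:R <= th * r%:R.
  by rewrite [leRHS]mulrC -ler_pdivrMr //; move: rbig a1; clear; lra.
have hm : 4 * z.+1%:R <= th * m%:R.
  by rewrite [leRHS]mulrC -ler_pdivrMr //; exact: ltW (truncnS_gt _).
have zr : (z <= r)%N by rewrite /r; apply: leqW; apply: leq_addl.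
have zq : (z <= 4 ^ r)%N by apply: leq_trans zr (ltnW (ltn_expl _ _)).
have th40 : 0 < th / 4 by move: th0; clear; lra.
have th41 : th / 4 <= 1 by move: th1; clear; lra.
have [lam [d [gL [gR [lam1 lamg gs gM gE]]]]] := gadget (4 ^ r)%N (th / 4) zq th40 th41.
pose tabL := gL \o key_set (4 ^ r) m; pose tabR := gR \o key_set (4 ^ r) m.
have gp : good_params r m d tabL tabR.
  by split=> // k; rewrite /= ?(gs _).1 ?(gs _).2.
have db : dist_bounds p th lam r m z y tabL tabR.
  move=> n xs t w sg b ux sx xn tt wW X.
  exact: (point_center_dist hp r0 m0 hy hyz M0 lam1 th0 th1 hr hm gs gM gE ux sx xn tt wW).
(* [c * b] is ln 4^(r b), the main part of ln N. With [rho] as below the threshold is N ((1 + th) /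
   c * ln N)^(2/p), so the lower bound on ln N already places it above the cost of the complete
   case. *)
pose c : R := 2 * r%:R * ln 2.
have l2 := ln2_bound R.
have c0 : 0 < c by rewrite !mulr_gt0 // ltr0n.
pose rho := ((1 + th) / c) `^ (2 / p).
have t1c : 0 < (1 + th) / c by apply: divr_gt0 => //; move: th0; clear; lra.
have p20 : 0 <= 2 / p by apply: divr_ge0 => //; apply: ltW.
exists rho; first exact: powR_gt0.
pose D := (Num.truncn ((d + z.+1)%:R / ln 2 : R)).+1.
have hD : (d + z.+1)%:R <= D%:R * ln (2 : R).
  by rewrite -ler_pdivrMr //; apply: ltW (truncnS_gt _).
exists D, 1%N => L HL; have [f pf Hf] := hjc L HL.
(* The instance is selected classically, depending on whether [x] is in [L]. The program never sees
   this choice: it works on the code [f x], as [ptime_reindex] allows. *)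
have /choice[I HI] : forall x, exists I, [/\ f x = enc_jc I, jc_valid z I,
    L x -> jc_complete y I & ~ L x -> jc_sound alpha y I].
  move=> x; have [Lx|nLx] := pselect (L x).
    by have [I [h1 h2 h3]] := (Hf x).1 Lx; exists I.
  by have [I [h1 h2 h3]] := (Hf x).2 nLx; exists I.
exists (fun x => enc_km (reduction r m z y d tabL tabR (I x))).
  apply: poly_time_of_ptime; apply: (ptime_trans (ptime_of_poly_time pf)).
  apply: (ptime_reindex (ptime_reduction gp hyz)) => x _; exists (I x).
  by have [-> vI _ _] := HI x; split.
move=> x; have [_ vI hc hs] := HI x.
have vJ : km_valid R D 1 (reduction r m z y d tabL tabR (I x)).
  by apply: km_valid_reduction => //; apply: leq_trans (ltnW hyz) zr.
have [N0 _ lnlo lnhi] := @ln_points R r m z y d tabL tabR (I x) vI.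
set J := reduction r m z y d tabL tabR (I x) in N0 lnlo lnhi vJ *.
set b := size (bits (jc_n (I x))) in lnlo lnhi.
set N := size (km_P J) in N0 lnlo lnhi.
have b0 : 0 <= b%:R :> R by rewrite ler0n.
have lnN0 : 0 <= ln N%:R :> R.
  by apply: le_trans lnlo; apply: mulr_ge0; rewrite ?ler0n // ltW.
have thE : km_threshold p rho J = N%:R * ((1 + th) / c * ln N%:R) `^ (2 / p).
  by rewrite /km_threshold -/N mulrAC mulrC powRM // ltW.
split=> hL.
- have [C' [sigma [sol cost]]] := reduction_complete p0 gp db hyz vI (hc hL).
  exists J; split => //; exists C', sigma; split => //.
  apply: le_trans cost _; rewrite -/b -/J -/N thE ler_wpM2l ?ler0n //.
  have E : (1 + th) / c * (b%:R * c) = b%:R * (1 + th).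
    by rewrite mulrCA divfK // gt_eqF.
  apply: ler_powRl => //.
    by apply: mulr_ge0 => //; move: th0; clear; lra.
  rewrite -E; apply: ler_wpM2l; first exact: ltW.
  apply: le_trans lnlo; rewrite !natrM /c le_eqVlt; apply/orP; left; apply/eqP; ring.
- exists J; split => // C' sigma sol.
  have cost := reduction_sound p0 th1 lam1 gp db hyz vI (hs hL) sol.
  apply: le_trans cost; rewrite -/b -/J -/N.
  have th1' : 0 <= 1 - th by rewrite subr_ge0.
  (* The gadget loses th / 4, at most eps / 4, in the square of the gap, and 1 - alpha is at most
     1. *)
  have lz : zeta - eps / 4 <= alpha + (1 - alpha) * lam ^+ 2.
    rewrite zetaE; have : g ^+ 2 - th / 4 <= lam ^+ 2 := lamg.
    by move: theps th0 halpha0 halpha1; clear; set G := g ^+ 2; set Q := lam ^+ 2; nra.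
  have al0 : 0 <= alpha + (1 - alpha) * lam ^+ 2.
    apply: addr_ge0 => //; apply: mulr_ge0; first by move: halpha1; clear; lra.
    exact: sqr_ge0.
  (* For a nonpositive factor the bound is trivial because costs are nonnegative; [slack] handles
     the other case. *)
  have [ze|ze] := leP (zeta - eps) 0.
    apply: (@le_trans _ _ 0).
      by apply: mulr_le0_ge0 => //; rewrite thE; apply: mulr_ge0; [exact: ler0n|exact: powR_ge0].
    by apply: mulr_ge0 => //; apply: mulr_ge0; [exact: ler0n|exact: powR_ge0].
  (* Here ln N is at most (2 r + z) b ln 2, hence at most (1 + th) c b. This second factor 1 + th
     explains the square in [slack]. *)
  have up : km_threshold p rho J <= N%:R * (b%:R `^ (2 / p) * ((1 + th) ^+ 2) `^ (2 / p)).
    rewrite thE; apply: ler_wpM2l; first exact: ler0n.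
    rewrite -powRM ?sqr_ge0 //; apply: ler_powRl => //.
      by apply: mulr_ge0 => //; apply: ltW.
    have E : (1 + th) / c * (b%:R * ((1 + th) * c)) = b%:R * (1 + th) ^+ 2.
      by rewrite expr2 -[RHS]mulr1 -(divff (lt0r_neq0 c0)); ring.
    rewrite -E; apply: ler_wpM2l; first exact: ltW.
    apply: le_trans lnhi _; rewrite natrM natrD natrM.
    have h : z%:R <= 2 * (th * r%:R) :> R.
      by apply: le_trans hz _; have : 0 <= th * r%:R; [apply: mulr_ge0; rewrite ?ler0n //
        ltW|lra].
    have -> : b%:R * ((1 + th) * c) = (2 * r%:R + 2 * (th * r%:R)) * b%:R * ln 2 by rewrite /c;
      ring.
    by rewrite ler_wpM2r ?(ltW l2) // ler_wpM2r // lerD2l.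
  apply: le_trans (ler_wpM2l (ltW ze) up) _.
  rewrite mulrCA [b%:R * (1 - th)]mulrC (powRM _ th1' b0) -!mulrA; apply: ler_wpM2l; first
    exact: ler0n.
  rewrite mulrCA [leRHS]mulrCA; apply: ler_wpM2l; first exact: powR_ge0.
  apply: le_trans (slack hp eps0 erefl ze) _; rewrite mulrC.
  by apply: ler_wpM2l => //; apply: powR_ge0.
Qed.
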